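(* Let $a\in\mathbb{C}$ and $f_a(z)=e^z+a$. Suppose that the escaping set $I(f_a)$ has a path-connected component that is dense in the Julia set $J(f_a)$. Then the set $\tilde{E}(f_a)$ of escaping endpoints of $f_a$ is connected.
   Context: For $a\in\mathbb{C}$, $f_a\colon\mathbb{C}\to\mathbb{C}$, $f_a(z)=e^z+a$. The Julia set $J(f_a)$ is the set of points at which the iterates $(f_a^n)$ are not equicontinuous with respect to the spherical metric. $I(f_a)=\{z\in\mathbb{C}: f_a^n(z)\to\infty\}$ is the escaping set. An arc is an injective continuous image of a compact interval (parametrised injectively). A point $z_0\in\mathbb{C}$ is on a hair if there is an arc $\gamma\colon[-1,1]\to I(f_a)$ with $\gamma(0)=z_0$. A point $z_0\in\mathbb{C}$ is an endpoint if $z_0$ is not on a hair and there is an arc $\gamma\colon[0,1]\to\mathbb{C}$ with $\gamma(0)=z_0$ and $\gamma(t)\in I(f_a)$ for all $t>0$. $E(f_a)$ is the set of endpoints, and $\tilde{E}(f_a)=E(f_a)\cap I(f_a)$ is the set of escaping endpoints. *)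

(* Defs.v *)
From HB Require Import structures.
From mathcomp Require Import all_boot all_order all_algebra.
From mathcomp Require Import all_classical all_reals all_analysis.
From mathcomp.real_closed Require Import complex.

Set Implicit Arguments.
Unset Strict Implicit.
Unset Printing Implicit Defensive.

Import Order.TTheory GRing.Theory Num.Theory.
Import numFieldNormedType.Exports.
Import Normc.
Local Open Scope classical_set_scope.
Local Open Scope complex_scope.
Local Open Scope ring_scope.

(* The Euclidean topology on R[i], transported from the topology that every
   numFieldType carries; the library does not register it on R[i] itself. *)
HB.instance Definition _ (R : rcfType) := NormedModule.copy R[i] R[i]^o.

Section Paths.
Variables (R : realType) (T : topologicalType).

Definition is_arc (a b : R) (gamma : R -> T) : Prop :=
  {within `[a, b], continuous gamma} /\ set_inj `[a, b] gamma.

(* Empty when x is not in A. *)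
Definition path_component (A : set T) (x : T) : set T :=
  [set y | exists gamma : R -> T,
    [/\ {within `[0, 1], continuous gamma}, gamma 0 = x, gamma 1 = y &
        forall t : R, 0 <= t <= 1 -> A (gamma t)]].

End Paths.

Section ExponentialMaps.
Variable R : realType.
Local Notation C := R[i].

Definition cexp (z : C) : C :=
  (expR (complex.Re z) * cos (complex.Im z)) +i*
  (expR (complex.Re z) * sin (complex.Im z)).

Definition expmap (a z : C) : C := cexp z + a.

(* Geodesic distance on the unit sphere (density 2|dz|/(1+|z|^2)), pulled back
   by stereographic projection; the argument of asin is half the chordal
   distance, hence lies in [0, 1]. *)
Definition spherical_dist (z w : C) : R :=
  2 * asin (normc (z - w) /
            (Num.sqrt (1 + normc z ^+ 2) * Num.sqrt (1 + normc w ^+ 2))).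

Definition spherically_equicontinuous_at (F : nat -> C -> C) (z : C) : Prop :=
  forall e : R, 0 < e ->
    \forall w \near z, forall n, spherical_dist (F n w) (F n z) < e.

Definition julia (f : C -> C) : set C :=
  [set z | ~ spherically_equicontinuous_at (fun n => iter n f) z].

Definition escaping (f : C -> C) : set C :=
  [set z | (fun n => normc (iter n f z)) @ \oo --> +oo].

Definition on_hair (f : C -> C) (z : C) : Prop :=
  exists gamma : R -> C,
    [/\ is_arc (- 1) 1 gamma, forall t : R, - 1 <= t <= 1 -> escaping f (gamma t) &
        gamma 0 = z].

Definition endpoints (f : C -> C) : set C :=
  [set z | ~ on_hair f z /\
    exists gamma : R -> C,
      [/\ is_arc 0 1 gamma, gamma 0 = z &
          forall t : R, 0 < t <= 1 -> escaping f (gamma t)]].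

Definition escaping_endpoints (f : C -> C) : set C :=
  endpoints f `&` escaping f.

End ExponentialMaps.

(* Main.v *)
Require Import Defs.
From mathcomp Require Import all_boot all_order all_algebra.
From mathcomp Require Import all_classical all_reals all_analysis.
From mathcomp.real_closed Require Import complex.
From mathcomp Require Import zify ring lra.

(* Far to the right, the points with a given itinerary through the strips
   |Im z - 2 k pi| < pi / 2 form a hair, a curve [Phi w T] issuing from a point w, and
   a hair is totally ordered by the real parts of the iterates of its points.

   The core is that every path in the escaping set escapes uniformly.  A Baire
   category argument reduces this to extending uniform escape to one end of a
   path, and there planarity enters through two elementary winding facts: two
   curves crossing a rectangle meet, and a long vertical displacement forces a
   chord of length 2 pi i.  Consequently some iterate maps a given path of the
   escaping set into a single hair.

   The initial point of a hair is an escaping endpoint as soon as the imaginary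
   parts of its iterates grow, and such tips accumulate at every point of such a hair.
   Suppose that disjoint relatively open sets given by U and V covered the endpoints.
   Since the escaping set lies in the Julia set, the dense path component meets both U
   and V, so a lifted piece of hair runs from U to V.  Replacing it by hairs of
   tips yields nested discs, each containing a lifted piece of hair from a tip in U to
   a point outside the closure of the tips in U.  The discs shrink to a tip, which
   has to be in U; near it all tips are in U, and they accumulate at the far
   end of those pieces of hair, a contradiction. *)

Set Implicit Arguments.
Unset Strict Implicit.
Unset Printing Implicit Defensive.

Import Order.TTheory GRing.Theory Num.Theory.
Import numFieldNormedType.Exports.
Import Normc.
Local Open Scope classical_set_scope.
Local Open Scope complex_scope.
Local Open Scope ring_scope.

(** Everything is first known up to a bounded error, which expansion then removes: where the real
    part is at least [normc a + 144], inverse branches contract by 16, so two orbits with one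
    itinerary that stay a bounded distance apart coincide. Hence a hair need only be prescribed up
    to an error of 10, and the margins 20, 50, 100, 200 over [R0] absorb the losses incurred
    whenever a point is replaced by one on its hair or by one with a shifted itinerary. The obstacle
    to straightening a path is that its points may return far to the left at arbitrarily late times;
    uniform escape excludes this, so that a single iterate handles the whole path. The obstacle in
    the separation argument is that tips do not form a closed set: a sequence of tips may converge
    to a point inside a hair. Two devices meet this. The condition [fast] concerns the itinerary
    alone, is closed, and makes tips dense along hairs. And each disc carries a bound on how far
    back a hair through the images of its points can begin, which forces the limit point to be a
    tip. *)

Local Notation re := complex.Re.
Local Notation im := complex.Im.

Ltac only_ineqs := repeat match goal with
  | H : ?T |- _ => lazymatch type of T with Prop => lazymatch T with
      | is_true (Order.le _ _) => fail
      | is_true (Order.lt _ _) => fail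
      | is_true (andb _ _) => fail
      | @eq _ _ _ => fail
      | _ => clear H
      end end
  end.
Ltac flra := first [only_ineqs; lra | lra].

(** * The complex exponential *)

Section ComplexBasics.
Variable R : realType.
Local Notation C := R[i].
Implicit Types (z w u v : C) (x y t r : R).

Lemma reD z w : re (z + w) = re z + re w. Proof. by case: z w => ? ? []. Qed.
Lemma imD z w : im (z + w) = im z + im w. Proof. by case: z w => ? ? []. Qed.
Lemma reN z : re (- z) = - re z. Proof. by case: z. Qed.
Lemma imN z : im (- z) = - im z. Proof. by case: z. Qed.
Lemma reM z w : re (z * w) = re z * re w - im z * im w.
Proof. by case: z w => ? ? []. Qed.
Lemma imM z w : im (z * w) = re z * im w + im z * re w.
Proof. by case: z w => ? ? []. Qed.
Lemma re0 : re (0 : C) = 0. Proof. by []. Qed.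
Lemma im0 : im (0 : C) = 0. Proof. by []. Qed.
Lemma re1 : re (1 : C) = 1. Proof. by []. Qed.
Lemma im1 : im (1 : C) = 0. Proof. by []. Qed.
Definition reimE := (reD, imD, reN, imN, reM, imM, re0, im0, re1, im1).

Lemma complex_ext z w : re z = re w -> im z = im w -> z = w.
Proof. by case: z w => ? ? [? ?] /= -> ->. Qed.

Lemma normc_ge0 z : 0 <= normc z.
Proof. by case: z => x y; rewrite /normc sqrtr_ge0. Qed.

Lemma sqr_normcE z : normc z ^+ 2 = re z ^+ 2 + im z ^+ 2.
Proof. by case: z => x y; rewrite /normc sqr_sqrtr // addr_ge0 ?sqr_ge0. Qed.

Lemma normc_re z : `|re z| <= normc z.
Proof.
rewrite -(@ler_pXn2r _ 2) ?nnegrE ?normc_ge0 // sqr_normcE real_normK ?num_real //.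
by rewrite lerDl sqr_ge0.
Qed.

Lemma normc_im z : `|im z| <= normc z.
Proof.
rewrite -(@ler_pXn2r _ 2) ?nnegrE ?normc_ge0 // sqr_normcE real_normK ?num_real //.
by rewrite lerDr sqr_ge0.
Qed.

Lemma normc_le_reim z : normc z <= `|re z| + `|im z|.
Proof.
rewrite -(@ler_pXn2r _ 2) ?nnegrE ?normc_ge0 ?addr_ge0 // sqr_normcE sqrrD.
rewrite !real_normK ?num_real //.
have := mulr_ge0 (normr_ge0 (re z)) (normr_ge0 (im z)); flra.
Qed.

Lemma ler_normcD z w : normc (z + w) <= normc z + normc w.
Proof. exact: le_normcD. Qed.

Lemma normcB z w : normc (z - w) = normc (w - z).
Proof. by rewrite -normcN opprB. Qed.

Lemma ler_normcB z w : normc (z - w) <= normc z + normc w.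
Proof. by rewrite -[normc w]normcN; exact: ler_normcD. Qed.

Lemma ler_normc_dist z w : `|normc z - normc w| <= normc (z - w).
Proof.
have h1 := ler_normcD (z - w) w; have h2 := ler_normcD (w - z) z.
rewrite !subrK (normcB w) in h1 h2 *; rewrite ler_norml; flra.
Qed.

Lemma ler_normc_tri u z w : normc (z - w) <= normc (z - u) + normc (u - w).
Proof. by rewrite -[in leLHS](subrK u z) -addrA; exact: ler_normcD. Qed.

Lemma normc_eq0 z : normc z <= 0 -> z = 0.
Proof. by move=> h; apply: eq0_normc; apply/eqP; rewrite eq_le h normc_ge0. Qed.

Lemma normc_gt0 z : z != 0 -> 0 < normc z.
Proof.
move=> z0; rewrite lt_neqAle normc_ge0 andbT eq_sym; apply: contra z0 => /eqP.
by move/(@eq0_normc R) => ->.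
Qed.

Lemma eq_small z w : (forall e, 0 < e -> normc (z - w) <= e) -> z = w.
Proof.
move=> h; apply/eqP; rewrite -subr_eq0; apply/eqP/normc_eq0.
by apply/ler_addgt0Pr => e e0; rewrite add0r h.
Qed.

Lemma normc_real x : normc (x%:C) = `|x|.
Proof. by rewrite /normc /= expr0n /= addr0 sqrtr_sqr. Qed.

Lemma normc_imag x : normc (0 +i* x) = `|x|.
Proof. by rewrite /normc /= expr0n /= add0r sqrtr_sqr. Qed.

Lemma normc_cis x y : 0 <= x -> normc ((x * cos y) +i* (x * sin y)) = x.
Proof.
move=> x0; rewrite /normc /= !exprMn -mulrDr cos2Dsin2 mulr1 sqrtr_sqr.
by rewrite ger0_norm.
Qed.

Lemma normc_cexp z : normc (cexp z) = expR (re z).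
Proof. by rewrite normc_cis // expR_ge0. Qed.

Lemma cexpD z w : cexp (z + w) = cexp z * cexp w.
Proof.
by apply: complex_ext; rewrite /cexp ?reimE /= ?reimE expRD ?cosD ?sinD; ring.
Qed.

Lemma cexp0 : cexp 0 = 1 :> C.
Proof.
by apply: complex_ext; rewrite /cexp /= expR0 ?cos0 ?sin0; ring.
Qed.

Lemma cexp_neq0 z : cexp z != 0.
Proof.
apply: contraTneq (expR_gt0 (re z)) => h.
by rewrite -normc_cexp h normc0 ltxx.
Qed.

Lemma cexpN z : cexp (- z) = (cexp z)^-1.
Proof.
apply: (mulfI (cexp_neq0 z)); rewrite divff ?cexp_neq0 //.
by rewrite -cexpD subrr cexp0.
Qed.

Lemma cexpB z w : cexp (z - w) = cexp z / cexp w.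
Proof. by rewrite cexpD cexpN. Qed.

Lemma pi_lt4 : pi < 4 :> R.
Proof. have := @pihalf_lt2 R; flra. Qed.

Definition twopi : R := 2 * pi.

Lemma twopi_ge4 : 4 <= twopi.
Proof. have := @pi_ge2 R; rewrite /twopi; flra. Qed.
Lemma twopi_lt8 : twopi < 8.
Proof. have := pi_lt4; rewrite /twopi; flra. Qed.

Lemma cos_2pin x (k : int) : cos (x + twopi * k%:~R) = cos x.
Proof.
have h n t : cos (t + twopi * n%:R) = cos t.
  rewrite -[RHS](periodicn (@cosD2pi R) n t); congr (cos (t + _)).
  by rewrite /twopi -[RHS]mulr_natr -[pi *+ 2]mulr_natl.
case: k => n; first by rewrite h.
rewrite NegzE intrN mulrN -(h n.+1 (x - _)); congr cos.
by rewrite subrK.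
Qed.

Lemma sin_2pin x (k : int) : sin (x + twopi * k%:~R) = sin x.
Proof.
have := cos_2pin (x - pi / 2) k; rewrite cosBpihalf => <-.
by rewrite -cosBpihalf; congr cos; ring.
Qed.

Definition ipi (k : int) : C := 0 +i* (twopi * k%:~R).

Lemma cexp_ipi z k : cexp (z + ipi k) = cexp z.
Proof.
by rewrite /cexp !reimE /= addr0 cos_2pin sin_2pin.
Qed.

Lemma near_2pin x : exists k : int, `|x - twopi * k%:~R| <= pi.
Proof.
have tp := @pi_gt0 R.
exists (Num.floor ((x + pi) / twopi)).
have := floor_itv ((x + pi) / twopi); set k := Num.floor _.
rewrite /twopi ler_pdivlMr ?ltr_pdivrMr ?mulr_gt0 // intrD => /andP[h1 h2].
rewrite ler_norml; nra.
Qed.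

Lemma cos_eq1 x : cos x = 1 -> exists k : int, x = twopi * k%:~R.
Proof.
move=> h; have [k hk] := near_2pin x; exists k.
have : cos `|x - twopi * k%:~R| = cos 0.
  by rewrite cos_norm cos0 -mulrN -intrN cos_2pin.
move/cos_inj; rewrite !in_itv /= normr_ge0 hk lexx pi_ge0 => /(_ isT isT)/eqP.
by rewrite normr_eq0 subr_eq0 => /eqP.
Qed.

Lemma cexp_eq z w : cexp z = cexp w -> exists k, z = w + ipi k.
Proof.
move=> h.
have hr : re z = re w by apply: expR_inj; rewrite -!normc_cexp h.
have [hc hs] : cos (im z) = cos (im w) /\ sin (im z) = sin (im w).
  move: h; rewrite /cexp hr => -[] /(mulfI (lt0r_neq0 (expR_gt0 _))) ->.
  by move/(mulfI (lt0r_neq0 (expR_gt0 _))).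
have : cos (im z - im w) = 1 by rewrite cosB hc hs -!expr2 cos2Dsin2.
move/cos_eq1 => [k hk]; exists k; apply: complex_ext; rewrite !reimE /=.
  by rewrite addr0.
by rewrite -hk; ring.
Qed.

Lemma cos_gt0_strip x : 0 < cos x -> exists k : int, `|x - twopi * k%:~R| < pi / 2.
Proof.
move=> h; have [k hk] := near_2pin x; exists k.
have hc : cos `|x - twopi * k%:~R| = cos x by rewrite cos_norm -mulrN -intrN cos_2pin.
rewrite ltNge; apply/negP => h2.
have : cos `|x - twopi * k%:~R| <= cos (pi / 2).
  have p0 := @pi_gt0 R; move: h2; rewrite le_eqVlt => /orP[/eqP <-//|h2].
  by rewrite ltW // ltr_cos ?in_itv /=; flra.
by rewrite hc cos_pihalf leNgt h.
Qed.

Lemma int_small (k l : int) : `|twopi * k%:~R - twopi * l%:~R| < twopi -> k = l.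
Proof.
rewrite -mulrBr -intrB normrM; have t4 := twopi_ge4.
rewrite (ger0_norm (_ : 0 <= twopi)); last by flra.
rewrite -[X in _ < X]mulr1 ltr_pM2l; last by flra.
rewrite -intr_norm -[1]/(1%:~R) ltr_int => h.
by apply/eqP; rewrite -subr_eq0 -normr_le0; lia.
Qed.

(** The components of the preimage of the right half-plane under [cexp]; on each of them [cexp] is
    inverted by a translate of [Log]. *)
Definition strip (k : int) z := `|im z - twopi * k%:~R| < pi / 2.

Lemma strip_uniq k l z : strip k z -> strip l z -> k = l.
Proof.
rewrite /strip => h1 h2; apply: int_small; have := @pi_gt0 R.
rewrite /twopi in h1 h2 *; move: h1 h2; rewrite !ltr_norml; flra.
Qed.

Lemma strip_close k l z w : strip k z -> strip l w -> `|im z - im w| < pi -> k = l.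
Proof.
rewrite /strip => h1 h2 h3; apply: int_small.
rewrite /twopi in h1 h2 *; move: h1 h2 h3; rewrite !ltr_norml; flra.
Qed.

Lemma strip_dist k z w : strip k z -> strip k w -> `|im z - im w| < pi.
Proof. by rewrite /strip !ltr_norml; flra. Qed.

End ComplexBasics.

(** * Logarithm and compactness *)

Section RealAnalysis.
Variable R : realType.
Local Notation C := R[i].
Implicit Types (z w u v : C) (x y t r : R).

Lemma lip1 (f df : R -> R) :
  (forall x, is_derive x 1 f (df x)) -> (forall x, `|df x| <= 1) ->
  forall x y, `|f x - f y| <= `|x - y|.
Proof.
move=> fd df1; suff H x y : x <= y -> `|f x - f y| <= `|x - y|.
  move=> x y; case: (leP x y) => [|/ltW] /H //.
  by rewrite (distrC (f y)) (distrC y).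
move=> xy; have [c _ h] := @MVT_segment _ f df x y xy (fun c _ => fd c)
  (derivable_within_continuous (fun c _ => @ex_derive _ _ _ _ _ _ _ (fd c))).
rewrite distrC h normrM (distrC x) -[leRHS]mul1r ler_wpM2r //.
Qed.

Lemma atan_lip x y : `|atan x - atan y| <= `|x - y|.
Proof.
apply: (@lip1 _ (fun x => (1 + x ^+ 2)^-1)) => t.
rewrite normfV invf_le1 ?normr_gt0; have := sqr_ge0 t.
  by move=> h; rewrite ger0_norm; flra.
by move=> h; rewrite gt_eqF; flra.
Qed.

Lemma sin_lip x y : `|sin x - sin y| <= `|x - y|.
Proof. by apply: (@lip1 _ cos) => t; exact: cos_max. Qed.

Lemma cos_lip x y : `|cos x - cos y| <= `|x - y|.
Proof. by apply: (@lip1 _ (fun t => - sin t)) => t; rewrite normrN; exact: sin_max. Qed.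

(** Meant for [0 < re u] only, where this arctangent is the principal argument. *)
Definition Log u : C := (ln (normc u)) +i* (atan (im u / re u)).

Lemma cos_sin_Log u : 0 < re u ->
  normc u * cos (im (Log u)) = re u /\ normc u * sin (im (Log u)) = im u.
Proof.
move=> u0; rewrite /Log /=; set q := im u / re u.
have hn : normc u = re u * Num.sqrt (1 + q ^+ 2).
  apply/eqP; rewrite -(@eqrXn2 _ 2) ?normc_ge0 //; last first.
    by rewrite mulr_ge0 ?sqrtr_ge0 ?ltW.
  rewrite sqr_normcE exprMn sqr_sqrtr ?addr_ge0 ?sqr_ge0 ?ler01 //.
  by rewrite /q; apply/eqP; field; rewrite gt_eqF.
have s0 : 0 < Num.sqrt (1 + q ^+ 2).
  by rewrite sqrtr_gt0; have := sqr_ge0 q; flra.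
have hc : normc u * cos (atan q) = re u.
  by rewrite hn cos_atan -mulrA mulfV ?mulr1 // gt_eqF.
split => //.
have hs : sin (atan q) = q * cos (atan q).
  have c0 : cos (atan q) != 0 by rewrite cos_atan invr_eq0 gt_eqF.
  by rewrite -{2}(atanK q) /tan mulfVK.
by rewrite hs mulrCA hc /q mulfVK // gt_eqF.
Qed.

Lemma cexp_Log u : 0 < re u -> cexp (Log u) = u.
Proof.
move=> u0; have [hc hs] := cos_sin_Log u0.
have n0 : 0 < normc u.
  by apply: lt_le_trans u0 _; apply: le_trans (normc_re _); exact: ler_norm.
by apply: complex_ext; rewrite /cexp [expR _]lnK ?posrE //=.
Qed.

Lemma re_Log u : re (Log u) = ln (normc u). Proof. by []. Qed.

Lemma im_Log u : `|im (Log u)| < pi / 2.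
Proof. by rewrite ltr_norml atan_ltpi2 atan_gtNpi2. Qed.

Lemma Log1 : Log 1 = 0 :> C.
Proof.
apply: complex_ext; first by rewrite re_Log normc1 ln1.
by rewrite /Log [LHS]/= im1 mul0r atan0.
Qed.

Lemma ln_lip r x y : 0 < r -> r <= x -> r <= y -> `|ln x - ln y| <= `|x - y| / r.
Proof.
move=> r0; suff H a b : r <= a -> r <= b -> ln a - ln b <= `|a - b| / r.
  by move=> rx ry; rewrite ler_norml H // lerNl opprB distrC H.
move=> ra rb; have a0 := lt_le_trans r0 ra; have b0 := lt_le_trans r0 rb.
rewrite -ln_div ?posrE // -[a / b](addrNK 1) addrC.
have h : a / b - 1 = (a - b) / b by field; rewrite gt_eqF.
apply: le_trans (@le_ln1Dx _ _ _) _.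
  by have := divr_gt0 a0 b0; flra.
rewrite h; apply: le_trans (ler_norm _) _.
rewrite normrM normfV (ger0_norm (ltW b0)) ler_wpM2l // lef_pV2 ?posrE //.
Qed.

(** The real part costs 1 by [ln_lip], the argument at most 8. If [s] is at least 1/2, the trivial
    bound pi on the difference of arguments suffices. Otherwise a cross product bounds the sine of
    that difference by [s], the law of cosines makes its cosine positive, and the difference is the
    arctangent of its tangent. *)
Lemma Log_lip r u v : 0 < r -> r <= re u -> r <= re v ->
  normc (Log u - Log v) <= 9 * normc (u - v) / r.
Proof.
move=> r0 ru rv.
have nu : r <= normc u by apply: le_trans ru (le_trans (ler_norm _) (normc_re _)).
have nv : r <= normc v by apply: le_trans rv (le_trans (ler_norm _) (normc_re _)).
have u0 := lt_le_trans r0 ru; have v0 := lt_le_trans r0 rv.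
set s := normc (u - v) / r.
have s0 : 0 <= s by rewrite divr_ge0 ?normc_ge0 ?ltW.
suff H : `|im (Log u) - im (Log v)| <= 8 * s.
  apply: le_trans (normc_le_reim _) _; rewrite !reimE !re_Log.
  have h1 : `|ln (normc u) - ln (normc v)| <= s.
    apply: le_trans (ln_lip r0 nu nv) _.
    by apply: ler_wpM2r; [rewrite invr_ge0 ltW|exact: ler_normc_dist].
  rewrite -mulrA -/s; flra.
have := im_Log u; have := im_Log v; have [cu su] := cos_sin_Log u0.
have [cv sv] := cos_sin_Log v0.
move: cu su cv sv; set A := im (Log u); set B := im (Log v) => cu su cv sv hB hA.
have p4 := @pi_lt4 R.
case: (lerP (2^-1) s) => hs.
  by move: hA hB; rewrite !ltr_norml ler_norml; flra.
have nu0 : 0 < normc u by flra.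
have nv0 : 0 < normc v by flra.
have hsn : `|sin (A - B)| <= s.
  have e1 : normc u * normc v * sin (A - B) = im u * re v - re u * im v.
    by rewrite sinB -cu -su -cv -sv; ring.
  have e2 : im u * re v - re u * im v = im (u - v) * re v - re (u - v) * im v.
    by rewrite !reimE; ring.
  have e3 : `|im (u - v) * re v - re (u - v) * im v| <= normc (u - v) * normc v.
    rewrite -(@ler_pXn2r _ 2) ?nnegrE ?mulr_ge0 ?normc_ge0 //.
    rewrite real_normK ?num_real // exprMn !sqr_normcE.
    set a := im (u - v); set b := re (u - v).
    have := sqr_ge0 (b * re v + a * im v); flra.
  rewrite /s ler_pdivlMr // -(ler_pM2r nv0).
  apply: le_trans _ e3; rewrite -e2 -e1 !normrM (ger0_norm (ltW nu0)) (ger0_norm (ltW nv0)).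
  have : 0 <= `|sin (A - B)| * normc v by rewrite mulr_ge0 // ltW.
  nra.
have hcs : 0 < cos (A - B).
  have e1 : normc u * normc v * cos (A - B) = re u * re v + im u * im v.
    by rewrite cosB -cu -su -cv -sv; ring.
  have e2 : normc (u - v) ^+ 2 = normc u ^+ 2 + normc v ^+ 2 - 2 * (re u * re v + im u * im v).
    by rewrite !sqr_normcE !reimE; ring.
  have e3 : normc (u - v) ^+ 2 <= r ^+ 2.
    rewrite ler_pXn2r ?nnegrE ?normc_ge0 ?ltW //.
    move: hs; rewrite /s ltr_pdivrMr //; flra.
  rewrite ltNge; apply/negP => hc.
  have h4 : normc u * normc v * cos (A - B) <= 0.
    by rewrite -oppr_ge0 -mulrN mulr_ge0 ?oppr_ge0 // mulr_ge0 // ltW.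
  have : r ^+ 2 <= normc u ^+ 2 by rewrite ler_pXn2r ?nnegrE ?normc_ge0 // ltW.
  have : r ^+ 2 <= normc v ^+ 2 by rewrite ler_pXn2r ?nnegrE ?normc_ge0 // ltW.
  have : 0 < r ^+ 2 by rewrite exprn_gt0.
  rewrite e1 in h4; flra.
have hAB : - (pi / 2) < A - B < pi / 2.
  have hlt : 0 < cos `|A - B| by rewrite cos_norm.
  have h : `|A - B| <= pi by move: hA hB; rewrite !ltr_norml ler_norml; flra.
  rewrite -ltr_norml ltNge; apply/negP => h2.
  have : cos `|A - B| <= cos (pi / 2).
    have p0 := @pi_gt0 R; move: h2; rewrite le_eqVlt => /orP[/eqP <-//|h2].
    by rewrite ltW // ltr_cos ?in_itv /=; flra.
  by rewrite cos_pihalf; flra.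
have hA2 : A - B = atan (tan (A - B)) by rewrite tanK // in_itv.
have hc2 : 2^-1 <= cos (A - B).
  have h1 := cos2Dsin2 (A - B).
  have h2 : sin (A - B) ^+ 2 <= 4^-1.
    have -> : (4^-1 : R) = 2^-1 ^+ 2 by field.
    by rewrite -real_normK ?num_real // ler_pXn2r ?nnegrE //; flra.
  nra.
have := atan_lip (tan (A - B)) 0; rewrite -hA2 atan0 !subr0 => /le_trans -> //.
rewrite /tan normrM normfV (ger0_norm (ltW hcs)) ler_pdivrMr //.
nra.
Qed.

Lemma expR_sub1 x : `|x| <= 2^-1 -> `|expR x - 1| <= 2 * `|x|.
Proof.
move=> h; have h1 := expR_ge1Dx x; have h2 := expR_ge1Dx (- x).
have h3 := expRxMexpNx_1 x; have e0 := expR_gt0 x.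
move: h; case: (lerP 0 x) => x0.
  rewrite (ger0_norm x0) => h; rewrite ger0_norm; last by flra.
  nra.
rewrite (ltr0_norm x0) => h; rewrite ler0_norm; last by nra.
flra.
Qed.

Lemma cexp_sub1 z : normc z <= 2^-1 -> normc (cexp z - 1) <= 8 * normc z.
Proof.
move=> h; have hr := normc_re z; have hi := normc_im z.
have h1 := expR_sub1 (le_trans hr h).
have h2 := sin_lip (im z) 0; rewrite sin0 !subr0 in h2.
have h3 := cos_lip (im z) 0; rewrite cos0 !subr0 in h3.
have h4 : normc (cexp z - 1) <= `|expR (re z) - 1| +
   expR (re z) * (`|cos (im z) - 1| + `|sin (im z)|).
  apply: le_trans (normc_le_reim _) _; rewrite !reimE /= subr0.
  have -> : expR (re z) * cos (im z) - 1 = (expR (re z) - 1) +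
     expR (re z) * (cos (im z) - 1) by ring.
  have := ler_normD (expR (re z) - 1) (expR (re z) * (cos (im z) - 1)).
  rewrite !normrM (ger0_norm (expR_ge0 _)); flra.
have h5 : expR (re z) <= 2.
  have : `|re z| <= 2^-1 by flra.
  by move=> ?; move: h1; rewrite ler_norml; flra.
have : expR (re z) * (`|cos (im z) - 1| + `|sin (im z)|) <= 2 * (2 * normc z).
  by apply: ler_pM; rewrite ?expR_ge0 ?addr_ge0 //; flra.
move=> h6; apply: le_trans h4 _; apply: le_trans (lerD h1 h6) _.
have := normc_ge0 z; flra.
Qed.

(** Interval induction: the supremum of the [x] with [I a x] is attained and cannot lie before [b].
    It serves below as compactness and connectedness of an interval at once: uniform constants,
    cluster points, lifting, constancy of discrete data. *)
Lemma cousin (I : R -> R -> Prop) (a b : R) : a <= b ->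
  (forall u v w : R, a <= u -> u <= v -> v <= w -> w <= b -> I u v -> I v w -> I u w) ->
  (forall t, a <= t <= b -> exists2 e, 0 < e &
     forall u v : R, a <= u -> u <= v -> v <= b -> t - e < u -> v < t + e -> I u v) ->
  I a b.
Proof.
move=> ab tr loc.
pose S := [set x | a <= x <= b /\ I a x].
have Sa : S a.
  split; first by rewrite lexx.
  have [|e e0 h] := loc a; first by rewrite lexx.
  by apply: h => //; flra.
have Sb : has_sup S by split; [exists a | exists b => x [/andP[]]].
set s := sup S.
have as_ : a <= s by apply: ub_le_sup; [exact: Sb.2|].
have sb : s <= b by apply: ge_sup; [exists a|move=> x [/andP[]]].
have [|e e0 h] := loc s; first by apply/andP.
have [x [/andP[ax xb] Iax] sx] := sup_adherent e0 Sb.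
have xs : x <= s by apply: ub_le_sup; [exact: Sb.2|split=> //; apply/andP].
have key y : s <= y -> y <= b -> y < s + e -> I a y.
  move=> sy yb ye; apply: (tr _ x) => //; first flra.
  by apply: h => //; flra.
have [sb'|] := ltP s b; last first.
  by move=> bs; apply: key; flra.
pose y := Num.min b (s + e / 2).
have yb : y <= b by rewrite ge_min lexx.
have sy : s < y by rewrite lt_min sb' /=; flra.
have ye : y < s + e by rewrite gt_min; apply/orP; right; flra.
have : y <= s.
  apply: ub_le_sup; first exact: Sb.2.
  split; first by apply/andP; split; flra.
  by apply: key; flra.
flra.
Qed.

Lemma heine_borel (Q : R -> R -> Prop) (a b : R) :
  (forall t d d', 0 < d' -> d' <= d -> Q t d -> Q t d') ->
  (forall t, a <= t <= b -> exists2 e, 0 < e & exists2 d, 0 < d &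
     forall t', a <= t' <= b -> `|t' - t| < e -> Q t' d) ->
  exists2 d, 0 < d & forall t, a <= t <= b -> Q t d.
Proof.
move=> mono loc; have [ab|ab] := leP a b; last first.
  by exists 1 => // t; flra.
apply: (@cousin (fun u v : R => exists2 d, 0 < d & forall t, u <= t <= v -> Q t d)) => //.
  move=> u v w au uv vw wb [d d0 h] [d' d'0 h'].
  exists (Num.min d d'); first by rewrite lt_min d0.
  move=> t /andP[ut tw]; have [tv|tv] := leP t v.
    apply: (mono _ d); rewrite ?lt_min ?d0 //; first by rewrite ge_min lexx.
    by apply: h; rewrite ut.
  apply: (mono _ d'); rewrite ?lt_min ?d0 //; first by rewrite ge_min lexx orbT.
  by apply: h'; rewrite ltW.
move=> t /loc[e e0 [d d0 h]]; exists e => // u v au uv vb tu vt.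
exists d => // t' /andP[ut' t'v]; apply: h; first by apply/andP; split; flra.
by rewrite ltr_norml; flra.
Qed.

Lemma cluster_seq (x : nat -> R) a b : (forall n, a <= x n <= b) ->
  exists2 t, a <= t <= b & forall e, 0 < e -> forall N, exists2 n, (N <= n)%N & `|x n - t| < e.
Proof.
move=> xab; apply: contrapT => hno.
have ab : a <= b by have := xab 0%N; flra.
have := @cousin (fun u v : R => exists N, forall n, (N <= n)%N -> ~ (u <= x n <= v)) _ _ ab.
case.
- move=> u v w _ uv vw _ [N h] [N' h']; exists (maxn N N') => n.
  rewrite geq_max => /andP[hN hN'] /andP[ux xw]; have [xv|xv] := leP (x n) v.
    by apply: (h n hN); rewrite ux.
  by apply: (h' n hN'); rewrite ltW.
- move=> t tab; apply: contrapT => hno2; apply: hno; exists t => // e e0 N.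
  apply: contrapT => hN; apply: hno2; exists e => // u v au uv vb tu vt.
  exists N => n Nn /andP[ux xv]; apply: hN; exists n => //.
  by rewrite ltr_norml; flra.
- by move=> N h; apply: (h N).
Qed.

Lemma bolzano (x : nat -> R) a b : (forall n, a <= x n <= b) ->
  exists t (phi : nat -> nat), [/\ a <= t <= b, (forall k, (k <= phi k)%N) &
   forall e, 0 < e -> exists K, forall k, (K <= k)%N -> `|x (phi k) - t| < e].
Proof.
move=> xab; have [t tab h] := cluster_seq xab.
have /choice[phi hphi] k : exists n, (k <= n)%N /\ `|x n - t| < k.+1%:R^-1.
  have k0 : 0 < k.+1%:R^-1 :> R by rewrite invr_gt0.
  by have [n] := h _ k0 k; exists n.
exists t, phi; split => // [k|e e0]; first by case: (hphi k).
exists (Num.truncn e^-1) => k hk.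
apply: lt_trans (hphi k).2 _; rewrite invf_plt ?posrE //.
by apply: lt_le_trans (truncnS_gt _) _; rewrite ler_nat.
Qed.

(** The intervals of radius [2 * K / 2 ^+ n] about [x n] are nested, so the supremum of their left
    ends lies in all of them. *)
Lemma geometric_cvg (x : nat -> R) K : (forall n, `|x n.+1 - x n| <= K / 2 ^+ n) ->
  exists l, forall n, `|x n - l| <= 2 * K / 2 ^+ n.
Proof.
move=> h; pose c n : R := 2 * K / 2 ^+ n.
have e n : K / 2 ^+ n = c n - c n.+1.
  by rewrite /c exprS; field; rewrite expf_neq0.
have lo n m : (n <= m)%N -> x n - c n <= x m - c m.
  elim: m => [|m IH]; first by rewrite leqn0 => /eqP ->.
  rewrite leq_eqVlt ltnS => /orP[/eqP ->//|/IH H]; apply: le_trans H _.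
  by have := h m; rewrite e ler_norml; flra.
have up n m : (n <= m)%N -> x m + c m <= x n + c n.
  elim: m => [|m IH]; first by rewrite leqn0 => /eqP ->.
  rewrite leq_eqVlt ltnS => /orP[/eqP ->//|/IH H]; apply: le_trans _ H.
  by have := h m; rewrite e ler_norml; flra.
have K0 : 0 <= K by have := le_trans (normr_ge0 _) (h 0%N); rewrite expr0 divr1.
have c0 n : 0 <= c n by rewrite /c divr_ge0 ?mulr_ge0 ?exprn_ge0.
have lu n m : x n - c n <= x m + c m.
  have [nm|/ltnW mn] := leqP n m.
    by have := lo _ _ nm; have := c0 m; flra.
  by have := up _ _ mn; have := c0 n; flra.
pose S := [set y | exists n, y = x n - c n].
have hS : has_sup S.
  by split; [exists (x 0%N - c 0%N); exists 0%N|exists (x 0%N + c 0%N) => _ [n ->]].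
exists (sup S) => n; rewrite ler_norml.
have h1 : x n - c n <= sup S by apply: ub_le_sup; [exact: hS.2|exists n].
have h2 : sup S <= x n + c n by apply: ge_sup; [exact: hS.1|move=> _ [m ->]].
rewrite -/(c n); flra.
Qed.

Lemma geometric_cvgC (x : nat -> C) K : (forall n, normc (x n.+1 - x n) <= K / 2 ^+ n) ->
  exists l, forall n, normc (x n - l) <= 4 * K / 2 ^+ n.
Proof.
move=> h.
have [|lr hr] := @geometric_cvg (fun n => re (x n)) K.
  by move=> n; apply: le_trans (h n); rewrite -reN -reD normc_re.
have [|li hi] := @geometric_cvg (fun n => im (x n)) K.
  by move=> n; apply: le_trans (h n); rewrite -imN -imD normc_im.
exists (lr +i* li) => n; apply: le_trans (normc_le_reim _) _; rewrite !reimE /=.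
have := hr n; have := hi n; rewrite -!mulrA; set q := K / _; flra.
Qed.

End RealAnalysis.

(** * Paths in the plane *)

Section Paths.
Variable R : realType.
Local Notation C := R[i].
Implicit Types (z w : C) (a b t : R) (f g : R -> C) (x y : R -> R).

Definition ccont f a b := forall t, a <= t <= b -> forall e, 0 < e ->
  exists2 d, 0 < d & forall t', a <= t' <= b -> `|t' - t| < d -> normc (f t' - f t) < e.
Definition rcont x a b := forall t, a <= t <= b -> forall e, 0 < e ->
  exists2 d, 0 < d & forall t', a <= t' <= b -> `|t' - t| < d -> `|x t' - x t| < e.
Definition cont_at (F : C -> C) z := forall e : R, 0 < e ->
  exists2 d : R, 0 < d & forall w, normc (w - z) < d -> normc (F w - F z) < e.

Lemma rcont_within x a b : rcont x a b -> {within `[a, b], continuous x}.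
Proof.
move=> h; apply/subspace_continuousP => t /=; rewrite in_itv /= => tab.
apply/cvgrPdist_lt => e e0; have [d d0 hd] := h t tab e e0.
rewrite near_withinE; exists d => // t' /= tt'; rewrite in_itv /= => t'ab.
by rewrite distrC; apply: hd => //; rewrite distrC.
Qed.

Lemma rcont_sub x a b a' b' : a <= a' -> b' <= b -> rcont x a b -> rcont x a' b'.
Proof.
move=> aa bb h t /andP[at' tb] e e0.
have [|d d0 hd] := h t _ e e0; first by apply/andP; split; flra.
by exists d => // t' /andP[? ?]; apply: hd; apply/andP; split; flra.
Qed.

Lemma ccont_sub f a b a' b' : a <= a' -> b' <= b -> ccont f a b -> ccont f a' b'.
Proof.
move=> aa bb h t /andP[at' tb] e e0.
have [|d d0 hd] := h t _ e e0; first by apply/andP; split; flra.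
by exists d => // t' /andP[? ?]; apply: hd; apply/andP; split; flra.
Qed.

Lemma rIVT x a b c d v : rcont x a b -> a <= c <= b -> a <= d <= b ->
  x c <= v <= x d -> exists2 t, (a <= t <= b) && (Num.min c d <= t <= Num.max c d) & x t = v.
Proof.
move=> h /andP[ac cb] /andP[ad db] hv.
have cd : Num.min c d <= Num.max c d by rewrite le_max !ge_min lexx.
have [||t] := @IVT _ x _ _ v cd.
- apply: rcont_within; apply: rcont_sub h; first by rewrite le_min ac.
  by rewrite ge_max cb.
- case: (leP c d) => _; rewrite ?(minC (x d)) ?(maxC (x d)); rewrite ge_min le_max;
    by have /andP[-> ->] := hv; rewrite ?orbT.
- rewrite in_itv /= => tI xt; exists t => //; rewrite tI andbT.
  by move: tI; rewrite ge_min le_max; flra.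
Qed.

Lemma first_hit x a b v : a <= b -> rcont x a b -> x a <= v -> v <= x b ->
  exists2 c, a <= c <= b & x c = v /\ forall t, a <= t <= c -> x t <= v.
Proof.
move=> ab h xa xb.
pose S := [set s | a <= s <= b /\ forall t, a <= t <= s -> x t <= v].
have Sa : S a by split; [rewrite lexx|move=> t tt; have -> : t = a by flra].
have hS : has_sup S by split; [exists a|exists b => s [/andP[]]].
have as_ : a <= sup S by apply: ub_le_sup; [exact: hS.2|].
have sb : sup S <= b by apply: ge_sup; [exists a|move=> s [/andP[]]].
have below t : a <= t < sup S -> x t <= v.
  move=> /andP[at_ ts]; have e0 : 0 < sup S - t by flra.
  have [s [_ hs] ss] := sup_adherent e0 hS; apply: hs; flra.
have xs : x (sup S) <= v.
  rewrite leNgt; apply/negP => hgt.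
  have [||d d0 hd] := h (sup S) _ (x (sup S) - v); [flra|flra|].
  have [sa|sa] := leP (sup S) a.
    have e : sup S = a by flra.
    by rewrite e in hgt; flra.
  pose t := Num.max a (sup S - d / 2).
  have t1 : a <= t by rewrite le_max lexx.
  have t2 : t < sup S by rewrite gt_max sa /=; flra.
  have t3 : sup S - d / 2 <= t by rewrite le_max lexx orbT.
  have := hd t; rewrite !ltr_norml; have := below t; flra.
have [sbb|sbb] := leP b (sup S).
  have e : sup S = b by flra.
  exists b; first by flra.
  by rewrite e in xs below; split; [flra|move=> t tt; have [tb|tb] := ltP t b;
    [apply: below; flra|have -> : t = b by flra]].
exists (sup S); first by flra.
split; last first.
  move=> t tt; have [tb|tb] := ltP t (sup S); first by apply: below; flra.
  by have -> : t = sup S by flra.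
apply/eqP; rewrite eq_le xs /= leNgt; apply/negP => hlt.
have [||d d0 hd] := h (sup S) _ (v - x (sup S)); [flra|flra|].
pose s := Num.min b (sup S + d / 2).
have s1 : s <= b by rewrite ge_min lexx.
have s2 : sup S < s by rewrite lt_min sbb /=; flra.
have s3 : s <= sup S + d / 2 by rewrite ge_min lexx orbT.
have : s <= sup S; last by flra.
apply: ub_le_sup; first exact: hS.2.
split; first by flra.
move=> t /andP[at_ ts]; have [tb|tb] := ltP t (sup S); first by apply: below; flra.
by have := hd t; rewrite !ltr_norml; flra.
Qed.

Lemma rcont_int_const x T a b : 0 < T -> rcont x a b ->
  (forall t, a <= t <= b -> exists k : int, x t = T * k%:~R) ->
  forall t t', a <= t <= b -> a <= t' <= b -> x t = x t'.
Proof.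
move=> T0 h hk; suff H t t' : a <= t -> t <= t' -> t' <= b -> x t = x t'.
  by move=> t t' /andP[? ?] /andP[? ?]; case: (leP t t') => [/H|/ltW /H] -> //.
move=> at_ tt t'b; apply: (@cousin _ (fun u v : R => x u = x v)) => //.
  by move=> u v w _ _ _ _ -> ->.
move=> s ss; have [||e e0 he] := h s _ (T / 2); [flra|flra|].
exists e => // u v tu uv vt su vs.
have [|ku hu] := hk u; first flra.
have [|kv hv] := hk v; first flra.
have h1 : `|x u - x s| < T / 2 by apply: he; [|rewrite ltr_norml]; flra.
have h2 : `|x v - x s| < T / 2 by apply: he; [|rewrite ltr_norml]; flra.
have : `|T * (ku%:~R - kv%:~R)| < T.
  by rewrite mulrBr -hu -hv; move: h1 h2; rewrite !ltr_norml; flra.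
rewrite normrM (ger0_norm (ltW T0)) -[ltRHS]mulr1 ltr_pM2l // -intrB -intr_norm.
rewrite -[1]/(1%:~R) ltr_int hu hv => hh.
by have -> : ku = kv by clear -hh; lia.
Qed.

Lemma ccont_cst z a b : ccont (fun=> z) a b.
Proof. by move=> t _ e e0; exists 1 => // t' _ _; rewrite subrr normc0. Qed.

Lemma ccontD f g a b : ccont f a b -> ccont g a b -> ccont (fun t => f t + g t) a b.
Proof.
move=> hf hg t tt e e0.
have [|d d0 hd] := hf t tt (e / 2); first by flra.
have [|d' d'0 hd'] := hg t tt (e / 2); first by flra.
exists (Num.min d d'); first by rewrite lt_min d0.
move=> t' tt'; rewrite lt_min => /andP[h1 h2].
have -> : f t' + g t' - (f t + g t) = (f t' - f t) + (g t' - g t) by ring.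
by have := ler_normcD (f t' - f t) (g t' - g t); have := hd _ tt' h1; have := hd' _ tt' h2; flra.
Qed.

Lemma ccontN f a b : ccont f a b -> ccont (fun t => - f t) a b.
Proof.
move=> hf t tt e e0; have [d d0 hd] := hf t tt e e0.
by exists d => // t' tt' h; rewrite -opprD normcN; apply: hd.
Qed.

Lemma ccontB f g a b : ccont f a b -> ccont g a b -> ccont (fun t => f t - g t) a b.
Proof. by move=> hf hg; apply: ccontD => //; apply: ccontN. Qed.

Lemma ccontM f g a b : ccont f a b -> ccont g a b -> ccont (fun t => f t * g t) a b.
Proof.
move=> hf hg t tt e e0.
pose M := 1 + normc (f t) + normc (g t).
have M1 : 1 <= M by have := normc_ge0 (f t); have := normc_ge0 (g t); rewrite /M; flra.
pose e' := Num.min 1 (e / (2 * M)).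
have e'0 : 0 < e' by rewrite lt_min ltr01 divr_gt0 //; flra.
have e'1 : e' <= 1 by rewrite ge_min lexx.
have e'2 : e' * (2 * M) <= e by rewrite -ler_pdivlMr ?ge_min ?lexx ?orbT //; flra.
have [d d0 hd] := hf t tt e' e'0.
have [d' d'0 hd'] := hg t tt e' e'0.
exists (Num.min d d'); first by rewrite lt_min d0.
move=> t' tt'; rewrite lt_min => /andP[h1 h2].
have -> : f t' * g t' - f t * g t = (f t' - f t) * g t' + f t * (g t' - g t) by ring.
apply: le_lt_trans (ler_normcD _ _) _; rewrite !normcM.
have := hd _ tt' h1; have := hd' _ tt' h2.
set A := normc (f t' - f t); set B := normc (g t' - g t) => hB hA.
have hG : normc (g t') <= normc (g t) + 1.
  have := ler_normcD (g t' - g t) (g t); rewrite subrK -/B; flra.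
have A0 : 0 <= A := normc_ge0 _; have B0 : 0 <= B := normc_ge0 _.
have G0 := normc_ge0 (g t'); have F0 := normc_ge0 (f t).
have : A * normc (g t') <= e' * (normc (g t) + 1) by apply: ler_pM => //; flra.
have : normc (f t) * B <= normc (f t) * e' by apply: ler_pM => //; flra.
have : e' * M < e' * (2 * M) by rewrite ltr_pM2l //; flra.
by rewrite {1}/M; flra.
Qed.

Lemma ccont_comp F f a b : ccont f a b -> (forall t, a <= t <= b -> cont_at F (f t)) ->
  ccont (fun t => F (f t)) a b.
Proof.
move=> hf hF t tt e e0; have [d d0 hd] := hF t tt e e0.
have [d' d'0 hd'] := hf t tt d d0.
by exists d' => // t' tt' h; apply: hd; apply: hd'.
Qed.

Lemma ccont_reparam f a b x c d : ccont f a b -> rcont x c d ->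
  (forall t, c <= t <= d -> a <= x t <= b) -> ccont (fun t => f (x t)) c d.
Proof.
move=> hf hx hab t tt e e0; have [d1 d10 hd] := hf (x t) (hab t tt) e e0.
have [d2 d20 hd2] := hx t tt d1 d10.
by exists d2 => // t' tt' h; apply: hd; [exact: hab|exact: hd2].
Qed.

Lemma rcont_lip x a b K : 0 < K -> (forall t t', a <= t <= b -> a <= t' <= b ->
  `|x t - x t'| <= K * `|t - t'|) -> rcont x a b.
Proof.
move=> K0 h t tt e e0; exists (e / K); first by rewrite divr_gt0.
move=> t' tt'; rewrite ltr_pdivlMr // mulrC; apply: le_lt_trans; exact: h.
Qed.

Lemma rcont_affine k c a b : rcont (fun t : R => c + k * t) a b.
Proof.
apply: (@rcont_lip _ _ _ (`|k| + 1)); first by have := normr_ge0 k; flra.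
move=> t t' _ _; have -> : c + k * t - (c + k * t') = k * (t - t') by ring.
by rewrite normrM ler_wpM2r //; flra.
Qed.

Lemma rcont_le x f a b : ccont f a b ->
  (forall t t', `|x t - x t'| <= normc (f t - f t')) -> rcont x a b.
Proof.
move=> hf h t tt e e0; have [d d0 hd] := hf t tt e e0; exists d => // t' tt' hh.
exact: le_lt_trans (h _ _) (hd _ tt' hh).
Qed.

Lemma rcont_re f a b : ccont f a b -> rcont (fun t => re (f t)) a b.
Proof. by move=> h; apply: (rcont_le h) => t t'; rewrite -reN -reD normc_re. Qed.
Lemma rcont_im f a b : ccont f a b -> rcont (fun t => im (f t)) a b.
Proof. by move=> h; apply: (rcont_le h) => t t'; rewrite -imN -imD normc_im. Qed.
Lemma rcont_bounded x a b : rcont x a b -> exists2 M, 0 < M & forall t, a <= t <= b -> x t <= M.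
Proof.
move=> h; have [||d d0 hd] := @heine_borel _ (fun t d => x t <= d^-1) a b.
- by move=> t d d' d'0 dd /le_trans -> //; rewrite lef_pV2 ?posrE //; flra.
- move=> t tt; have [d d0 hd] := h t tt 1 ltr01; exists d => //.
  exists (`|x t| + 1)^-1; first by rewrite invr_gt0; have := normr_ge0 (x t); flra.
  move=> t' tt' /(hd _ tt'); rewrite invrK ltr_norml; have := ler_norm (x t); flra.
by exists d^-1 => //; rewrite invr_gt0.
Qed.

Lemma ccont_lower_bound f a b : ccont f a b -> (forall t, a <= t <= b -> f t != 0) ->
  exists2 m, 0 < m & forall t, a <= t <= b -> m <= normc (f t).
Proof.
move=> h f0; apply: (@heine_borel _ (fun t d => d <= normc (f t))).
  by move=> t d d' _ dd /(le_trans dd).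
move=> t tt; have n0 := normc_gt0 (f0 t tt).
have [|d d0 hd] := h t tt (normc (f t) / 2); first by flra.
exists d => //; exists (normc (f t) / 2); first by flra.
move=> t' tt' /(hd _ tt'); have := ler_normc_dist (f t') (f t).
by rewrite ler_norml; flra.
Qed.

Lemma ccont_cexp f a b : ccont f a b -> ccont (fun t => cexp (f t)) a b.
Proof.
move=> hf; apply: (ccont_comp (F := @cexp R)) hf _ => t _ e e0.
have x0 := expR_gt0 (re (f t)); set z := f t in x0 *.
pose d := Num.min 2^-1 (e / (16 * expR (re z))).
have d0 : 0 < d by rewrite lt_min divr_gt0 ?mulr_gt0 ?andbT; flra.
exists d => // w; rewrite lt_min ltr_pdivlMr ?mulr_gt0 // => /andP[h1 h2].
have -> : cexp w - cexp z = cexp z * (cexp (w - z) - 1).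
  by rewrite mulrBr -cexpD mulr1 [z + _]addrC subrK.
rewrite normcM normc_cexp; have := cexp_sub1 (ltW h1).
move/(ler_wpM2l (expR_ge0 (re z))) => h3; apply: le_lt_trans h3 _.
have := normc_ge0 (w - z); nra.
Qed.

Lemma cont_at_Log z : 0 < re z -> cont_at (@Log R) z.
Proof.
move=> z0 e e0; pose r := re z / 2; have r0 : 0 < r by rewrite /r; flra.
exists (Num.min r (e * r / 10)); first by rewrite lt_min r0 divr_gt0 ?mulr_gt0.
move=> w; rewrite lt_min => /andP[h1 h2].
have rw : r <= re w.
  have := normc_re (w - z); rewrite !reimE ler_norml; move: h1; rewrite /r; flra.
apply: le_lt_trans (Log_lip r0 rw _) _; first by rewrite /r; flra.
by rewrite ltr_pdivrMr //; have := normc_ge0 (w - z); flra.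
Qed.

Lemma ccontV f a b : ccont f a b -> (forall t, a <= t <= b -> f t != 0) ->
  ccont (fun t => (f t)^-1) a b.
Proof.
move=> hf f0 t tt e e0; have n0 := normc_gt0 (f0 t tt); set n := normc (f t) in n0.
have [|d d0 hd] := hf t tt (Num.min (n / 2) (e * n * n / 4)).
  by rewrite lt_min !divr_gt0 ?mulr_gt0.
exists d => // t' tt' /(hd _ tt'); rewrite lt_min => /andP[h1 h2].
have f't0 := f0 t' tt'.
have n1 : n / 2 <= normc (f t').
  by have := ler_normc_dist (f t') (f t); rewrite ler_norml -/n; flra.
have n2 : 0 < normc (f t') by flra.
have -> : (f t')^-1 - (f t)^-1 = (f t - f t') / (f t' * f t).
  by field; rewrite f't0 f0.
rewrite normcM normcV normcM -/n ltr_pdivrMr ?mulr_gt0 // normcB.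
apply: lt_le_trans h2 _; rewrite -!mulrA ler_pM2l //; nra.
Qed.

Lemma ccont_glue f g a b c : ccont f a b -> ccont g b c -> f b = g b ->
  ccont (fun t => if t <= b then f t else g t) a c.
Proof.
move=> hf hg fg t /andP[at_ tc] e e0.
have [tb|tb|tb] := ltgtP t b.
- have [|d d0 hd] := hf t _ e e0; first by flra.
  exists (Num.min d (b - t)); first by rewrite lt_min d0; flra.
  move=> t' /andP[? ?]; rewrite lt_min !ltr_norml => h.
  by rewrite ifT; [apply: hd; [|rewrite ltr_norml]|]; flra.
- have [|d d0 hd] := hg t _ e e0; first by flra.
  exists (Num.min d (t - b)); first by rewrite lt_min d0; flra.
  move=> t' /andP[? ?]; rewrite lt_min !ltr_norml => h.
  by rewrite ifF; [apply: hd; [|rewrite ltr_norml]|apply/negbTE; rewrite -ltNge]; flra.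
rewrite tb in at_ tc *.
have [|d d0 hd] := hf b _ e e0; first by flra.
have [|d' d'0 hd'] := hg b _ e e0; first by flra.
exists (Num.min d d'); first by rewrite lt_min d0.
move=> t' /andP[? ?]; rewrite lt_min => /andP[h1 h2].
have [hb|hb] := leP t' b; first by apply: hd => //; apply/andP; split; flra.
by rewrite fg; apply: hd' => //; apply/andP; split; flra.
Qed.

Lemma rcont_ext x y a b : (forall t, a <= t <= b -> x t = y t) -> rcont x a b -> rcont y a b.
Proof.
move=> fg hf t tt e e0; have [d d0 hd] := hf t tt e e0.
by exists d => // t' tt' h; rewrite -!fg //; apply: hd.
Qed.

End Paths.

(** * Continuous logarithms and the two winding arguments *)

Section Lifting.
Variable R : realType.
Local Notation C := R[i].
Implicit Types (z w : C) (a b t s : R) (f g l p q : R -> C) (x y : R -> R).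

Lemma exp_lift_uniq l l' a b s : ccont l a b -> ccont l' a b ->
  (forall t, a <= t <= b -> cexp (l t) = cexp (l' t)) ->
  a <= s <= b -> l s = l' s -> forall t, a <= t <= b -> l t = l' t.
Proof.
move=> hl hl' e ss ls t tt.
have re0' t' : a <= t' <= b -> re (l t') = re (l' t').
  by move=> h; have [k ->] := cexp_eq (e t' h); rewrite !reimE /= addr0.
apply: complex_ext; first exact: re0'.
have hc : rcont (fun t' => im (l t' - l' t')) a b by apply: rcont_im; exact: ccontB.
have tp : 0 < twopi R by have := twopi_ge4 R; flra.
have := rcont_int_const tp hc _ tt ss; rewrite ls subrr !reimE => h.
apply/eqP; rewrite -subr_eq0 h // => t' tt'.
by have [k ->] := cexp_eq (e t' tt'); exists k; rewrite !reimE /=; ring.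
Qed.

Lemma exp_lift c a b : a <= b -> ccont c a b -> (forall t, a <= t <= b -> c t != 0) ->
  forall w0, cexp w0 = c a -> exists l, [/\ ccont l a b, l a = w0 &
    forall t, a <= t <= b -> cexp (l t) = c t].
Proof.
move=> ab hc c0.
apply: (@cousin _ (fun u v : R => forall w0, cexp w0 = c u -> exists l, [/\ ccont l u v, l u = w0 &
    forall t, u <= t <= v -> cexp (l t) = c t]) a b) => //.
  move=> u v w au uv vw wb h1 h2 w0 /h1[l1 [l1c l1u l1e]].
  have [|l2 [l2c l2v l2e]] := h2 (l1 v); first by apply: l1e; rewrite uv lexx.
  exists (fun t => if t <= v then l1 t else l2 t); split.
  - exact: ccont_glue.
  - by rewrite uv.
  - move=> t /andP[ut tw]; have [tv|tv] := leP t v; first by apply: l1e; rewrite ut.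
    by apply: l2e; rewrite ltW.
move=> t tt; have n0 := normc_gt0 (c0 t tt).
have [|e e0 he] := hc t tt (normc (c t) / 4); first by flra.
exists e => // u v au uv vb tu vt w0 w0e.
have near s : u <= s <= v -> normc (c s - c t) < normc (c t) / 4.
  by move=> ss; apply: he; [|rewrite ltr_norml]; flra.
have c0u : c u != 0 by apply: c0; flra.
have rp s : u <= s <= v -> 3^-1 <= re (c s / c u).
  move=> ss; have h1 := near s ss; have h2 : normc (c u - c t) < normc (c t) / 4.
    by apply: near; flra.
  have h3 := ler_normc_dist (c u) (c t); rewrite ler_norml in h3.
  have h4 := ler_normc_tri (c t) (c s) (c u); rewrite (normcB (c t)) in h4.
  have h6 : normc (c s / c u - 1) <= 2 / 3.
    have -> : c s / c u - 1 = (c s - c u) / c u by field.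
    rewrite normcM normcV ler_pdivrMr; last by flra.
    flra.
  by have := normc_re (c s / c u - 1); rewrite !reimE ler_norml; flra.
(* On this short interval the quotient stays in the right half-plane, where [Log] is continuous. *)
exists (fun s => w0 + Log (c s / c u)); split.
- apply: ccontD; first exact: ccont_cst.
  apply: (ccont_comp (F := @Log R)); last first.
    by move=> s ss; apply: cont_at_Log; have := rp s ss; flra.
  apply: ccontM; last exact: ccont_cst.
  by apply: ccont_sub hc; flra.
- by rewrite divff // Log1 addr0.
- move=> s ss; rewrite cexpD w0e cexp_Log; last by have := rp s ss; flra.
  by field.
Qed.

(** [Log] covers the right half-plane; multiplying by powers of ['i], which itself has the logarithm
    i pi / 2, brings every other nonzero point there. *)
Lemma exists_log z : z != 0 -> exists w, cexp w = z.
Proof.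
have ci : cexp (0 +i* (pi / 2)) = 'i :> C.
  by apply: complex_ext; rewrite /cexp /= expR0 ?cos_pihalf ?sin_pihalf; ring.
have pos w : 0 < re w -> exists v, cexp v = w.
  by move=> w0; exists (Log w); exact: cexp_Log.
have rot w : (exists v, cexp v = w) -> exists v, cexp v = w * 'i.
  by move=> [v <-]; exists (v + (0 +i* (pi / 2))); rewrite cexpD ci.
have ii : 'i * 'i = -1 :> C by apply: complex_ext; rewrite !reimE /=; ring.
have eN (w : C) : w = - w * 'i * 'i by rewrite -mulrA ii; ring.
move=> z0; have [r0|r0|r0] := ltgtP (re z) 0; last 2 first.
- exact: pos.
- have [i0|i0|i0] := ltgtP (im z) 0.
  + have -> : z = (z * 'i) * 'i * 'i * 'i by apply: complex_ext; rewrite !reimE /=; ring.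
    by apply/rot/rot/rot/pos; rewrite !reimE /=; flra.
  + have -> : z = (z * - 'i) * 'i by apply: complex_ext; rewrite !reimE /=; ring.
    by apply/rot/pos; rewrite !reimE /=; flra.
  + by move: z0; rewrite (complex_ext (w := 0) r0 i0) eqxx.
- by rewrite (eN z); apply/rot/rot/pos; rewrite reimE; flra.
Qed.

Lemma path_dist_lower_bound p q a b c d : ccont p a b -> ccont q c d ->
  (forall s t, a <= s <= b -> c <= t <= d -> p s != q t) ->
  exists2 m, 0 < m & forall s t, a <= s <= b -> c <= t <= d -> m <= normc (p s - q t).
Proof.
move=> hp hq hne.
have [|| m m0 hm] := @heine_borel R
  (fun t m => forall s, a <= s <= b -> m <= normc (p s - q t)) c d.
- by move=> t m m' _ mm h s ss; apply: le_trans mm (h s ss).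
- move=> t tt.
  have [|| m m0 hm] := @ccont_lower_bound R (fun s => p s - q t) a b.
  + by apply: ccontB => //; exact: ccont_cst.
  + by move=> s ss; rewrite subr_eq0 hne.
  have [|e e0 he] := hq t tt (m / 2); first by flra.
  exists e => //; exists (m / 2); first by flra.
  move=> t' tt' h s ss; have := he t' tt' h; have := hm s ss.
  have := ler_normc_tri (q t') (p s) (q t); flra.
by exists m => // s t ss tt; apply: hm.
Qed.

(** A logarithm is lifted along the edge [s = a] and then, for each [t], in the variable [s].
    Separate continuity is all that is claimed, because the winding arguments only follow the four
    edges. *)
Lemma square_log p q a b c d : a <= b -> c <= d -> ccont p a b -> ccont q c d ->
  (forall s t, a <= s <= b -> c <= t <= d -> p s != q t) ->
  exists L : R -> R -> C, [/\ forall s t, a <= s <= b -> c <= t <= d -> cexp (L s t) = p s - q t,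
    forall t, c <= t <= d -> ccont (fun s => L s t) a b &
    forall s, a <= s <= b -> ccont (L s) c d].
Proof.
move=> ab cd hp hq hne.
have [m m0 hm] := path_dist_lower_bound hp hq hne.
have aa : a <= a <= b by rewrite lexx.
have ne0 s t : a <= s <= b -> c <= t <= d -> p s - q t != 0.
  by move=> ss tt; rewrite subr_eq0 hne.
have cc : c <= c <= d by rewrite lexx.
have [w1 w1e] := exists_log (ne0 a c aa cc).
have [||m0f [m0c _ m0e]] := @exp_lift (fun t => p a - q t) c d cd _ _ w1 w1e.
- by apply: ccontB => //; exact: ccont_cst.
- by move=> t tt; exact: ne0.
have /choice[L hL] t : exists l, c <= t <= d -> [/\ ccont l a b, l a = m0f t &
    forall s, a <= s <= b -> cexp (l s) = p s - q t].
  have [tt|] := boolP (c <= t <= d); last by exists (fun=> 0).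
  have [||l hl] := @exp_lift (fun s => p s - q t) a b ab _ _ (m0f t) (m0e t tt).
  - by apply: ccontB => //; exact: ccont_cst.
  - by move=> s ss; exact: ne0.
  by exists l.
have LE s t : a <= s <= b -> c <= t <= d -> cexp (L t s) = p s - q t.
  by move=> ss tt; have [_ _] := hL t tt; exact.
exists (fun s t => L t s); split => //; first by move=> t tt; have [] := hL t tt.
move=> s ss t tt e e0; have [Lc La _] := hL t tt.
pose r t' s' := (p s' - q t') / (p s' - q t).
have [d1 d10 hd1] := m0c t tt 1 ltr01.
pose k := Num.min (m / 100) (e * m / 100).
have [|d2 d20 hd2] := hq t tt k; first by rewrite lt_min !divr_gt0 ?mulr_gt0.
exists (Num.min d1 d2); first by rewrite lt_min d10.
move=> t' tt'; rewrite lt_min => /andP[/(hd1 t' tt') h1 /(hd2 t' tt')].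
rewrite lt_min => /andP[h2 h3].
have [Lc' La' _] := hL t' tt'.
have r1 s' : a <= s' <= b -> normc (r t' s' - 1) <= normc (q t' - q t) / m.
  move=> ss'; have -> : r t' s' - 1 = (q t - q t') / (p s' - q t).
    by rewrite /r; field; exact: ne0.
  rewrite normcM normcV normcB; apply: ler_wpM2l; first exact: normc_ge0.
  by rewrite lef_pV2 ?posrE //; [exact: hm|apply: normc_gt0; exact: ne0].
have h4 : normc (q t' - q t) / m <= 100^-1.
  by rewrite ler_pdivrMr //; flra.
have rp s' : a <= s' <= b -> 2^-1 <= re (r t' s').
  move=> ss'; have := r1 _ ss'; have := normc_re (r t' s' - 1).
  by rewrite !reimE ler_norml; flra.
have Lr s' : a <= s' <= b -> normc (Log (r t' s')) <= 18 * (normc (q t' - q t) / m).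
  move=> ss'; have h := @Log_lip _ 2^-1 (r t' s') 1; rewrite Log1 subr0 in h.
  apply: le_trans (h _ (rp _ ss') _) _; rewrite ?re1; [flra|flra|].
  have := r1 _ ss'; flra.
(* Neighbouring lifts differ by the logarithm of the quotient, up to a multiple of 2 pi i; this
   multiple vanishes because both lifts start on the continuous lift [m0f]. *)
have key s' : a <= s' <= b -> L t' s' = L t s' + Log (r t' s').
  move=> ss'; apply: (@exp_lift_uniq (L t') (fun s' => L t s' + Log (r t' s')) a b a) => //.
  - apply: ccontD => //; apply: (ccont_comp (F := @Log R)); last first.
      by move=> s1 ss1; apply: cont_at_Log; have := rp _ ss1; flra.
    apply: ccontM; first by apply: ccontB => //; exact: ccont_cst.
    apply: ccontV; first by apply: ccontB => //; exact: ccont_cst.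
    by move=> s1 ss1; exact: ne0.
  - move=> s1 ss1; rewrite cexpD cexp_Log; last by have := rp _ ss1; flra.
    by rewrite !LE // /r; field; exact: ne0.
  have [k' hk] : exists k', L t' a = L t a + Log (r t' a) + ipi R k'.
    apply: cexp_eq; rewrite cexpD cexp_Log; last by have := rp _ aa; flra.
    by rewrite !LE // /r; field; exact: ne0.
  suff k0 : k' = 0 by rewrite hk k0; apply: complex_ext; rewrite !reimE /=; ring.
  apply: (@int_small R); rewrite mulr0 subr0.
  have -> : twopi R * k'%:~R = im (m0f t' - m0f t) - im (Log (r t' a)).
    by rewrite -La -La' hk !reimE /=; ring.
  have := normc_im (m0f t' - m0f t); have := normc_im (Log (r t' a)).
  have := Lr _ aa; have := twopi_ge4 R.
  by rewrite ltr_norml !ler_norml; flra.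
rewrite key //; have -> : L t s + Log (r t' s) - L t s = Log (r t' s) by ring.
apply: le_lt_trans (Lr _ ss) _.
have : normc (q t' - q t) / m < e / 50.
  by rewrite ltr_pdivrMr //; have := mulr_gt0 e0 m0; flra.
flra.
Qed.

(** To leave the band, a continuous argument would have to pass through values where the cosine is
    negative. *)
Lemma cos_band x a b s phi : rcont x a b ->
  (forall t, a <= t <= b -> 0 <= cos (x t - phi)) -> a <= s <= b ->
  `|x s - phi| <= pi / 2 -> forall t, a <= t <= b -> `|x t - phi| <= pi / 2.
Proof.
have H (y : R -> R) (phi' : R) : rcont y a b ->
    (forall t, a <= t <= b -> 0 <= cos (y t - phi')) -> a <= s <= b ->
    `|y s - phi'| <= pi / 2 -> forall t, a <= t <= b -> y t - phi' <= pi / 2.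
  move=> hy hc ss hs t tt; rewrite leNgt; apply/negP => hlt.
  have p0 := @pi_gt0 R.
  pose v := Num.min (y t - phi') pi + phi'.
  have v1 : v - phi' <= y t - phi' by rewrite /v addrK ge_min lexx.
  have v2 : v - phi' <= pi by rewrite /v addrK ge_min lexx orbT.
  have v3 : pi / 2 < v - phi' by rewrite /v addrK lt_min hlt /=; flra.
  have [|t' tt' xt'] := @rIVT _ y a b s t v hy ss tt.
    by move: hs; rewrite ler_norml; flra.
  have /andP[t'ab _] := tt'; have := hc t' t'ab; rewrite xt' leNgt => /negP; apply.
  rewrite -cos_pihalf ltr_cos ?in_itv //=; flra.
move=> hx hc ss hs t tt; rewrite ler_norml; apply/andP; split; last exact: (H x).
have := H (fun t => - x t) (- phi) _ _ ss _ t tt; rewrite opprK.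
move=> h; suff : - x t + phi <= pi / 2 by flra.
apply: h.
- move=> t1 tt1 e e0; have [d d0 hd] := hx t1 tt1 e e0; exists d => // t' tt' h.
  by rewrite -opprD normrN; exact: hd.
- by move=> t1 tt1; rewrite -cosN; have := hc t1 tt1; congr (0 <= cos _); ring.
- by move: hs; rewrite -normrN; congr (`|_| <= _); ring.
Qed.

Lemma sin_eq1_half (x : R) : `|x| <= pi / 2 -> sin x = 1 -> x = pi / 2.
Proof.
move=> hx h; apply: sin_inj; rewrite ?in_itv /= ?sin_pihalf //.
  by move: hx; rewrite ler_norml.
by have := @pi_gt0 R; flra.
Qed.

Lemma sin_gt0_half (x : R) : `|x| <= pi / 2 -> 0 < sin x -> 0 < x.
Proof.
move=> hx h; rewrite ltNge; apply/negP => x0.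
have : 0 <= sin (- x) by apply: sin_ge0_pi; move: hx; have := @pi_gt0 R; rewrite ler_norml; flra.
by rewrite sinN; flra.
Qed.

(* The chord lemma: going round the square on which [p s - p t - 2 pi i] would
   be nonvanishing, its argument would turn once. *)
Lemma chord_2pi p a b : a <= b -> ccont p a b ->
  re (p a) = re (p b) -> (forall t, a <= t <= b -> re (p t) <= re (p b)) ->
  im (p a) + twopi R < im (p b) ->
  exists s t, [/\ a <= s <= b, a <= t <= b & p s = p t + ipi R 1].
Proof.
move=> ab hp eab hX hI; apply: contrapT => hno.
have aa : a <= a <= b by rewrite lexx.
have bb : a <= b <= b by rewrite lexx andbT.
have hq : ccont (fun t => p t + ipi R 1) a b by apply: ccontD => //; exact: ccont_cst.
have [|L [LE Ls Lt]] := square_log ab ab hp hq.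
  by move=> s t ss tt; apply/eqP => h; apply: hno; exists s, t.
pose y s t := im (L s t).
have hre s t : a <= s <= b -> a <= t <= b -> re (p s) - re (p t) = expR (re (L s t)) * cos (y s t).
  by move=> ss tt; have := LE s t ss tt; move/(congr1 (@complex.Re R)); rewrite !reimE /= => ->; ring.
have him s t : a <= s <= b -> a <= t <= b ->
    im (p s) - im (p t) - twopi R = expR (re (L s t)) * sin (y s t).
  by move=> ss tt; have := LE s t ss tt; move/(congr1 (@complex.Im R)); rewrite !reimE /= => ->; ring.
have t4 := twopi_ge4 R; have p0 := @pi_gt0 R.
have corner s t : a <= s <= b -> a <= t <= b -> re (p s) = re (p t) ->
   cos (y s t) = 0 /\ (im (p s) - im (p t) < twopi R -> sin (y s t) = -1) /\
   (twopi R < im (p s) - im (p t) -> sin (y s t) = 1).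
  move=> ss tt e; have := hre s t ss tt; rewrite e subrr => /esym/eqP.
  rewrite mulf_eq0 gt_eqF ?expR_gt0 //= => /eqP c0; split => //.
  have := cos2Dsin2 (y s t); rewrite c0 expr0n /= add0r => s1.
  have := him s t ss tt; have := expR_gt0 (re (L s t)).
  have : (sin (y s t) - 1) * (sin (y s t) + 1) = 0 by rewrite -subr_sqr s1 expr1n subrr.
  move/eqP; rewrite mulf_eq0 subr_eq0 addr_eq0 => /orP[]/eqP -> E0 hh; split => //; nra.
have [caa [saa _]] := corner a a aa aa erefl.
have {}saa : sin (y a a) = -1 by apply: saa; rewrite subrr; flra.
(* Relative to [phi] the argument at the corner [(a, a)] is [- (pi / 2)]. The sign of the real part
   on each edge then determines it at the corners [(a, b)], [(b, b)], [(b, a)] in turn. *)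
pose phi := y a a + pi / 2.
have cphi t : cos (t - phi) = cos t.
  rewrite /phi opprD addrA cosBpihalf sinB caa saa; ring.
have sphi t : sin (t - phi) = sin t.
  rewrite /phi opprD addrA sinBpihalf cosB caa saa; ring.
have ys t : a <= t <= b -> rcont (fun s => y s t) a b by move=> tt; exact: rcont_im (Ls t tt).
have yt s : a <= s <= b -> rcont (y s) a b by move=> ss; exact: rcont_im (Lt s ss).
have cpos s t : a <= s <= b -> a <= t <= b -> re (p t) <= re (p s) -> 0 <= cos (y s t).
  move=> ss tt h; rewrite -(pmulr_rge0 _ (expR_gt0 (re (L s t)))) -hre //; flra.
have cneg s t : a <= s <= b -> a <= t <= b -> re (p s) <= re (p t) -> cos (y s t) <= 0.
  move=> ss tt h; rewrite -(pmulr_rle0 _ (expR_gt0 (re (L s t)))) -hre //; flra.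
have eaa : y a a - phi = - (pi / 2) by rewrite /phi; ring.
have h1 : `|y a b - phi| <= pi / 2.
  apply: (cos_band (s := a) (yt a aa)) => //.
    by move=> t tt; rewrite cphi cpos // eab hX.
  by rewrite eaa normrN ger0_norm //; flra.
have eab' : y a b - phi = - (pi / 2).
  have [_ [h _]] := corner a b aa bb eab.
  have := @sin_eq1_half (- (y a b - phi)); rewrite normrN sinN sphi => h'.
  by have := h' h1; rewrite h; flra.
have h2 : `|y b b - (phi - pi)| <= pi / 2.
  apply: (cos_band (s := a) (ys b bb)) => //.
    move=> s ss; have -> : y s b - (phi - pi) = (y s b - phi) + pi by ring.
    by rewrite cosDpi cphi oppr_ge0 cneg // hX.
  have -> : y a b - (phi - pi) = pi / 2 by flra.
  by rewrite ger0_norm //; flra.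
have ebb : y b b - phi = - (pi / 2).
  have [_ [h _]] := corner b b bb bb erefl.
  have := sin_eq1_half h2; have -> : y b b - (phi - pi) = (y b b - phi) + pi by ring.
  rewrite sinDpi sphi h ?opprK; last by rewrite subrr; flra.
  by move=> /(_ erefl); flra.
have h3 : `|y b a - phi| <= pi / 2.
  apply: (cos_band (s := b) (yt b bb)) => //.
    by move=> t tt; rewrite cphi cpos // hX.
  by rewrite ebb normrN ger0_norm //; flra.
have eba : y b a - phi = pi / 2.
  have [_ [_ h]] := corner b a bb aa (esym eab).
  by apply: sin_eq1_half => //; rewrite sphi h //; flra.
(* Back at the first corner the argument would be at least [phi + pi / 2], whereas it is
   [phi - pi / 2]. *)
have : `|y a a - (phi + pi)| <= pi / 2.
  apply: (cos_band (s := b) (ys a aa)) => //.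
    move=> s ss; have -> : y s a - (phi + pi) = (y s a - phi) - pi by ring.
    by rewrite -[cos _]opprK -cosDpi subrK cphi oppr_ge0 cneg // eab hX.
  have -> : y b a - (phi + pi) = - (pi / 2) by flra.
  by rewrite normrN ger0_norm //; flra.
by rewrite ler_norml; flra.
Qed.

(** If the curves did not meet, the argument of [p s - q t] could be followed round the parameter
    rectangle. The four edges confine this difference to the right, upper, left and lower half-plane
    in turn, which forces a full turn. *)
Lemma crossing p q a b c d : a <= b -> c <= d -> ccont p a b -> ccont q c d ->
  (forall t, c <= t <= d -> im (p a) < im (q t)) ->
  (forall t, c <= t <= d -> im (q t) < im (p b)) ->
  (forall s, a <= s <= b -> re (q c) <= re (p s)) ->
  (forall s, a <= s <= b -> re (p s) <= re (q d)) ->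
  exists s t, [/\ a <= s <= b, c <= t <= d & p s = q t].
Proof.
move=> ab cd hp hq hlo hhi hl hr; apply: contrapT => hno.
have aa : a <= a <= b by rewrite lexx.
have bb : a <= b <= b by rewrite lexx andbT.
have cc : c <= c <= d by rewrite lexx.
have dd : c <= d <= d by rewrite lexx andbT.
have [|L [LE Ls Lt]] := square_log ab cd hp hq.
  by move=> s t ss tt; apply/eqP => h; apply: hno; exists s, t.
pose y s t := im (L s t).
have hre s t : a <= s <= b -> c <= t <= d -> re (p s) - re (q t) = expR (re (L s t)) * cos (y s t).
  by move=> ss tt; have := LE s t ss tt; move/(congr1 (@complex.Re R)); rewrite !reimE /= => ->.
have him s t : a <= s <= b -> c <= t <= d -> im (p s) - im (q t) = expR (re (L s t)) * sin (y s t).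
  by move=> ss tt; have := LE s t ss tt; move/(congr1 (@complex.Im R)); rewrite !reimE /= => ->.
have p0 := @pi_gt0 R.
have [k hk] := near_2pin (y a c); pose phi := twopi R * k%:~R.
have cphi t : cos (t - phi) = cos t by rewrite /phi -mulrN -intrN cos_2pin.
have sphi t : sin (t - phi) = sin t by rewrite /phi -mulrN -intrN sin_2pin.
have ys t : c <= t <= d -> rcont (fun s => y s t) a b by move=> tt; exact: rcont_im (Ls t tt).
have yt s : a <= s <= b -> rcont (y s) c d by move=> ss; exact: rcont_im (Lt s ss).
have cl s : a <= s <= b -> 0 <= cos (y s c).
  move=> ss; rewrite -(pmulr_rge0 _ (expR_gt0 (re (L s c)))) -hre //; have := hl s ss; flra.
have cr s : a <= s <= b -> cos (y s d) <= 0.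
  move=> ss; rewrite -(pmulr_rle0 _ (expR_gt0 (re (L s d)))) -hre //; have := hr s ss; flra.
have sl t : c <= t <= d -> sin (y a t) < 0.
  move=> tt; rewrite -(pmulr_rlt0 _ (expR_gt0 (re (L a t)))) -him //; have := hlo t tt; flra.
have sh t : c <= t <= d -> 0 < sin (y b t).
  move=> tt; rewrite -(pmulr_rgt0 _ (expR_gt0 (re (L b t)))) -him //; have := hhi t tt; flra.
have h0 : `|y a c - phi| <= pi / 2.
  rewrite leNgt; apply/negP => h; have := cl a aa; rewrite -cphi -cos_norm leNgt => /negP; apply.
  by rewrite -cos_pihalf ltr_cos ?in_itv //=; rewrite -/phi in hk; flra.
have h0' : y a c - phi < 0.
  have := @sin_gt0_half (- (y a c - phi)); rewrite normrN sinN sphi => h.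
  by have := h h0; have := sl c cc; flra.
have h1 : `|y b c - phi| <= pi / 2.
  by apply: (cos_band (s := a) (ys c cc)) => // s ss; rewrite cphi cl.
have h1' : 0 < y b c - phi by apply: sin_gt0_half; rewrite ?sphi ?sh.
have h2 : `|y b d - (phi + pi / 2)| <= pi / 2.
  apply: (cos_band (s := c) (yt b bb)) => //.
    move=> t tt; have -> : y b t - (phi + pi / 2) = (y b t - phi) - pi / 2 by ring.
    by rewrite cosBpihalf sphi ltW // sh.
  by move: h1; rewrite !ler_norml; flra.
have h2' : pi / 2 <= y b d - phi.
  rewrite leNgt; apply/negP => h; have := cr b bb; rewrite -cphi leNgt => /negP; apply.
  by apply: cos_gt0_pihalf; move: h2; rewrite ler_norml; flra.
have h3 : `|y a d - (phi + pi)| <= pi / 2.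
  apply: (cos_band (s := b) (ys d dd)) => //.
    move=> s ss; have -> : y s d - (phi + pi) = (y s d - phi) - pi by ring.
    by rewrite -[cos _]opprK -cosDpi subrK cphi oppr_ge0 cr.
  by move: h2; rewrite !ler_norml; flra.
have : `|y a d - (phi - pi / 2)| <= pi / 2.
  apply: (cos_band (s := c) (yt a aa)) => //.
    move=> t tt; have -> : y a t - (phi - pi / 2) = (y a t - phi) + pi / 2 by ring.
    by rewrite cosDpihalf sphi oppr_ge0 ltW // sl.
  by move: h0; rewrite !ler_norml; flra.
by move: h3; rewrite !ler_norml; flra.
Qed.

End Lifting.

(** * Hairs *)

Section Hairs.
Variable R : realType.
Local Notation C := R[i].
Variable a : C.
Implicit Types (z w u v : C) (x y t r S T e : R) (k : nat -> int) (n m j : nat).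

Local Notation f := (expmap a).
Local Notation F n z := (iter n (expmap a) z).
Local Notation A0 := (normc a).

(** 600 exceeds the threshold 512 of [expR_lower], and even [R0 - 100] exceeds [normc a + 144],
    where inverse branches contract. *)
Definition R0 : R := 10 * normc a + 600.
Definition inX r z := forall n, r <= re (F n z).
Definition addr k z := forall n, strip (k n) (F n z).

Lemma A0_ge0 : 0 <= A0. Proof. exact: normc_ge0. Qed.
Lemma re_a_le : re a <= A0. Proof. exact: le_trans (ler_norm _) (normc_re _). Qed.
Lemma re_a_ge : - A0 <= re a.
Proof. have := normc_re a; rewrite ler_norml; flra. Qed.

Lemma expmapBa z : f z - a = cexp z. Proof. by rewrite /expmap addrK. Qed.
Lemma normc_expmapBa z : normc (f z - a) = expR (re z).
Proof. by rewrite expmapBa normc_cexp. Qed.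
Lemma expmap_ipi z (l : int) : f (z + ipi R l) = f z.
Proof. by rewrite /expmap cexp_ipi. Qed.
Lemma iter_expmapD n m z : F (n + m) z = F n (F m z). Proof. by rewrite iterD. Qed.
Lemma iter_expmapS n z : F n.+1 z = F n (f z). Proof. by rewrite iterSr. Qed.

Lemma inX_le r r' z : r' <= r -> inX r z -> inX r' z.
Proof. by move=> h hz n; apply: le_trans h (hz n). Qed.
Lemma inX_iter r n z : inX r z -> inX r (F n z).
Proof. by move=> h m; rewrite -iter_expmapD. Qed.

Lemma strip_expmap z : 0 < re (f z - a) -> exists l, strip l z.
Proof.
by rewrite expmapBa /= (pmulr_rgt0 _ (expR_gt0 _)) => /cos_gt0_strip.
Qed.

Lemma inX_addr r z : A0 < r -> inX r z -> exists k, addr k z.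
Proof.
move=> hr hz; have /choice[k hk] n : exists l, strip l (F n z).
  apply: strip_expmap; rewrite reimE; have := hz n.+1; have := re_a_le => /=.
  by rewrite reimE; flra.
by exists k.
Qed.

Lemma addr_iter k z m : addr k z -> addr (fun n => k (n + m)%N) (F m z).
Proof. by move=> h n; rewrite -iter_expmapD. Qed.

Lemma addr_uniq k k' z : addr k z -> addr k' z -> k = k'.
Proof. by move=> h h'; apply/funext => n; apply: strip_uniq (h n) (h' n). Qed.

Lemma strip_ipi (l l' : int) z : strip l z -> strip (l + l') (z + ipi R l').
Proof.
rewrite /strip !reimE /= intrD mulrDr; congr (_ < _); congr (`|_|); ring.
Qed.

Lemma strip_Log u : strip 0 (Log u).
Proof. by rewrite /strip mulr0 subr0 im_Log. Qed.

Lemma Log_branch (l : int) z : strip l z -> 0 < re (f z - a) ->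
  z = Log (f z - a) + ipi R l.
Proof.
move=> sl h; have e : cexp z = cexp (Log (f z - a)) by rewrite cexp_Log // expmapBa.
have [l' el'] := cexp_eq e; rewrite {1}el'; congr (_ + ipi R _).
apply: (strip_uniq (z := z)) => //; rewrite el'.
by have := strip_ipi l' (strip_Log (f z - a)); rewrite add0r.
Qed.

Lemma expmap_branch (l : int) u : 0 < re (u - a) -> f (Log (u - a) + ipi R l) = u.
Proof. by move=> h; rewrite expmap_ipi /expmap cexp_Log // subrK. Qed.

Lemma strip_branch (l : int) u : strip l (Log u + ipi R l).
Proof. by have := strip_ipi l (strip_Log u); rewrite add0r. Qed.

(** 144 is 9 times 16, with 9 the constant of [Log_lip]. *)
Lemma branch_lip u v : A0 + 144 <= re u -> A0 + 144 <= re v ->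
  normc (Log (u - a) - Log (v - a)) <= normc (u - v) / 16.
Proof.
move=> hu hv; have h := @Log_lip R 144 (u - a) (v - a); have := re_a_le => hra.
apply: le_trans (h _ _ _) _; rewrite ?reimE; [flra|flra|flra|].
have -> : u - a - (v - a) = u - v by ring.
flra.
Qed.

Lemma expmap_expand (l : int) u v : strip l u -> strip l v ->
  A0 + 144 <= re (f u) -> A0 + 144 <= re (f v) -> 16 * normc (u - v) <= normc (f u - f v).
Proof.
move=> su sv hu hv; have hra := re_a_le.
have eu : u = Log (f u - a) + ipi R l by apply: Log_branch => //; rewrite reimE reN; flra.
have ev : v = Log (f v - a) + ipi R l by apply: Log_branch => //; rewrite reimE reN; flra.
have -> : u - v = Log (f u - a) - Log (f v - a) by rewrite {1}eu {1}ev; ring.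
have := branch_lip hu hv; flra.
Qed.

Lemma iter_expand n u v k :
  (forall j, (j <= n)%N -> A0 + 144 <= re (F j u)) ->
  (forall j, (j <= n)%N -> A0 + 144 <= re (F j v)) ->
  (forall j, (j < n)%N -> strip (k j) (F j u)) ->
  (forall j, (j < n)%N -> strip (k j) (F j v)) ->
  16 ^+ n * normc (u - v) <= normc (F n u - F n v).
Proof.
elim: n u v k => [|n IH] u v k hu hv su sv; first by rewrite expr0 mul1r.
rewrite exprSr -mulrA; apply: le_trans (_ : 16 ^+ n * normc (f u - f v) <= _).
  rewrite ler_pM2l ?exprn_gt0 //; apply: (@expmap_expand (k 0%N)).
  - exact: su 0%N _.
  - exact: sv 0%N _.
  - exact: hu 1%N _.
  - exact: hv 1%N _.
rewrite !iter_expmapS; apply: (IH _ _ (fun j => k j.+1)) => j hj; rewrite -iter_expmapS.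
- exact: hu. - exact: hv. - exact: su. - exact: sv.
Qed.

Lemma natr_le_pow2 n : n%:R <= 2 ^+ n :> R.
Proof.
elim: n => [|n IH]; first by rewrite expr0.
rewrite exprS -natr1; have : 1 <= 2 ^+ n :> R by rewrite exprn_ege1 //; flra.
flra.
Qed.

Lemma pow2_le n m : (n <= m)%N -> 2 ^+ n <= 2 ^+ m :> R.
Proof. by move=> h; apply: ler_weXn2l => //; flra. Qed.

Lemma pow16_le n x : (forall n, 16 ^+ n * x <= 100) -> 0 <= x -> x = 0.
Proof.
move=> h x0; apply/eqP; rewrite eq_le x0 andbT leNgt; apply/negP => xp.
have hp m : m%:R <= 16 ^+ m :> R.
  elim: m => [|m IH]; first by rewrite expr0.
  rewrite exprS -natr1; have : 1 <= 16 ^+ m :> R by rewrite exprn_ege1 //; flra.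
  flra.
have := h (Num.truncn (100 / x)).+1; apply/negP; rewrite -ltNge.
rewrite -ltr_pdivrMr //; apply: lt_le_trans (truncnS_gt _) _; exact: hp.
Qed.

(** Expansivity: along a common itinerary distances grow by a factor of at least 16 per step, so a
    bounded distance must be zero. *)
Lemma addr_inj k u v : inX (A0 + 144) u -> inX (A0 + 144) v -> addr k u -> addr k v ->
  (forall n, normc (F n u - F n v) <= 100) -> u = v.
Proof.
move=> hu hv ku kv h; apply/eqP; rewrite -subr_eq0; apply/eqP/normc_eq0.
rewrite (@pow16_le 0 (normc (u - v))) ?normc_ge0 // => n.
by apply: le_trans (h n); apply: (@iter_expand _ _ _ k) => j _; [apply: hu|apply: hv|apply: ku|apply: kv].
Qed.

(* The inverse branches contract, so a pseudo-orbit with a prescribed itinerary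
   is the limit of its pullbacks. *)
Lemma shadowing (v : nat -> C) k (D : R) : 0 <= D ->
  (forall n, A0 + 144 + 2 * D <= re (v n)) ->
  (forall n, normc (v n - (Log (v n.+1 - a) + ipi R (k n))) <= D) ->
  exists w, forall n, normc (F n w - v n) <= 2 * D /\ strip (k n) (F n w).
Proof.
move=> D0 hv hD; have hra := re_a_le.
(* [B m n] is [v (n + m)] pulled back [m] times, down to level [n]. *)
pose B := fix B m n := if m is m'.+1 then Log (B m' n.+1 - a) + ipi R (k n) else v n.
have near z n : normc (z - v n) <= 2 * D -> A0 + 144 <= re z.
  move=> h; have := hv n; have := normc_re (z - v n); rewrite !reimE ler_norml; flra.
have br z z' n : A0 + 144 <= re z -> A0 + 144 <= re z' ->
   normc (Log (z - a) + ipi R (k n) - (Log (z' - a) + ipi R (k n))) <= normc (z - z') / 16.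
  move=> h h'; have -> : forall p q s : C, p + q - (s + q) = p - s by move=> p q s; ring.
  exact: branch_lip.
have Bv m n : normc (B m n - v n) <= 2 * D.
  elim: m n => [|m IH] n; first by rewrite /= subrr normc0; flra.
  have h1 := br _ _ n (near _ _ (IH n.+1)) (near (v n.+1) n.+1 _).
  have h2 : normc (B m.+1 n - (Log (v n.+1 - a) + ipi R (k n))) <= normc (B m n.+1 - v n.+1) / 16.
    by apply: h1; rewrite subrr normc0; flra.
  have h3 := ler_normc_tri (Log (v n.+1 - a) + ipi R (k n)) (B m.+1 n) (v n).
  have := IH n.+1; have := hD n; rewrite (normcB (v n)); flra.
have BB m n : normc (B m.+1 n - B m n) <= D / 2 ^+ m.
  elim: m n => [|m IH] n; first by rewrite normcB expr0 divr1 /=; exact: hD.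
  apply: le_trans (br _ _ n (near _ _ (Bv m.+1 n.+1)) (near _ _ (Bv m n.+1))) _.
  have := IH n.+1; rewrite exprS invfM; set q := 2 ^- m => h.
  have q0 : 0 <= q by rewrite invr_ge0 exprn_ge0.
  have := mulr_ge0 D0 q0; flra.
have /choice[W hW] n : exists l, forall m, normc (B m n - l) <= 4 * D / 2 ^+ m.
  by have [l hl] := geometric_cvgC (fun m => BB m n); exists l.
have small e : 0 < e -> exists m, 4 * D / 2 ^+ m <= e.
  move=> e0; exists (Num.truncn (4 * D / e)).+1.
  rewrite ler_pdivrMr ?exprn_gt0 // (mulrC e) -ler_pdivrMr //.
  apply: le_trans (ltW (truncnS_gt _)) _.
  exact: natr_le_pow2.
have Wv n : normc (W n - v n) <= 2 * D.
  apply/ler_addgt0Pr => e e0; have [m hm] := small e e0.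
  have := ler_normc_tri (B m n) (W n) (v n); have := hW n m; have := Bv m n.
  rewrite (normcB (W n) (B m n)); flra.
have WE n : W n = Log (W n.+1 - a) + ipi R (k n).
  apply: eq_small => e e0; have [m hm] := small (e / 2) ltac:(flra).
  have h1 := br _ _ n (near _ _ (Bv m n.+1)) (near _ _ (Wv n.+1)).
  have h2 := ler_normc_tri (B m.+1 n) (W n) (Log (W n.+1 - a) + ipi R (k n)).
  have h3 := hW n m.+1; rewrite (normcB (W n) (B m.+1 n)) in h2; have h4 := hW n.+1 m.
  have h5 : 4 * D / 2 ^+ m.+1 <= 4 * D / 2 ^+ m.
    apply: ler_wpM2l; first by flra.
    by rewrite lef_pV2 ?posrE ?exprn_gt0 // pow2_le.
  move: h1; rewrite -/(B m.+1 n) => h1; flra.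
have FW n : F n (W 0%N) = W n.
  elim: n => [//|n IH] /=; rewrite IH {1}WE expmap_branch // !reimE.
  by have := near _ _ (Wv n.+1); flra.
exists (W 0%N) => n; rewrite FW; split; first exact: Wv.
by rewrite WE; exact: strip_branch.
Qed.

(* Growth of the parameter along a hair: [F n w + tau n w T] is a pseudo-orbit. *)
Fixpoint tau n w T : R :=
  if n is n'.+1 then expR (re (F n' w)) * (expR (tau n' w T) - 1) else T.

Lemma tauD n m w T : tau (n + m) w T = tau n (F m w) (tau m w T).
Proof. by elim: n => [//|n IH] /=; rewrite IH iter_expmapD. Qed.

Lemma tau0 n w : tau n w 0 = 0.
Proof. by elim: n => [//|n IH] /=; rewrite IH expR0 subrr mulr0. Qed.

Lemma tau_expand n w S T : inX 1 w -> 0 <= S -> S <= T ->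
  2 ^+ n * (T - S) <= tau n w T - tau n w S /\ 0 <= tau n w S.
Proof.
move=> hw S0 ST; elim: n => [|n [IH1 IH2]]; first by rewrite expr0 mul1r.
rewrite /= exprS -mulrA; set s := tau n w S in IH1 IH2 *; set t := tau n w T in IH1 *.
have ts : 0 <= t - s by apply: le_trans IH1; rewrite mulr_ge0 ?exprn_ge0 ?subr_ge0.
have h1 : 2 <= expR (re (F n w)).
  have := expR_ge1Dx (re (F n w)); have := hw n; flra.
have h2 : t - s <= expR t - expR s.
  have e1 := expR_ge1Dx (t - s); have e2 := expR_ge1Dx s.
  have -> : expR t = expR s * expR (t - s) by rewrite -expRD addrC subrK.
  nra.
split; last by have := expR_ge1Dx s; nra.
have -> : expR (re (F n w)) * (expR t - 1) - expR (re (F n w)) * (expR s - 1) =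
  expR (re (F n w)) * (expR t - expR s) by ring.
nra.
Qed.

Lemma tau_ge0 n w T : inX 1 w -> 0 <= T -> 0 <= tau n w T.
Proof. by move=> hw T0; have [] := tau_expand n hw T0 (lexx T). Qed.

Lemma tau_ge n w T : inX 1 w -> 0 <= T -> 2 ^+ n * T <= tau n w T.
Proof.
by move=> hw T0; have [] := tau_expand n hw (lexx 0) T0; rewrite tau0 !subr0.
Qed.

Lemma tau_le n w S T : inX 1 w -> 0 <= S -> S <= T -> tau n w S <= tau n w T.
Proof.
move=> hw S0 ST; have [h _] := tau_expand n hw S0 ST.
have : 0 <= 2 ^+ n * (T - S) by rewrite mulr_ge0 ?exprn_ge0 ?subr_ge0.
flra.
Qed.

Lemma tau_surj n w S : inX 1 w -> 0 <= S -> exists2 T, 0 <= T & tau n w T = S.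
Proof.
move=> hw; elim: n S => [|n IH] S S0; first by exists S.
have E0 := expR_gt0 (re (F n w)).
have h : 1 <= 1 + S / expR (re (F n w)) by rewrite lerDl divr_ge0 // ltW.
have [T T0 hT] := IH _ (ln_ge0 h); exists T => //=.
by rewrite hT lnK ?posrE; [field; rewrite gt_eqF|flra].
Qed.

Lemma pow2_gt x T : 0 < T -> exists n, x < 2 ^+ n * T.
Proof.
move=> T0; exists (Num.truncn (x / T)).+1; rewrite -ltr_pdivrMr //.
apply: lt_le_trans (truncnS_gt _) _.
exact: natr_le_pow2.
Qed.

Lemma tau_large x w T : inX 1 w -> 0 < T -> exists N, forall n, (N <= n)%N -> x < tau n w T.
Proof.
move=> hw T0; have [N hN] := pow2_gt x T0; exists N => n Nn.
apply: lt_le_trans (tau_ge n hw (ltW T0)); apply: lt_le_trans hN _.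
by rewrite ler_pM2r // pow2_le.
Qed.

(** Moving a point to the right by [T] multiplies its exponential [u] by [expR T], whereas the
    pseudo-orbit translates [u] by the real number of the same growth. The two moduli agree up to a
    factor of 2, which costs at most 1 in the real part of the logarithm, and the arguments differ
    by less than pi. *)
Lemma hair_estimate u T : 0 < re u -> 0 <= T ->
  normc (T%:C + Log u - Log (u + (normc u * (expR T - 1))%:C)) <= 5.
Proof.
move=> u0 T0; set n : R := normc u; set q : R := expR T - 1.
have n0 : 0 < n by apply: lt_le_trans u0 (le_trans (ler_norm _) (normc_re _)).
have q0 : 0 <= q by have := expR_ge1Dx T; rewrite /q; flra.
set v := u + _; have hv : normc v ^+ 2 = n ^+ 2 * (1 + q ^+ 2) + 2 * (n * q * re u).
  have e := sqr_normcE u; rewrite -/n in e; rewrite sqr_normcE /v !reimE /= addr0.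
  by have -> : im u ^+ 2 = n ^+ 2 - re u ^+ 2 by [rewrite e; ring]; ring.
have nq : 0 <= n * q * re u by rewrite !mulr_ge0 // ltW.
have v1 : normc v <= n * expR T.
  apply: le_trans (ler_normcD _ _) _; rewrite normc_real ger0_norm ?mulr_ge0 ?(ltW n0) //.
  by rewrite -/n /q; flra.
have v2 : n * expR T / 2 <= normc v.
  rewrite -(@ler_pXn2r _ 2) ?nnegrE ?normc_ge0 ?divr_ge0 ?mulr_ge0 ?expR_ge0 ?(ltW n0) //.
  rewrite hv; have -> : expR T = 1 + q by rewrite /q; ring.
  have := sqr_ge0 (1 - q); have : 0 < n ^+ 2 by rewrite exprn_gt0.
  nra.
have v0 : 0 < normc v.
  by apply: lt_le_trans v2; rewrite divr_gt0 ?mulr_gt0 ?expR_gt0.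
have hre : 0 <= T + ln n - ln (normc v) <= 1.
  have e1 : T + ln n = ln (n * expR T) by rewrite lnM ?posrE ?expR_gt0 // expRK addrC.
  have e2 : ln (normc v) <= ln (n * expR T) by rewrite ler_ln ?posrE // mulr_gt0 ?expR_gt0.
  have e3 : ln (n * expR T / 2) <= ln (normc v) by rewrite ler_ln ?posrE // divr_gt0 ?mulr_gt0 ?expR_gt0.
  rewrite ln_div ?posrE ?mulr_gt0 ?expR_gt0 // -e1 in e3.
  have e4 : ln 2 <= 1 :> R by have := @le_ln1Dx R 1; have -> : 1 + 1 = 2 :> R by []; apply; flra.
  flra.
have hi : im (T%:C + Log u - Log v) = im (Log u) - im (Log v) by rewrite !reimE add0r.
have hr : re (T%:C + Log u - Log v) = T + ln n - ln (normc v) by rewrite !reimE.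
apply: le_trans (normc_le_reim _) _; rewrite hi hr.
have : `|T + ln n - ln (normc v)| <= 1 by rewrite ler_norml; flra.
have := im_Log u; have := im_Log v; have := pi_lt4 R; move: (im (Log u)) (im (Log v)) => p q'.
rewrite !ltr_norml => h1 h2 h3 h4; have : `|p - q'| <= 4 by rewrite ler_norml; flra.
flra.
Qed.

End Hairs.

(** * The map [Phi]: existence, continuity and order of points on hairs *)

Section HairMap.
Variable R : realType.
Local Notation C := R[i].
Variable a : C.
Implicit Types (z w u v : C) (x y t r S T e : R) (k : nat -> int) (n m j : nat).

Local Notation f := (expmap a).
Local Notation F n z := (iter n (expmap a) z).
Local Notation A0 := (normc a).
Local Notation R0 := (R0 a).
Local Notation inX := (inX a).
Local Notation addr := (addr a).
Local Notation tau := (tau a).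

Lemma R0E : R0 = 10 * A0 + 600. Proof. by []. Qed.

Lemma inX1 r z : R0 <= r -> inX r z -> inX 1 z.
Proof. by move=> h; apply: inX_le; have := A0_ge0 a; rewrite R0E in h; flra. Qed.

Lemma inX144 r z : R0 <= r -> inX (r - 100) z -> inX (A0 + 144) z.
Proof. by move=> h; apply: inX_le; have := A0_ge0 a; rewrite R0E in h; flra. Qed.

Lemma inR0_addr z : inX R0 z -> exists k, addr k z.
Proof. by apply: inX_addr; have := A0_ge0 a; rewrite R0E; flra. Qed.

(** The bound 10 is twice the defect 5 of the pseudo-orbit, as [shadowing] delivers; with the common
    itinerary it determines [u]. *)
Definition hairP w T u := (forall n, normc (F n u - (F n w + (tau n w T)%:C)) <= 10) /\
  exists k, addr k w /\ addr k u.
(* The point with parameter [T] on the hair issuing from [w] (junk value [w] if there is none). *)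
Definition Phi w T := xget w (hairP w T).

Lemma hair_exists w T : inX R0 w -> 0 <= T -> exists u, hairP w T u.
Proof.
move=> hw T0; have [k hk] := inR0_addr hw.
have A1 := A0_ge0 a; have hra := re_a_le a.
have t0 n := tau_ge0 n (inX1 (lexx _) hw) T0.
have [|n|n|u hu] := @shadowing _ a (fun n => F n w + (tau n w T)%:C) k 5.
- by [].
- rewrite !reimE /=; have := hw n; have := t0 n; rewrite R0E; flra.
- set u := F n.+1 w - a.
  have u0 : 0 < re u by rewrite reD reN; have := hw n.+1; rewrite R0E; flra.
  have nu : normc u = expR (re (F n w)) by rewrite /u /= normc_expmapBa.
  have -> : F n.+1 w + (tau n.+1 w T)%:C - a = u + (normc u * (expR (tau n w T) - 1))%:C.
    by rewrite /= nu /u /=; ring.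
  have e : F n w = Log u + ipi R (k n) by apply: Log_branch.
  have -> : F n w + (tau n w T)%:C - (Log (u + (normc u * (expR (tau n w T) - 1))%:C) + ipi R (k n)) =
    (tau n w T)%:C + Log u - Log (u + (normc u * (expR (tau n w T) - 1))%:C) by rewrite {1}e; ring.
  exact: hair_estimate.
exists u; split; first by move=> n; have [] := hu n; flra.
by exists k; split => // n; have [] := hu n.
Qed.

Lemma hairP_inX w T u r : inX R0 w -> 0 <= T -> inX r w -> hairP w T u -> inX (r - 10) u.
Proof.
move=> hw T0 hr [h _] n; have := h n; have := hr n; have := tau_ge0 n (inX1 (lexx _) hw) T0.
have := normc_re (F n u - (F n w + (tau n w T)%:C)); rewrite !reimE /= ler_norml; flra.
Qed.

Lemma hairP_uniq w T u u' : inX R0 w -> 0 <= T -> hairP w T u -> hairP w T u' -> u = u'.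
Proof.
move=> hw T0 hu hu'.
have := hairP_inX hw T0 hw hu; have := hairP_inX hw T0 hw hu'.
case: hu hu' => h [k [kw ku]] [h' [k' [kw' ku']]] i' i.
move: ku'; rewrite -(addr_uniq kw kw') => ku'.
apply: (@addr_inj _ a k) => //; last 1 first.
  move=> n; have h1 := h n; have h2 := h' n; move: h1 h2.
  have := ler_normc_tri (F n w + (tau n w T)%:C) (F n u) (F n u').
  rewrite (normcB (_ + _) (F n u')); flra.
- by apply: (inX144 (r := R0 )) => //; apply: inX_le i; flra.
- by apply: (inX144 (r := R0 )) => //; apply: inX_le i'; flra.
Qed.

Lemma PhiP w T : inX R0 w -> 0 <= T -> hairP w T (Phi w T).
Proof. by move=> hw T0; apply: xgetPex; exact: hair_exists. Qed.

Lemma Phi_close w T n : inX R0 w -> 0 <= T ->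
  normc (F n (Phi w T) - (F n w + (tau n w T)%:C)) <= 10.
Proof. by move=> hw T0; have [] := PhiP hw T0. Qed.

Lemma Phi_re w T n : inX R0 w -> 0 <= T ->
  `|re (F n (Phi w T)) - (re (F n w) + tau n w T)| <= 10.
Proof.
move=> hw T0; apply: le_trans (Phi_close n hw T0).
by apply: le_trans (normc_re _); rewrite !reimE.
Qed.

Lemma Phi_addr w T k : inX R0 w -> 0 <= T -> addr k w -> addr k (Phi w T).
Proof.
by move=> hw T0 hk; have [_ [k' [h1 h2]]] := PhiP hw T0; rewrite (addr_uniq hk h1).
Qed.

Lemma Phi_inX w T r : R0 <= r -> inX r w -> 0 <= T -> inX (r - 10) (Phi w T).
Proof.
move=> hr hw T0; have h0 := inX_le hr hw.
exact: hairP_inX hw (PhiP h0 T0).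
Qed.

Lemma Phi_inX144 w T : inX R0 w -> 0 <= T -> inX (A0 + 144) (Phi w T).
Proof.
move=> hw T0; apply: (inX144 (r := R0)) => //.
by apply: inX_le (Phi_inX (lexx _) hw T0); flra.
Qed.

Lemma Phi_uniq w T u : inX R0 w -> 0 <= T -> hairP w T u -> u = Phi w T.
Proof. by move=> hw T0 h; apply: hairP_uniq hw T0 h (PhiP hw T0). Qed.

Lemma Phi_iter w T m : inX R0 w -> 0 <= T -> F m (Phi w T) = Phi (F m w) (tau m w T).
Proof.
move=> hw T0; apply: Phi_uniq; [exact: inX_iter|exact: tau_ge0 (inX1 (lexx _) hw) T0|].
split=> [n|]; first by rewrite -!iter_expmapD -tauD; exact: Phi_close.
have [k hk] := inR0_addr hw; exists (fun n => k (n + m)%N).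
by split; apply: addr_iter => //; exact: Phi_addr.
Qed.

Lemma Phi0 w : inX R0 w -> Phi w 0 = w.
Proof.
move=> hw; rewrite -(@Phi_uniq w 0 w) //; split.
  by move=> n; rewrite tau0 addr0 subrr normc0.
by have [k hk] := inR0_addr hw; exists k.
Qed.

Lemma addr_imdist k u v n : addr k u -> addr k v -> `|im (F n u) - im (F n v)| < 4.
Proof. by move=> hu hv; apply: lt_trans (strip_dist (hu n) (hv n)) (pi_lt4 _). Qed.

Lemma cont_at_expmap z : cont_at f z.
Proof.
move=> e e0; have E0 := expR_gt0 (re z).
exists (Num.min 2^-1 (e / (8 * expR (re z)))).
  by rewrite lt_min divr_gt0 ?mulr_gt0 // andbT.
move=> w; rewrite lt_min => /andP[h1]; rewrite ltr_pdivlMr ?mulr_gt0 // => h2.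
have -> : f w - f z = cexp z * (cexp (w - z) - 1).
  by rewrite cexpB /expmap; field; rewrite cexp_neq0.
rewrite normcM normc_cexp; have := cexp_sub1 (ltW h1); nra.
Qed.

Lemma cont_at_iter n z : cont_at (fun z => F n z) z.
Proof.
elim: n => [|n IH] e e0; first by exists e.
have [d d0 h] := cont_at_expmap (F n z) e0; have [d' d'0 h'] := IH _ d0.
by exists d' => // w /h' /h.
Qed.

Lemma ccont_iter n p b c : ccont p b c -> ccont (fun t => F n (p t)) b c.
Proof. by move=> h; apply: (ccont_comp h) => t _; exact: cont_at_iter. Qed.

Lemma cont_at_upto n z e : 0 < e -> exists2 d, 0 < d &
  forall w, normc (w - z) < d -> forall j, (j <= n)%N -> normc (F j w - F j z) < e.
Proof.
move=> e0; elim: n => [|n [d d0 h]].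
  by exists e => // w hw j; rewrite leqn0 => /eqP ->.
have [d' d'0 h'] := cont_at_iter n.+1 z e0; exists (Num.min d d'); first by rewrite lt_min d0.
move=> w; rewrite lt_min => /andP[h1 h2] j; rewrite leq_eqVlt ltnS => /orP[/eqP ->|].
  exact: h'.
exact: h.
Qed.

(** The neighbourhoods of [(w, T)] as a filter, so that joint continuity of [tau] follows from the
    limit rules for differences and products. *)
Definition jn w T : set_system (C * R) := [set P | exists2 d : R, 0 < d &
  forall w' T', normc (w' - w) < d -> `|T' - T| < d -> P (w', T')].

Instance jn_filter w T : Filter (jn w T).
Proof.
split.
- by exists 1.
- move=> P Q [d d0 h] [d' d'0 h']; exists (Num.min d d'); first by rewrite lt_min d0.
  move=> w' T'; rewrite !lt_min => /andP[? ?] /andP[? ?].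
  by split; [apply: h|apply: h'].
- by move=> P Q PQ [d d0 h]; exists d => // w' T' h1 h2; apply: PQ; apply: h.
Qed.

Lemma tau_jcont n w T : tau n p.1 p.2 @[p --> jn w T] --> tau n w T.
Proof.
have hre m : expR (re (F m p.1)) @[p --> jn w T] --> expR (re (F m w)).
  apply: (continuous_cvg _ (@continuous_expR R _)).
  apply/cvgrPdist_lt => e e0; have [d d0 h] := cont_at_iter m w e0.
  exists d => // w' T' hw _ /=; apply: le_lt_trans (h _ hw).
  by rewrite distrC -reN -reD; exact: normc_re.
elim: n => [|n IH].
  apply/cvgrPdist_lt => e e0; exists e => // w' T' _ /=; by rewrite distrC.
apply: cvgM; first exact: hre.
apply: cvgB; last exact: cvg_cst.
exact: (continuous_cvg _ (@continuous_expR R _)).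
Qed.

Lemma pi_gt1 : 1 < pi :> R.
Proof. by have := @pi_ge2 R; flra. Qed.

Lemma strips_close k k' u v n : addr k u -> addr k' v ->
  (forall j, (j <= n)%N -> normc (F j u - F j v) < 1) -> forall j, (j <= n)%N -> k j = k' j.
Proof.
move=> hu hv h j jn; apply: (strip_close (hu j) (hv j)).
have := normc_im (F j u - F j v); rewrite !reimE => h1.
apply: le_lt_trans h1 _; apply: lt_trans (h _ jn) _; exact: pi_gt1.
Qed.

Lemma pow16_mono n m : (n <= m)%N -> 16 ^+ n <= 16 ^+ m :> R.
Proof. by move=> h; apply: ler_weXn2l => //; flra. Qed.

Lemma pow16_gt x e : 0 < e -> exists n, x < 16 ^+ n * e.
Proof.
move=> e0; have [n hn] := @pow2_gt R x e e0; exists n; apply: lt_le_trans hn _.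
by rewrite ler_pM2r // lerXn2r ?nnegrE //; flra.
Qed.

(** Nearby base points share the first [n] entries of their itineraries, and at level [n] the two
    hair points are within 22: twice the error 10 of [Phi_close], plus 1 each for the base point and
    for [tau]. Pulling back divides this by [16 ^+ n]. *)
Lemma Phi_jcont w T e : inX R0 w -> 0 <= T -> 0 < e -> exists2 d, 0 < d &
  forall w' T', inX R0 w' -> 0 <= T' -> normc (w' - w) < d -> `|T' - T| < d ->
    normc (Phi w' T' - Phi w T) < e.
Proof.
move=> hw T0 e0; have [n hn] := pow16_gt 22 e0.
have [d d0 hd] := @cont_at_upto n w 1 ltr01.
have /cvgrPdist_lt/(_ _ ltr01)[d' d'0 hd'] := tau_jcont (n := n) (w := w) (T := T).
exists (Num.min d d'); first by rewrite lt_min d0.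
move=> w' T' hw' T'0; rewrite !lt_min => /andP[h1 h2] /andP[_ h3].
have {h2 h3} ht := hd' _ _ h2 h3; have {}h1 := hd _ h1.
have [k hk] := inR0_addr hw; have [k' hk'] := inR0_addr hw'.
have hkk := strips_close hk' hk h1.
rewrite -(@ltr_pM2l _ (16 ^+ n)) ?exprn_gt0 //; apply: le_lt_trans hn.
apply: le_trans (@iter_expand _ _ n _ _ k _ _ _ _) _.
- by move=> j _; exact: Phi_inX144.
- by move=> j _; exact: Phi_inX144.
- by move=> j /ltnW jn; rewrite -hkk //; exact: Phi_addr.
- by move=> j _; exact: Phi_addr.
have h4 := Phi_close n hw T0; have h5 := Phi_close n hw' T'0; have h6 := h1 _ (leqnn n).
have -> : F n (Phi w' T') - F n (Phi w T) = (F n (Phi w' T') - (F n w' + (tau n w' T')%:C))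
  - (F n (Phi w T) - (F n w + (tau n w T)%:C)) + (F n w' - F n w) +
    (tau n w' T' - tau n w T)%:C by ring.
have h7 : normc ((tau n w' T' - tau n w T)%:C) <= 1.
  by rewrite normc_real distrC ltW.
apply: le_trans (ler_normcD _ _) _.
have h8 := ler_normcD ((F n (Phi w' T') - (F n w' + (tau n w' T')%:C))
  - (F n (Phi w T) - (F n w + (tau n w T)%:C))) (F n w' - F n w).
have h9 := ler_normcB (F n (Phi w' T') - (F n w' + (tau n w' T')%:C))
   (F n (Phi w T) - (F n w + (tau n w T)%:C)).
flra.
Qed.

Lemma Phi_ucont w B e : inX R0 w -> 0 < e -> exists2 d, 0 < d &
  forall w' T, inX R0 w' -> 0 <= T <= B -> normc (w' - w) < d ->
    normc (Phi w' T - Phi w T) <= e.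
Proof.
move=> hw e0; have [||d d0 hd] := @heine_borel R (fun T d => forall w', inX R0 w' ->
  normc (w' - w) < d -> normc (Phi w' T - Phi w T) <= e) 0 B.
- by move=> T d d' d'0 dd h w' hw' hd; apply: h => //; flra.
- move=> T /andP[T0 _]; have e20 : 0 < e / 2 by flra.
  have [d d0 hd] := Phi_jcont hw T0 e20; exists d => //; exists d => // T' /andP[T'0 _] hT w' hw' hn.
  have h1 := hd _ _ hw' T'0 hn hT; have := hd w T' hw T'0; rewrite subrr normc0 => /(_ d0 hT) h2.
  by have := ler_normc_tri (Phi w T) (Phi w' T') (Phi w T'); rewrite (normcB (Phi w T)); flra.
by exists d => // w' T hw' hT hn; exact: hd.
Qed.

Lemma Phi_ccont w b c : inX R0 w -> 0 <= b -> ccont (Phi w) b c.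
Proof.
move=> hw b0 t tt e e0; have t0 : 0 <= t by flra.
have [d d0 hd] := Phi_jcont hw t0 e0; exists d => // t' t't ht.
apply: hd => //; first by flra.
by rewrite subrr normc0.
Qed.

(** [tau n w] stretches differences of parameters by at least [2 ^+ n], while for points that are
    close enough the stretched parameters differ by less than 21, twice the error 10 plus 1. *)
Lemma Phi_inv_cont w T0 e : inX R0 w -> 0 <= T0 -> 0 < e -> exists2 d, 0 < d &
  forall T, 0 <= T -> normc (Phi w T - Phi w T0) < d -> `|T - T0| < e.
Proof.
move=> hw T00 e0; have [n hn] := @pow2_gt R 22 e e0.
have [d d0 hd] := cont_at_iter n (Phi w T0) (@ltr01 R); exists d => // T Tge hT.
have {hT} h := hd _ hT.
have h1 : `|tau n w T - tau n w T0| < 21.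
  have := Phi_re n hw T00; have := Phi_re n hw Tge.
  have := normc_re (F n (Phi w T) - F n (Phi w T0)); rewrite !reimE !ler_norml ltr_norml; flra.
have i1 := inX1 (lexx _) hw.
rewrite ltNge; apply/negP => he.
have h2 : 2 ^+ n * e <= 2 ^+ n * `|T - T0| by rewrite ler_pM2l ?exprn_gt0.
have [TT|TT] := leP T T0.
  have [] := tau_expand n i1 Tge TT; move: h2 h1; rewrite ltr_norml (ler0_norm (_ : T - T0 <= 0)); last flra.
  by rewrite opprB; flra.
have [] := tau_expand n i1 T00 (ltW TT); move: h2 h1; rewrite ltr_norml (ger0_norm (_ : 0 <= T - T0)); last flra.
flra.
Qed.

Lemma Phi_inj w S T : inX R0 w -> 0 <= S -> 0 <= T -> Phi w S = Phi w T -> S = T.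
Proof.
move=> hw S0 T0 h; apply/eqP; rewrite -subr_eq0 -normr_le0; apply/ler_addgt0Pr => e e0.
have [d d0 hd] := Phi_inv_cont hw T0 e0; rewrite add0r ltW //; apply: hd => //.
by rewrite h subrr normc0.
Qed.

Lemma hair_closed w z B : inX R0 w ->
  (forall N, exists2 T, 0 <= T <= B & 16 ^+ N * normc (Phi w T - z) <= 200) ->
  exists2 T, 0 <= T & z = Phi w T.
Proof.
move=> hw h.
have /choice[T hT] N : exists T, 0 <= T <= B /\ 16 ^+ N * normc (Phi w T - z) <= 200.
  by have [T] := h N; exists T.
have [t /andP[t0 _] ht] := cluster_seq (fun n => (hT n).1); exists t => //.
apply/esym/eq_small => e e0; have e20 : 0 < e / 2 by flra.
have [d d0 hd] := Phi_jcont hw t0 e20; have [N hN] := pow16_gt 200 e20.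
have [n Nn hn] := ht d d0 N; have [Tn hz] := hT n.
have h1 : normc (Phi w (T n) - Phi w t) < e / 2.
  by apply: hd => //; [flra|rewrite subrr normc0].
have h2 : normc (Phi w (T n) - z) < e / 2.
  rewrite -(@ltr_pM2l _ (16 ^+ n)) ?exprn_gt0 //; apply: le_lt_trans hz (lt_le_trans hN _).
  by rewrite ler_pM2r // pow16_mono.
have := ler_normc_tri (Phi w (T n)) (Phi w t) z; rewrite (normcB (Phi w t) (Phi w (T n))); flra.
Qed.

(* Two points with the same itinerary lie on a common hair, and it suffices to
   compare real parts along a subsequence, up to a bounded error, to know their order. *)
Lemma hair_of_ge w z k : inX R0 w -> inX (A0 + 144) z -> addr k w -> addr k z ->
  (forall N, exists2 n, (N <= n)%N & re (F n w) <= re (F n z) + 100) ->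
  exists2 T, 0 <= T & z = Phi w T.
Proof.
move=> hw hz kw kz h; have i1 := inX1 (lexx _) hw.
apply: (@hair_closed w z (`|re z - re w| + 300)) => // N.
have [n Nn hn] := h N.
(* The parameter whose hair point matches [F n z] in real part, or 0 if [F n z] lies to the left of
   [F n w], which it does by at most 100. *)
have [|T T0 hT] := @tau_surj _ a n w (Num.max 0 (re (F n z) - re (F n w))) i1.
  by rewrite le_max lexx.
have hr : `|re (F n w) + tau n w T - re (F n z)| <= 100.
  rewrite hT maxEle; case: ifP => [h1|/negbT h1]; first by rewrite (_ : _ - _ = 0) ?normr0 //; ring.
  by rewrite -ltNge in h1; rewrite ger0_norm; flra.
have hi := addr_imdist n kw kz.
have h1 : normc (F n w + (tau n w T)%:C - F n z) <= 104.
  apply: le_trans (normc_le_reim _) _; rewrite !reimE /= addr0; flra.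
have h2 : normc (F n (Phi w T) - F n z) <= 114.
  have := Phi_close n hw T0.
  have := ler_normc_tri (F n w + (tau n w T)%:C) (F n (Phi w T)) (F n z); flra.
have h3 : 16 ^+ n * normc (Phi w T - z) <= 114.
  apply: le_trans (@iter_expand _ _ n _ _ k _ _ _ _) h2.
  - by move=> j _; exact: Phi_inX144.
  - by move=> j _; exact: hz.
  - by move=> j _; exact: Phi_addr.
  - by move=> j _; exact: kz.
have n0 := normc_ge0 (Phi w T - z).
have h16 : 1 <= 16 ^+ n :> R by rewrite exprn_ege1 //; flra.
exists T.
  rewrite T0 /=; have := Phi_re 0 hw T0; have := normc_re (Phi w T - z).
  rewrite !reimE /= !ler_norml; have := ler_norm (re z - re w); nra.
apply: le_trans (_ : 114 <= _); last by flra.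
by apply: le_trans h3; rewrite ler_wpM2r // pow16_mono.
Qed.

Lemma hair_param_le w S S' : inX R0 w -> 0 <= S -> 0 <= S' ->
  (forall N, exists2 n, (N <= n)%N & re (F n (Phi w S)) <= re (F n (Phi w S')) + 100) -> S <= S'.
Proof.
move=> hw S0 S'0 h; rewrite leNgt; apply/negP => SS.
have SS0 : 0 < S - S' by rewrite subr_gt0.
have [N hN] := @pow2_gt R 200 (S - S') SS0; have [n Nn hn] := h N.
have [h1 _] := tau_expand n (inX1 (lexx _) hw) S'0 (ltW SS).
have h2 : 2 ^+ N * (S - S') <= 2 ^+ n * (S - S').
  by rewrite ler_pM2r // pow2_le.
have := Phi_re n hw S0; have := Phi_re n hw S'0; rewrite !ler_norml; flra.
Qed.

Lemma Phi_large w T x : inX R0 w -> 0 < T -> exists N, forall n, (N <= n)%N ->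
  re (F n w) + x < re (F n (Phi w T)).
Proof.
move=> hw T0; have [N hN] := tau_large (x + 10) (inX1 (lexx _) hw) T0.
by exists N => n /hN; have := Phi_re n hw (ltW T0); rewrite ler_norml; flra.
Qed.

Lemma le_trivial w z : inX R0 w -> (exists2 T, 0 <= T & z = Phi w T) ->
  forall n, re (F n w) <= re (F n z) + 10.
Proof.
move=> hw [T T0 ->] n; have := Phi_re n hw T0; have := tau_ge0 n (inX1 (lexx _) hw) T0.
by rewrite ler_norml; flra.
Qed.

(** Either [F n z] is infinitely often at least as far to the right as [F n w], or eventually never;
    [hair_of_ge] settles both cases. *)
Lemma hair_cmp w z k : inX R0 w -> inX R0 z -> addr k w -> addr k z ->
  (exists2 T, 0 <= T & z = Phi w T) \/ (exists2 T, 0 <= T & w = Phi z T).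
Proof.
move=> hw hz kw kz.
have [h|h] := pselect (forall N, exists2 n, (N <= n)%N & re (F n w) <= re (F n z)).
  left; apply: (@hair_of_ge _ _ k) => //; first by apply: (inX144 (r := R0)) => //; apply: inX_le hz; flra.
  by move=> N; have [n Nn hn] := h N; exists n => //; flra.
right; apply: (@hair_of_ge _ _ k) => //; first by apply: (inX144 (r := R0)) => //; apply: inX_le hw; flra.
move=> N; apply: contrapT => hN; apply: h => M; apply: contrapT => hM; apply: hN.
exists (maxn N M); first exact: leq_maxl.
have [//|hh] := leP (re (F (maxn N M) z)) (re (F (maxn N M) w) + 100).
by case: hM; exists (maxn N M); [exact: leq_maxr|flra].
Qed.

(** Together with [Phi_Phi] it identifies the hair of a point on a hair with the tail of that hair.
    The margin 20 covers the 10 lost in [Phi_inX]. *)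
Lemma Phi_shift w (u u0 : R) : inX (R0 + 20) w -> 0 <= u0 -> u0 <= u ->
  exists2 T, 0 <= T & Phi w u = Phi (Phi w u0) T.
Proof.
move=> hw u00 uu; have hw0 : inX R0 w by apply: inX_le hw; flra.
have u_0 : 0 <= u by flra.
have [k hk] := inR0_addr hw0.
have rr : R0 <= R0 + 20 by flra.
apply: (@hair_of_ge _ _ k); [|exact: Phi_inX144|exact: Phi_addr|exact: Phi_addr|].
  by apply: inX_le (Phi_inX rr hw u00); flra.
move=> N; exists N => //; have [h _] := tau_expand N (inX1 (lexx _) hw0) u00 uu.
have : 0 <= 2 ^+ N * (u - u0) by rewrite mulr_ge0 ?exprn_ge0 //; flra.
have := Phi_re N hw0 u00; have := Phi_re N hw0 u_0; rewrite !ler_norml; flra.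
Qed.

Lemma Phi_Phi w (u : R) T : inX (R0 + 20) w -> 0 <= u -> 0 <= T ->
  exists2 S, u <= S & Phi (Phi w u) T = Phi w S.
Proof.
move=> hw u0 T0; have hw0 : inX R0 w by apply: inX_le hw; flra.
have [k hk] := inR0_addr hw0.
have rr : R0 <= R0 + 20 by flra.
have hv : inX R0 (Phi w u) by apply: inX_le (Phi_inX rr hw u0); flra.
have kv := Phi_addr hw0 u0 hk.
have key n : re (F n (Phi w u)) <= re (F n (Phi (Phi w u) T)) + 10.
  by apply: le_trivial => //; exists T.
have [|||N|S S0 e] := @hair_of_ge w (Phi (Phi w u) T) k hw0.
- exact: Phi_inX144.
- by [].
- exact: Phi_addr.
- exists N => //; have := key N; have h := @le_trivial w (Phi w u) hw0.
  have := h (ex_intro2 _ _ u u0 erefl) N; flra.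
exists S => //; apply: (hair_param_le hw0 u0 S0) => N; exists N => //.
by rewrite -e; have := key N; flra.
Qed.

(** A lead of 10 in real part makes the modulus of [f u - a] at least 11 times that of [f v - a]; as
    both images lie in one strip, the excess has to appear in the real part. *)
Lemma propagate (l l' : int) u v : strip l u -> strip l v -> strip l' (f u) -> strip l' (f v) ->
  A0 + 144 <= re (f u) -> A0 + 144 <= re (f v) ->
  re v + 10 <= re u -> re (f v) + 10 <= re (f u).
Proof.
move=> su sv su' sv' hu hv h; have hra := re_a_le a.
have d : `|im (f u - a) - im (f v - a)| < 4.
  have -> : im (f u - a) - im (f v - a) = im (f u) - im (f v) by rewrite !imD !imN; ring.
  exact: lt_trans (strip_dist su' sv') (pi_lt4 _).
have nu := normc_expmapBa a u; have nv := normc_expmapBa a v.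
have h1 : 11 * normc (f v - a) <= normc (f u - a).
  rewrite nu nv; have -> : expR (re u) = expR (re u - re v) * expR (re v) by rewrite -expRD subrK.
  rewrite ler_pM2r ?expR_gt0 //; have := expR_ge1Dx (re u - re v); flra.
move: (f u) (f v) hu hv d h1 {su' sv' nu nv} => U V hu hv d h1.
have h2 := normc_le_reim (U - a); have h3 := normc_re (V - a); have h4 := normc_im (V - a).
have h5 : 100 <= normc (V - a).
  apply: le_trans h3; apply: le_trans (ler_norm _); rewrite !reimE; flra.
have h6 : `|re (U - a)| = re (U) - re a by rewrite ger0_norm !reimE //; flra.
have h7 : re (V) - re a <= normc (V - a).
  by apply: le_trans h3; apply: le_trans (ler_norm _); rewrite !reimE.
have h8 : `|im (U - a)| <= normc (V - a) + 4.
  have := ler_normB (im (U - a) - im (V - a)) (- im (V - a)).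
  rewrite opprK normrN subrK; flra.
rewrite h6 in h2; flra.
Qed.

Lemma propagate_iter k u v n m : addr k u -> addr k v -> inX (A0 + 144) u -> inX (A0 + 144) v ->
  re (F n v) + 10 <= re (F n u) -> (n <= m)%N -> re (F m v) + 10 <= re (F m u).
Proof.
move=> ku kv hu hv h; elim: m => [|m IH]; first by rewrite leqn0 => /eqP e; rewrite e in h.
rewrite leq_eqVlt => /orP[/eqP <- //|]; rewrite ltnS => /IH {}IH.
exact: propagate (ku m) (kv m) (ku m.+1) (kv m.+1) (hu m.+1) (hv m.+1) IH.
Qed.

Lemma path_strip p b c : ccont p b c -> (forall t, b <= t <= c -> exists l, strip l (p t)) ->
  forall (l : int) s t, b <= s <= c -> b <= t <= c -> strip l (p s) -> strip l (p t).
Proof.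
move=> hp hl.
suff H s t : b <= s -> s <= t -> t <= c -> forall l, strip l (p s) <-> strip l (p t).
  by move=> l s t ss tt; have [st|/ltW st] := leP s t; rewrite (H _ _ _ st) //; flra.
move=> bs st tc; apply: (@cousin _ (fun s t : R => forall l, strip l (p s) <-> strip l (p t)) s t) => //.
  by move=> u v w _ _ _ _ h1 h2 l; rewrite h1 h2.
move=> v sv; have [|d d0 hd] := hp v _ (1 / 2) ltac:(flra); first by flra.
exists d => // u w su uw wt vu wv l.
have close (u' : R) : b <= u' <= c -> v - d < u' < v + d -> forall l, strip l (p u') <-> strip l (p v).
  move=> u'c h; have /hd : `|u' - v| < d by rewrite ltr_norml; flra.
  move=> /(_ u'c) hn; have [i hi] := hl u' u'c; have [|i' hi'] := hl v _; first by flra.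
  have e : i = i'.
    apply: (strip_close hi hi'); have := normc_im (p u' - p v); have := @pi_ge2 R.
    by rewrite !reimE; flra.
  by split=> hs; [rewrite (strip_uniq hs hi) e|rewrite (strip_uniq hs hi') -e].
by rewrite !close //; flra.
Qed.

Lemma path_addr p b c r : A0 < r -> ccont p b c -> (forall t, b <= t <= c -> inX r (p t)) ->
  forall k s t, b <= s <= c -> b <= t <= c -> addr k (p s) -> addr k (p t).
Proof.
move=> hr hp hX k s t ss tt hk n.
apply: (path_strip (ccont_iter n hp)) ss tt (hk n) => t' tt'.
have [k' hk'] := inX_addr hr (hX t' tt'); exists (k' n); exact: hk'.
Qed.

(* A limit point of the minimisers of [re (F n (p t))] is the endpoint-most
   point of the path, because a gap of 10 between real parts never closes. *)
Lemma hair_min p b c : b <= c -> ccont p b c -> (forall t, b <= t <= c -> inX R0 (p t)) ->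
  exists2 s, b <= s <= c & forall t, b <= t <= c -> exists2 T, 0 <= T & p t = Phi (p s) T.
Proof.
move=> bc hp hX.
have /choice[x hx] n : exists s, b <= s <= c /\
    forall t, b <= t <= c -> re (F n (p s)) <= re (F n (p t)).
  have [s] := @EVT_min R (fun t => re (F n (p t))) b c bc
    (rcont_within (rcont_re (ccont_iter n hp))).
  by rewrite in_itv /= => ss h; exists s; split => // t tt; apply: h; rewrite in_itv.
have [s ss hs] := cluster_seq (fun n => (hx n).1); exists s => // t tt.
have [k hk] := inR0_addr (hX s ss).
have A1 : A0 < R0 by have := A0_ge0 a; rewrite R0E; flra.
have hk' t' tt' := path_addr A1 hp hX ss tt' hk (t := t').
have i144 t' (tt' : b <= t' <= c) : inX (A0 + 144) (p t').
  by apply: (inX144 (r := R0)) => //; apply: inX_le (hX _ tt'); flra.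
apply: (@hair_of_ge _ _ k) => //; [exact: hX|exact: i144|exact: hk'|].
move=> N; apply: contrapT => hN.
have hgt : re (F N (p t)) + 100 < re (F N (p s)).
  by rewrite ltNge; apply/negP => h; apply: hN; exists N.
have [d d0 hd] := ccont_iter N hp ss (@ltr01 R).
have [n Nn hn] := hs d d0 N; have [xn hxn] := hx n.
have := hd _ xn hn; have := normc_re (F N (p (x n)) - F N (p s)); rewrite !reimE ler_norml => h1 h2.
have h3 : re (F N (p t)) + 10 <= re (F N (p (x n))) by flra.
have := propagate_iter (hk' _ xn) (hk' _ tt) (i144 _ xn) (i144 _ tt) h3 Nn.
have := hxn t tt; flra.
Qed.

End HairMap.

(** * Lifting paths and hairs through iterates *)

Section Lifts.
Variable R : realType.
Local Notation C := R[i].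
Variable a : C.
Implicit Types (z w u v : C) (x y t r S T e b c s : R) (p q g d : R -> R) (k : nat -> int) (n m j M : nat).

Local Notation f := (expmap a).
Local Notation F n z := (iter n (expmap a) z).
Local Notation A0 := (normc a).
Local Notation R0 := (R0 a).
Local Notation inX := (inX a).
Local Notation addr := (addr a).
Local Notation tau := (tau a).
Local Notation Phi := (Phi a).

Lemma rcont_max (g : R -> R) b c : b <= c -> rcont g b c ->
  exists2 s, b <= s <= c & forall t, b <= t <= c -> g t <= g s.
Proof.
move=> bc /rcont_within hg; have [s ss hs] := EVT_max bc hg.
by exists s => [|t tt]; [have := ss; rewrite in_itv|apply: hs; rewrite in_itv].
Qed.

Lemma cexp_expmap z w : f z = f w -> cexp z = cexp w.
Proof. exact: addIr. Qed.

Lemma iter_lift_uniq M (l l' : R -> C) b c s : ccont l b c -> ccont l' b c ->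
  (forall t, b <= t <= c -> F M (l t) = F M (l' t)) ->
  b <= s <= c -> l s = l' s -> forall t, b <= t <= c -> l t = l' t.
Proof.
elim: M l l' => [|M IH] l l' hl hl' e ss ls t tt; first exact: e.
have h := IH (fun t => f (l t)) (fun t => f (l' t)).
apply: (exp_lift_uniq hl hl' _ ss ls) => // t' tt'; apply: cexp_expmap.
apply: h => //.
- exact: ccont_iter a 1 _ _ _ hl.
- exact: ccont_iter a 1 _ _ _ hl'.
- by move=> s' ss'; have := e s' ss'; rewrite !iter_expmapS.
- by rewrite ls.
Qed.

Lemma expmap_inj_near u v : f u = f v -> normc (u - v) < 4 -> u = v.
Proof.
move=> /cexp_expmap/cexp_eq[k ->]; have -> : v + ipi R k - v = ipi R k by ring.
rewrite /ipi normc_imag => h; have -> : k = 0.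
  apply: (@int_small R); rewrite mulr0z mulr0 subr0; have := twopi_ge4 R; flra.
by rewrite mulr0z mulr0 addr0.
Qed.

Lemma iter_locally_inj M z : exists2 r, 0 < r & forall u v, normc (u - z) < r ->
  normc (v - z) < r -> F M u = F M v -> u = v.
Proof.
elim: M => [|M [r r0 hr]]; first by exists 1.
have [d d0 hd] := cont_at_iter a M z (ltr0n R 2).
exists (Num.min r d); first by rewrite lt_min r0.
move=> u v; rewrite !lt_min => /andP[u1 u2] /andP[v1 v2] h.
apply: hr => //; apply: expmap_inj_near => //.
have := ler_normc_tri (F M z) (F M u) (F M v); have := hd _ u2; have := hd _ v2.
rewrite (normcB (F M v)); flra.
Qed.

Lemma iter_path_perturb M (l : R -> C) b c e : ccont l b c -> 0 < e ->
  exists2 d : R, 0 < d & forall h : R -> C, ccont h b c ->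
    (forall t, b <= t <= c -> normc (h t - F M (l t)) < d) ->
    exists l', [/\ ccont l' b c, forall t, b <= t <= c -> F M (l' t) = h t &
      forall t, b <= t <= c -> normc (l' t - l t) < e].
Proof.
move=> hl; elim: M => [|M IH] e0.
  by exists e => // h hh hd; exists h.
have [d d0 hd] := IH e0; set mu := fun t => F M (l t).
have hmu : ccont mu b c by exact: ccont_iter.
have hc := ccont_cexp hmu.
have [m m0 hm] := ccont_lower_bound hc (fun t _ => cexp_neq0 (mu t)).
exists (Num.min (m / 2) (m * d / 20)).
  by rewrite lt_min !divr_gt0 ?mulr_gt0.
move=> h hh hclose.
pose qq t := (h t - f (mu t)) / cexp (mu t).
have hq t : b <= t <= c -> normc (qq t) <= 2^-1 /\ 18 * normc (qq t) < d.
  move=> tt; have := hclose t tt; rewrite lt_min -/(mu t) -[F M.+1 _]/(f (mu t)) => /andP[h1 h2].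
  have mt := hm t tt; rewrite /qq normcM normcV; set n := normc (cexp (mu t)) in mt *.
  have n0 : 0 < n by flra.
  rewrite mulrA ler_pdivrMr ?ltr_pdivrMr //; split; first by flra.
  have := ler_pM2l d0; nra.
have re1q t : b <= t <= c -> 2^-1 <= re (1 + qq t).
  move=> tt; have [h1 _] := hq t tt; have := normc_re (qq t); rewrite reD re1 ler_norml; flra.
have cq : ccont (fun t => 1 + qq t) b c.
  apply: ccontD; first exact: ccont_cst.
  apply: ccontM; last by apply: ccontV => // t _; exact: cexp_neq0.
  apply: ccontB => //; exact: (ccont_iter a 1 hmu).
(* Adding [Log (1 + qq t)] multiplies [cexp (mu t)] by [1 + qq t], which turns [f (mu t)] into
   exactly [h t]. *)
pose mu' t := mu t + Log (1 + qq t).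
have cmu' : ccont mu' b c.
  apply: ccontD => //; apply: (ccont_comp cq) => t tt; apply: cont_at_Log.
  have := re1q t tt; flra.
have [|l' [cl' el' hl']] := hd mu' cmu'.
  move=> t tt; have -> : mu' t - F M (l t) = Log (1 + qq t) - Log 1.
    by rewrite Log1 subr0 /mu' /mu; ring.
  have h2 : 0 < 2^-1 :> R by flra.
  have h1 := Log_lip h2 (re1q t tt) (_ : 2^-1 <= re 1).
  apply: le_lt_trans (h1 _) _; first by rewrite re1; flra.
  have -> : 1 + qq t - 1 = qq t by ring.
  by have [_] := hq t tt; flra.
exists l'; split=> // t tt.
rewrite [LHS]/= el' // /mu' /expmap cexpD cexp_Log; last by have := re1q t tt; flra.
rewrite /qq /expmap; field; exact: cexp_neq0.
Qed.

Lemma iter_open M z e : 0 < e -> exists2 d, 0 < d &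
  forall Y, normc (Y - F M z) < d -> exists2 w, normc (w - z) < e & F M w = Y.
Proof.
move=> e0; have [d d0 hd] := iter_path_perturb M (@ccont_cst R z 0 0) e0.
exists d => // Y hY; have [l [_ h1 h2]] := hd (fun=> Y) (@ccont_cst R Y 0 0) (fun _ _ => hY).
have h0 : (0 : R) <= (0 : R) <= (0 : R) by rewrite lexx.
by exists (l 0); [exact: h2|exact: h1].
Qed.

(** Although [gam] may go back and forth, its points with equal [g] agree: [pp] is lifted one
    application of [f] at a time, starting at [gam t0], and uniqueness of lifts identifies [gam]
    with the lift reparametrised by [g]. *)
Lemma iter_factor M (gam pp : R -> C) (g : R -> R) b c t0 t1 G :
  ccont gam b c -> rcont g b c -> ccont pp 0 G ->
  (forall t, b <= t <= c -> 0 <= g t <= G) -> b <= t0 <= c -> g t0 = 0 ->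
  b <= t1 <= c -> g t1 = G ->
  (forall t, b <= t <= c -> F M (gam t) = pp (g t)) ->
  exists l, [/\ ccont l 0 G, forall T, 0 <= T <= G -> F M (l T) = pp T &
    forall t, b <= t <= c -> gam t = l (g t)].
Proof.
move=> hgam hg hp hG tt0 gt0 tt1 gt1; elim: M gam hgam => [|M IH] gam hgam e.
  by exists pp; split.
have [|t tt|l1 [cl1 el1 hl1]] := IH (fun t => f (gam t)).
- exact: (ccont_iter a 1 hgam).
- by have := e t tt; rewrite iter_expmapS.
have G0 : 0 <= G by have := hG _ tt1; flra.
have onto T : 0 <= T <= G -> exists2 t, b <= t <= c & g t = T.
  move=> TG; have [|t /andP[tt _] e'] := @rIVT R g b c t0 t1 T hg tt0 tt1.
    by rewrite gt0 gt1.
  by exists t.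
have cl1a : ccont (fun T => l1 T - a) 0 G by apply: ccontB => //; exact: ccont_cst.
(* [g] is onto [[0, G]], so [l1] omits the value [a] because [f] does. *)
have n0 T : 0 <= T <= G -> l1 T - a != 0.
  by move=> TG; have [t tt <-] := onto T TG; rewrite -hl1 // expmapBa; exact: cexp_neq0.
have [|l [cl l0 el]] := exp_lift G0 cl1a n0 (w0 := gam t0).
  by rewrite -{1}gt0 -hl1 // expmapBa.
have fl T : 0 <= T <= G -> f (l T) = l1 T by move=> TG; rewrite /expmap el // subrK.
exists l; split=> [//|T TG|].
  by rewrite iter_expmapS fl // el1.
apply: (exp_lift_uniq hgam (ccont_reparam cl hg hG) _ tt0); last by rewrite gt0 l0.
by move=> t tt; rewrite -(expmapBa a) (hl1 t tt) el //; exact: hG.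
Qed.

Lemma hair_coord w (pp : R -> C) (g : R -> R) b c : inX R0 w -> ccont pp b c ->
  (forall t, b <= t <= c -> 0 <= g t /\ pp t = Phi w (g t)) -> rcont g b c.
Proof.
move=> hw hp hg t tt e e0; have [g0 gE] := hg t tt.
have [d d0 hd] := Phi_inv_cont hw g0 e0; have [d' d'0 hd'] := hp t tt d d0.
exists d' => // t' tt' h; have [g0' gE'] := hg t' tt'; apply: hd => //.
by rewrite -gE -gE'; exact: hd'.
Qed.

(* A path that some iterate maps into [inX R0] runs back and forth along a single lifted hair. *)
Lemma hair_lift M (gam : R -> C) b c : b <= c -> ccont gam b c ->
  (forall t, b <= t <= c -> inX R0 (F M (gam t))) ->
  exists s t1 (g : R -> R) (l : R -> C), [/\ b <= s <= c /\ b <= t1 <= c,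
    [/\ g s = 0, rcont g b c & forall t, b <= t <= c -> 0 <= g t <= g t1],
    ccont l 0 (g t1),
    forall T, 0 <= T <= g t1 -> F M (l T) = Phi (F M (gam s)) T &
    forall t, b <= t <= c -> gam t = l (g t)].
Proof.
move=> bc hgam hX; have hc := ccont_iter a M hgam.
have [s ss hs] := hair_min bc hc hX.
have /choice[g hg] t : exists T, b <= t <= c -> 0 <= T /\ F M (gam t) = Phi (F M (gam s)) T.
  by have [/hs[T T0 e]|h] := pselect (b <= t <= c); [exists T|exists 0].
have rg := hair_coord (hX s ss) hc hg.
have gs : g s = 0.
  have [g0 e] := hg s ss; apply/esym/(@Phi_inj _ a (F M (gam s))) => //; first exact: hX.
  by rewrite Phi0; [exact: e|exact: hX].
have [t1 tt1 hmax] := rcont_max bc rg.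
have hG t : b <= t <= c -> 0 <= g t <= g t1.
  by move=> tt; have [-> _] := hg t tt; exact: hmax.
have cp : ccont (Phi (F M (gam s))) 0 (g t1) by apply: Phi_ccont => //; exact: hX.
have eg t : b <= t <= c -> F M (gam t) = Phi (F M (gam s)) (g t).
  by move=> tt; have [_] := hg t tt.
have [l [cl el hl]] := iter_factor hgam rg cp hG ss gs tt1 erefl eg.
by exists s, t1, g, l.
Qed.

(** Equal images have equal parameters on the straightened hair, and [gam] is a function of that
    parameter. *)
Lemma path_iter_inj M (gam : R -> C) b c : ccont gam b c ->
  (forall t, b <= t <= c -> inX R0 (F M (gam t))) ->
  forall s t, b <= s <= c -> b <= t <= c -> F M (gam s) = F M (gam t) -> gam s = gam t.
Proof.
move=> hgam hX s t ss tt e.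
have bc : b <= c by flra.
have [s0 [t1 [g [l [[ss0 tt1] [gs rg hG] cl el hl]]]]] := hair_lift bc hgam hX.
rewrite !hl //; congr l; apply: (@Phi_inj _ a (F M (gam s0))).
- exact: hX.
- by have := hG s ss; flra.
- by have := hG t tt; flra.
by rewrite -!el ?hG // -!hl.
Qed.

(** No iterate may lie strictly inside a hair issuing from a point of [inX r]; a larger [r] makes
    the condition weaker. *)
Definition tip r (b : C) := forall n z T, inX r z -> 0 <= T -> F n b = Phi z T -> T = 0.

Lemma tip_iter r m (b : C) : tip r b -> tip r (F m b).
Proof. by move=> hb n z T hz T0; rewrite -iter_expmapD; exact: hb. Qed.

(** The parameter on the hair of [F M w] is [tau M w] of a continuous parameter. The path this
    defines on the hair of [w] has the same image under [F M] as [zeta] and meets it at [t0], so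
    uniqueness of lifts applies. *)
Lemma hair_stay_base M (zeta : R -> C) w t0 T0 b c : inX R0 w -> ccont zeta b c -> b <= t0 <= c ->
  0 <= T0 -> zeta t0 = Phi w T0 ->
  (forall t, b <= t <= c -> exists2 T, 0 <= T & F M (zeta t) = Phi (F M w) T) ->
  forall t, b <= t <= c -> exists2 T, 0 <= T & zeta t = Phi w T.
Proof.
move=> hw hz tt0 T00 e0 h.
have i1 : inX 1 w by apply: inX_le hw; have := A0_ge0 a; rewrite R0E; flra.
have hMw := inX_iter M hw.
have /choice[g' hg'] t : exists T, b <= t <= c -> 0 <= T /\ F M (zeta t) = Phi (F M w) (tau M w T).
  have [/h[T Tp e]|hh] := pselect (b <= t <= c); last by exists 0.
  by have [S S0 eS] := tau_surj M i1 Tp; exists S => _; rewrite eS.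
have rg : rcont (fun t => tau M w (g' t)) b c.
  apply: (hair_coord hMw (ccont_iter a M hz)) => t /hg'[T1 e]; split=> //; exact: tau_ge0.
have rg' : rcont g' b c.
  move=> t tt e ep; have [d d0 hd] := rg t tt e ep; exists d => // t' tt' ht.
  apply: le_lt_trans (hd t' tt' ht); have [g1 _] := hg' t tt; have [g2 _] := hg' t' tt'.
  have p1 : 1 <= 2 ^+ M :> R by rewrite exprn_ege1 //; flra.
  have [hh|/ltW hh] := leP (g' t) (g' t').
    have [h1 _] := tau_expand M i1 g1 hh; rewrite ger0_norm ?subr_ge0 // ger0_norm; nra.
  have [h1 _] := tau_expand M i1 g2 hh; rewrite ler0_norm ?subr_le0 // ler0_norm; nra.
have cb : ccont (fun t => Phi w (g' t)) b c.
  have [B B0 hB] := rcont_bounded rg'.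
  apply: (ccont_reparam (a := 0) (b := B) _ rg'); first exact: Phi_ccont.
  by move=> t tt; have [-> _] := hg' t tt; exact: hB.
have ez := iter_lift_uniq (M := M) hz cb.
move=> t tt; have [g0 _] := hg' t tt; exists (g' t) => //; apply: (ez t0) => //.
  by move=> t' tt'; have [g1 e] := hg' t' tt'; rewrite Phi_iter.
rewrite e0; congr Phi; have [g1 e] := hg' t0 tt0.
have : tau M w T0 = tau M w (g' t0).
  apply: (@Phi_inj _ a (F M w)) => //; try exact: tau_ge0.
  by rewrite -e e0 Phi_iter.
move=> et; apply/eqP; rewrite eq_le; apply/andP; split; rewrite leNgt; apply/negP => /[dup] hlt /ltW hle.
  have [hh _] := tau_expand M i1 g1 hle; have : 0 < 2 ^+ M * (T0 - g' t0) by rewrite mulr_gt0 ?exprn_gt0 // subr_gt0.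
  flra.
have [hh _] := tau_expand M i1 T00 hle; have : 0 < 2 ^+ M * (g' t0 - T0) by rewrite mulr_gt0 ?exprn_gt0 // subr_gt0.
flra.
Qed.

Lemma R0_le20 : R0 <= R0 + 20. Proof. by flra. Qed.

Lemma inX_R0_le r z : 0 <= r -> inX (R0 + r) z -> inX R0 z.
Proof. by move=> r0; apply: inX_le; flra. Qed.

(** The endpoint-most point of the image path is comparable with [F M w], and it cannot lie strictly
    before it because [w] is a tip; so the image stays on the hair of [F M w]. *)
Lemma hair_stay_tip M r (zeta : R -> C) w t0 T0 b c : inX (R0 + 20) w -> R0 <= r -> tip r w ->
  ccont zeta b c -> b <= t0 <= c -> 0 <= T0 -> zeta t0 = Phi w T0 ->
  (forall t, b <= t <= c -> inX r (F M (zeta t))) ->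
  forall t, b <= t <= c -> exists2 T, 0 <= T & zeta t = Phi w T.
Proof.
move=> hw hr tw hz tt0 T00 e0 hX; have hw0 : inX R0 w by apply: inX_R0_le hw.
have bc : b <= c by flra.
have i1 : inX 1 w by apply: inX_le hw; have := A0_ge0 a; rewrite R0E; flra.
apply: (hair_stay_base (M := M) hw0 hz tt0 T00 e0).
have hX0 t (tt : b <= t <= c) : inX R0 (F M (zeta t)) by apply: inX_le (hX t tt).
have [s ss hs] := hair_min bc (ccont_iter a M hz) hX0.
have [k hk] := inR0_addr hw0.
have kz : addr (fun n => k (n + M)%N) (F M (zeta t0)).
  by apply: addr_iter; rewrite e0; exact: Phi_addr.
have kw : addr (fun n => k (n + M)%N) (F M w) by exact: addr_iter.
have A1 : A0 < R0 by have := A0_ge0 a; rewrite R0E; flra.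
have ks := path_addr A1 (ccont_iter a M hz) hX0 tt0 ss kz.
have hMw := inX_iter M hw; have hMw0 := inX_iter M hw0.
have [[T T_0 eT]|[T T_0 eT]] := hair_cmp hMw0 (hX0 s ss) kw ks.
  move=> t tt; have [S S0 eS] := hs t tt.
  by have [S' hS' e'] := Phi_Phi hMw T_0 S0; exists S'; [flra|rewrite eS eT e'].
have Te := tw M _ T (hX s ss) T_0 eT; move: eT; rewrite Te Phi0 => [eT|]; last exact: hX0.
by move=> t tt; rewrite eT; exact: hs.
Qed.

(** Here the hair of [z] may extend backwards beyond [z], but only through [z] itself. If the image
    path went back beyond [F M z], cutting it off at the parameter [T1] of [F M z] would give a path
    that does stay on the hair of [z]. This shows [l T1 = z], and the intermediate value theorem for
    [g] puts [z] on the path. *)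
Lemma hair_stay_avoid M (zeta : R -> C) z t0 T0 b c : inX (R0 + 20) z ->
  ccont zeta b c -> b <= t0 <= c -> 0 <= T0 -> zeta t0 = Phi z T0 ->
  (forall t, b <= t <= c -> inX (R0 + 20) (F M (zeta t))) ->
  (forall t, b <= t <= c -> zeta t != z) ->
  forall t, b <= t <= c -> exists2 T, 0 <= T & zeta t = Phi z T.
Proof.
move=> hz hc tt0 T00 e0 hX hne; have hz0 : inX R0 z by apply: inX_R0_le hz.
have bc : b <= c by flra.
have hX0 t (tt : b <= t <= c) : inX R0 (F M (zeta t)) by apply: inX_R0_le (hX t tt).
have [s [t1 [g [l [[ss tt1] [gs rg hG] cl el hl]]]]] := hair_lift bc hc hX0.
have hMz := inX_iter M hz; have hMz0 := inX_iter M hz0.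
have i1 : inX 1 z by apply: inX_le hz; have := A0_ge0 a; rewrite R0E; flra.
have [k hk] := inR0_addr hz0.
have kw : addr (fun n => k (n + M)%N) (F M z) by exact: addr_iter.
have kz : addr (fun n => k (n + M)%N) (F M (zeta t0)).
  by apply: addr_iter; rewrite e0; exact: Phi_addr.
have A1 : A0 < R0 by have := A0_ge0 a; rewrite R0E; flra.
have ks := path_addr A1 (ccont_iter a M hc) hX0 tt0 ss kz.
have eF t : b <= t <= c -> F M (zeta t) = Phi (F M (zeta s)) (g t).
  by move=> tt; rewrite hl // el // hG.
have [[T T_0 eT]|[T1 T1_0 eT]] := hair_cmp hMz0 (hX0 s ss) kw ks.
  apply: (hair_stay_base (M := M) hz0 hc tt0 T00 e0) => t tt.
  have /andP[g0 _] := hG t tt.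
  by have [S' hS' e'] := Phi_Phi hMz T_0 g0; exists S'; [flra|rewrite eF // eT e'].
exfalso.
have gt0 : T1 <= g t0.
  apply: (hair_param_le (hX0 s ss) T1_0); first by have := hG t0 tt0; flra.
  move=> N; exists N => //; rewrite -eT -eF // e0 (Phi_iter M hz0 T00).
  have hx : exists2 T, 0 <= T & Phi (F M z) (tau M z T0) = Phi (F M z) T.
    by exists (tau M z T0) => //; exact: tau_ge0.
  by have := le_trivial hMz0 hx N; flra.
pose zt t := l (Num.max (g t) T1).
have T1G t : b <= t <= c -> 0 <= Num.max (g t) T1 <= g t1.
  by move=> tt; rewrite le_max ge_max T1_0 orbT /=; have := hG t tt; have := hG t0 tt0; flra.
have rm : rcont (fun t => Num.max (g t) T1) b c.
  move=> t tt e e00; have [d d0 hd] := rg t tt e e00; exists d => // t' tt' /(hd _ tt').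
  rewrite !ltr_norml !maxEle; case: ifP => /negP h1; case: ifP => /negP h2; move: h1 h2; rewrite ?negbK; flra.
have czt : ccont zt b c by apply: (ccont_reparam cl rm T1G).
have ezt t : b <= t <= c -> exists2 T, 0 <= T & zt t = Phi z T.
  move=> tt; apply: (hair_stay_base (M := M) (t0 := t0) (T0 := T0) hz0 czt tt0 T00) tt.
    by rewrite /zt (max_idPl gt0) -hl.
  move=> t' tt'; rewrite /zt el ?T1G // eT.
  have m1 : T1 <= Num.max (g t') T1 by rewrite le_max lexx orbT.
  have [S S0 ->] := Phi_shift (hX s ss) T1_0 m1; by exists S.
have [S S0] := ezt s ss; rewrite /zt gs (max_idPr T1_0) => eS.
have eMz : F M (Phi z S) = F M z.
  by rewrite -eS el ?eT // T1_0 /=; have := hG t0 tt0; flra.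
have S00 : tau M z S = 0.
  have hS := tau_ge0 M i1 S0.
  by apply: (@Phi_inj _ a (F M z)) => //; rewrite -Phi_iter // eMz Phi0.
have lz : l T1 = z.
  have : S <= 0.
    by have := tau_ge M i1 S0; rewrite S00 => h; rewrite -(@pmulr_rle0 _ (2 ^+ M)) ?exprn_gt0.
  by move=> S_0; have S1 : S = 0 by [flra]; rewrite eS S1 Phi0 //; exact: hz0.
have [|t /andP[tt _] gt] := @rIVT R g b c s t0 T1 rg ss tt0; first by rewrite gs T1_0.
by have := hne t tt; rewrite hl // gt lz eqxx.
Qed.

End Lifts.

(** * Tips of hairs *)

Section Tips.
Variable R : realType.
Local Notation C := R[i].
Variable a : C.
Implicit Types (z w u v : C) (x y t r S T e b c s : R) (k : nat -> int) (n m j M : nat).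

Local Notation f := (expmap a).
Local Notation F n z := (iter n (expmap a) z).
Local Notation A0 := (normc a).
Local Notation R0 := (R0 a).
Local Notation inX := (inX a).
Local Notation addr := (addr a).
Local Notation tau := (tau a).
Local Notation Phi := (Phi a).
Local Notation tip := (tip a).

Lemma R0_ge : 600 <= R0.
Proof. by have := A0_ge0 a; rewrite R0E; flra. Qed.
Lemma R0_gtA0 : A0 < R0.
Proof. by have := A0_ge0 a; rewrite R0E; flra. Qed.
Lemma inR0_1 z : inX R0 z -> inX 1 z.
Proof. exact: inX1 (lexx _). Qed.
Lemma inR0_144 z : inX R0 z -> inX (A0 + 144) z.
Proof. by apply: inX_le; have := A0_ge0 a; rewrite R0E; flra. Qed.

Lemma expR_norm n z : expR (re (F n z)) = normc (F n.+1 z - a).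
Proof. by rewrite [F n.+1 z]/= normc_expmapBa. Qed.

Lemma expR_lower y : 512 <= y -> 64 * y <= expR y.
Proof.
move=> h; have -> : expR y = expR (y / 2) * expR (y / 2) by rewrite -expRD; congr expR; field.
have := expR_ge1Dx (y / 2); nra.
Qed.

(** The modulus of [F n.+1 z - a] is [expR (re (F n z))], so a large modulus means a large real part
    one step earlier. *)
Lemma escapingP z : escaping f z <-> forall r, exists N, forall n, (N <= n)%N -> r <= re (F n z).
Proof.
split=> [h r|h].
  move/cvgryPge : h => /(_ (expR r + A0)) [N _ hN]; exists N => n Nn.
  have := hN n.+1 (leqW Nn); have := ler_normc_dist (F n.+1 z) a.
  have := @ler_normcD R (F n.+1 z - a) a; rewrite subrK -expR_norm => h1 _ /= h2.
  by rewrite -(@ler_expR R); move: h1 h2 => /=; flra.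
apply/cvgryPge => A; have [N hN] := h A; exists N => // n /= Nn.
apply: le_trans (hN n Nn) (le_trans (ler_norm _) (normc_re _)).
Qed.

Lemma escaping_iter n z : escaping f (F n z) <-> escaping f z.
Proof.
split=> /escapingP h; apply/escapingP => r; have [N hN] := h r.
  exists (N + n)%N => m hm; have := hN (m - n)%N; rewrite -iter_expmapD subnK; last by lia.
  by apply; lia.
by exists N => m hm; rewrite -iter_expmapD; apply: hN; lia.
Qed.

Lemma escaping_inX r z : escaping f z -> exists n, inX r (F n z).
Proof.
move=> /escapingP/(_ r)[N hN]; exists N => n; rewrite -iter_expmapD; apply: hN; lia.
Qed.

Lemma escaping_Phi w T : inX R0 w -> escaping f w -> 0 <= T -> escaping f (Phi w T).
Proof.
move=> hw /escapingP h T0; apply/escapingP => r; have [N hN] := h (r + 10); exists N => n /hN.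
have := Phi_re n hw T0; have := tau_ge0 n (inR0_1 hw) T0; rewrite ler_norml; flra.
Qed.

Lemma path_escape M (gam : R -> C) b c : b <= c -> ccont gam b c ->
  (forall t, b <= t <= c -> inX R0 (F M (gam t))) ->
  (forall t, b <= t <= c -> escaping f (gam t)) ->
  forall r, exists N, forall n, (N <= n)%N -> forall t, b <= t <= c -> r <= re (F n (gam t)).
Proof.
move=> bc hg hX hI r.
have [s ss hs] := hair_min bc (ccont_iter a M hg) hX.
have /escapingP/(_ (r + 10))[N hN] := hI s ss.
exists (N + M)%N => n hn t tt; have := le_trivial (hX s ss) (hs t tt) (n - M)%N.
rewrite -!iter_expmapD subnK; last by lia.
have := hN n; rewrite (_ : (N <= n)%N) => [/(_ isT)|]; [flra|lia].
Qed.

Lemma tip_of_iter r n (b : C) : R0 <= r -> tip r (F n b) -> tip r b.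
Proof.
move=> hr hb m z T hz T0 e; have hz0 : inX R0 z by apply: inX_le hz.
have h : F m (F n b) = Phi (F n z) (tau n z T).
  by rewrite -Phi_iter // -e -!iter_expmapD addnC.
have := hb m _ _ (inX_iter n hz) (tau_ge0 n (inR0_1 hz0) T0) h.
have := tau_ge n (inR0_1 hz0) T0; have : 0 < 2 ^+ n :> R by rewrite exprn_gt0.
move=> p0 h1 h2; rewrite h2 in h1; have : T <= 0 by rewrite -(pmulr_rle0 T p0).
flra.
Qed.

Lemma ln_near (E x : R) : 0 < E -> E / 4 <= x -> x <= 2 * E -> `|ln E - ln x| <= 2.
Proof.
move=> E0 h1 h2; have x0 : 0 < x by flra.
have l1 : ln 2 <= 1 :> R by have := @le_ln1Dx R 1; rewrite -[1 + 1]/(2%:R); apply; flra.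
have l4 : ln 4 = ln 2 + ln 2 :> R by rewrite -lnM ?posrE //; congr ln; ring.
have g1 : ln (E / 4) <= ln x by rewrite ler_ln ?posrE // divr_gt0.
have g2 : ln x <= ln (2 * E) by rewrite ler_ln ?posrE // mulr_gt0.
rewrite ln_div ?posrE // in g1; rewrite lnM ?posrE // in g2.
rewrite ler_norml; flra.
Qed.

Lemma diag_bounds (E : R) : 8 * A0 <= E ->
  E / 4 <= normc ((E / 2) +i* (E / 2) - a) <= 2 * E.
Proof.
move=> hE; have A1 := A0_ge0 a; have ra := re_a_le a; have h := normc_re a; have h' := normc_im a.
set q := _ - a; have rq : re q = E / 2 - re a by rewrite reD reN.
have iq : im q = E / 2 - im a by rewrite imD imN.
apply/andP; split.
  by apply: le_trans (le_trans (ler_norm _) (normc_re q)); rewrite rq; clear -ra hE A1; flra.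
apply: le_trans (normc_le_reim q) _; rewrite rq iq.
have := ler_normB (E / 2) (im a); have := ler_normB (E / 2) (re a).
have -> : `|E / 2| = E / 2 by rewrite ger0_norm //; clear -hE A1; flra.
clear -h h' hE A1; flra.
Qed.

(* The orbit of [b] is made to follow the diagonal Im = Re, whereas beyond the initial
   point of a hair the real part dominates the imaginary part. *)
Lemma guided_tip (l : int) x (K : nat) : R0 + 200 <= x -> 64 * (K%:R + 2) <= expR x ->
  exists (b : C) k, [/\ addr k b, k 0%N = l, `|re b - x| <= 30, forall j, (j.+1 + K <= `|k j.+1|)%N &
    tip R0 b].
Proof.
move=> hx hK; have R2 := R0_ge; have A1 := A0_ge0 a; have hra := re_a_le a; have hra' := re_a_ge a.
have p2 := @pi_ge2 R; have p4 := pi_lt4 R.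
(* From time 1 on, the real and imaginary parts of this pseudo-orbit coincide; the initial height
   lies on the axis of the strip [l]. *)
pose v := fix v n : C := if n is m.+1 then
  (expR (re (v m)) / 2) +i* (expR (re (v m)) / 2) else x +i* (twopi R * l%:~R).
have vS n : v n.+1 = (expR (re (v n)) / 2) +i* (expR (re (v n)) / 2) by [].
have big n : R0 + 200 <= re (v n) /\ re (v n) + 8 <= re (v n.+1).
  elim: n => [|n [IH1 IH2]].
    have e0 : re (v 0%N) = x by []. have e1 : re (v 1%N) = expR x / 2 by [].
    by rewrite e1 e0; split => //; have := @expR_lower x; flra.
  have h : R0 + 200 <= re (v n.+1) by flra.
  split => //; have -> : re (v n.+2) = expR (re (v n.+1)) / 2 by [].
  have := @expR_lower (re (v n.+1)); flra.
have /choice[k hk] n : exists m : int, `|im (v n) - twopi R * m%:~R| <= pi /\ (n = 0%N -> m = l).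
  case: n => [|n]; first by exists l; rewrite /= subrr normr0; split => //; flra.
  by have [m hm] := near_2pin (im (v n.+1)); exists m.
have [|n|n|b hb] := @shadowing _ a v k 10; first by flra.
- by have [] := big n; rewrite R0E in R2 *; flra.
- have [h1 h2] := big n; have [h3 _] := hk n; have := @expR_lower (re (v n)).
  set E := expR (re (v n)) => h4; have E1 : 64 * (R0 + 200) <= E by clear -h1 h4 R2; flra.
  have E1' : 8 * A0 <= E by rewrite R0E in E1; clear -E1 A1; flra.
  have /andP[q1 q2] := diag_bounds E1'; rewrite -vS in q1 q2; set q := v n.+1 - a in q1 q2 *.
  have E0 : 0 < E by rewrite expR_gt0.
  have := ln_near E0 q1 q2; rewrite expRK => hl.
  apply: le_trans (normc_le_reim _) _.
  have -> : re (v n - (Log q + ipi R (k n))) = re (v n) - ln (normc q) by rewrite !reD !reN !reD re_Log addr0.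
  have -> : im (v n - (Log q + ipi R (k n))) = (im (v n) - twopi R * (k n)%:~R) - im (Log q).
    by rewrite !imD !imN !imD [im (ipi _ _)]/=; ring.
  have := im_Log q; have := ler_normB (im (v n) - twopi R * (k n)%:~R) (im (Log q)).
  clear -hl h3 p4; flra.
have bv n : `|re (F n b) - re (v n)| <= 20 /\ `|im (F n b) - im (v n)| <= 20.
  have [h _] := hb n; rewrite -!reN -!imN -!reD -!imD.
  have := normc_re (F n b - v n); have := normc_im (F n b - v n); flra.
have kb : addr k b by move=> n; have [] := hb n.
exists b, k; split=> //.
- by have [_ ->] := hk 0%N.
- by have [] := bv 0%N; rewrite /=; flra.
- move=> j; have h : 32 * (K%:R + 2) + 8 * j%:R <= im (v j.+1).
    elim: j => [|j IH]; first by rewrite /= mulr0; flra.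
    have [_] := big j.+1; have -> : re (v j.+2) = im (v j.+2) by [].
    have -> : re (v j.+1) = im (v j.+1) by []. rewrite -natr1; flra.
  have [h1 _] := hk j.+1; have t8 := twopi_lt8 R; have t4 := twopi_ge4 R.
  suff : (j.+1 + K)%:Z <= k j.+1 by clear; move: (k j.+1) => kj; lia.
  rewrite leNgt; apply/negP => hlt.
  have K0 : 0 <= K%:R :> R by []. have j0 : 0 <= j%:R :> R by [].
  have h2 : (k j.+1)%:~R <= (j.+1 + K)%:R :> R.
    by rewrite -[(j.+1 + K)%:R]/((j.+1 + K)%:Z%:~R) ler_int ltW.
  rewrite natrD -natr1 in h2; move: h1; rewrite ler_norml => /andP[_ h1].
  have h3 : twopi R * (k j.+1)%:~R <= 8 * (j%:R + 1 + K%:R).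
    apply: le_trans (_ : twopi R * (j%:R + 1 + K%:R) <= _); first by rewrite ler_pM2l //; clear -t4; flra.
    rewrite ler_wpM2r ?(ltW t8) //; clear -j0 K0; flra.
  clear -h h1 h3 p4 K0; flra.
(* Let [W] and [V] be the points reached from [Phi z T] and [z] at level [N.+1]. The height of [W]
   is within 4 of that of [V], hence at most [expR (re (F N z)) + normc a + 4], while its modulus is
   at least 11 times this exponential, up to [normc a]. Near the diagonal the modulus is at most
   about twice the height. *)
move=> m z T hz T0 e; apply/eqP; rewrite eq_le T0 andbT leNgt; apply/negP => Tp.
have i1 := inR0_1 hz; have [N hN] := tau_large 20 i1 Tp.
have hN' := hN N (leqnn N).
have [kz hkz] := inR0_addr hz.
have eF n : F (n + m) b = F n (Phi z T) by rewrite iter_expmapD e.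
have d1 := addr_imdist N.+1 (Phi_addr hz T0 hkz) hkz.
have d2 : re (F N z) + 10 <= re (F N (Phi z T)).
  by have := Phi_re N hz T0; rewrite ler_norml; flra.
have e1 : im (F N.+1 z) <= expR (re (F N z)) + A0.
  rewrite expR_norm; have := normc_im (F N.+1 z - a); have := normc_im a.
  by rewrite imD imN !ler_norml; flra.
have e2 : expR (re (F N (Phi z T))) <= normc (F N.+1 (Phi z T)) + A0.
  by rewrite expR_norm; exact: ler_normcB.
have e3 : 11 * expR (re (F N z)) <= expR (re (F N (Phi z T))).
  have -> : expR (re (F N (Phi z T))) = expR (re (F N (Phi z T)) - re (F N z)) * expR (re (F N z)).
    by rewrite -expRD subrK.
  rewrite ler_pM2r ?expR_gt0 //; have := expR_ge1Dx (re (F N (Phi z T)) - re (F N z)); flra.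
have e4 := expR_ge1Dx (re (F N z)); have e5 := hz N.
have [f1 f2] := bv (N.+1 + m)%N; have f3 : re (v (N.+1 + m)%N) = im (v (N.+1 + m)%N) by rewrite addSn.
rewrite eF in f1 f2; have f4 := normc_le_reim (F N.+1 (Phi z T)).
have [f5 _] := big (N.+1 + m)%N.
move: d1 e1 e2 f1 f2 f4; set W := F N.+1 (Phi z T); set V := F N.+1 z.
rewrite !ler_norml ltr_norml R0E in e5 f5 * => d1 e1 e2 f1 f2.
have w1 : 0 <= re W by clear -f1 f5 A1; flra.
have w2 : 0 <= im W by clear -f2 f3 f5 A1; flra.
rewrite (ger0_norm w1) (ger0_norm w2); clear -d1 e1 e2 e3 e4 e5 f1 f2 f3 A1; flra.
Qed.

(* Strip indices beyond [K0] force real parts beyond [R0 + 100] one step earlier. *)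
Definition K0 : nat := (Num.truncn (expR (R0 + 100) + A0 + 10)).+1.

Lemma K0_gt : expR (R0 + 100) + A0 + 10 < K0%:R.
Proof. exact: truncnS_gt. Qed.

(** A condition on the itinerary alone, hence shared by all points of a hair and preserved under
    limits, yet strong enough to force [inX (R0 + 100)] and escape. The entry [k 0] is left free. *)
Definition fast w := exists k, addr k w /\ forall n, (n.+1 + K0 <= `|k n.+1|)%N.

(** The height of [F n.+1 w] has absolute value about [twopi R * K] or more, and it is at most
    [expR (re (F n w)) + normc a]. *)
Lemma fast_expR k w n K : addr k w -> (K <= `|k n.+1|)%N -> K%:R - A0 - 2 <= expR (re (F n w)).
Proof.
move=> kw hk; have := kw n.+1; rewrite /strip expR_norm => hs.
have h1 : K%:R <= `|(k n.+1)%:~R| :> R.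
  by rewrite -intr_norm -[K%:R]/(K%:Z%:~R) ler_int; lia.
have h2 := normc_im (F n.+1 w - a); have h3 := normc_im a; rewrite imD imN in h2.
have t4 := twopi_ge4 R; have p4 := pi_lt4 R.
have h4 : `|twopi R * (k n.+1)%:~R| = twopi R * `|(k n.+1)%:~R|.
  by rewrite normrM ger0_norm //; flra.
have h5 := ler_normB (im (F n.+1 w)) (im (F n.+1 w) - twopi R * (k n.+1)%:~R).
have h6 := ler_normD (im (F n.+1 w) - im a) (im a).
rewrite subrK in h6; rewrite opprB addrC subrK h4 in h5.
have K_0 : 0 <= K%:R :> R by []. nra.
Qed.

Lemma addr_fast_inX k w : addr k w -> (forall n, (K0 <= `|k n.+1|)%N) -> inX (R0 + 100) w.
Proof.
move=> kw hk n; have := fast_expR kw (hk n); have := K0_gt => h1 h2.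
by rewrite -(@ler_expR R); flra.
Qed.

Lemma fast_inX w : fast w -> inX (R0 + 100) w.
Proof. by move=> [k [kw hk]]; apply: (addr_fast_inX kw) => n; have := hk n; lia. Qed.

Lemma fast_inR0 w : fast w -> inX R0 w.
Proof. by move/fast_inX; apply: inX_le; flra. Qed.

Lemma fast_growth w n : fast w -> n%:R <= expR (re (F n w)).
Proof.
move=> [k [kw hk]]; have := fast_expR kw (hk n); have := K0_gt; have := expR_gt0 (R0 + 100).
rewrite addSn -addnS natrD -natr1; flra.
Qed.

Lemma fast_escaping w : fast w -> escaping f w.
Proof.
move=> hw; apply/escapingP => r; exists (Num.truncn (expR r)).+1 => n hn.
rewrite -(@ler_expR R); apply: le_trans (fast_growth n hw).
apply: le_trans (ltW (truncnS_gt _)) _; by rewrite ler_nat.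
Qed.

Lemma fast_Phi w T : fast w -> 0 <= T -> fast (Phi w T).
Proof.
by move=> /[dup] /fast_inR0 hw [k [kw hk]] T0; exists k; split => //; exact: Phi_addr.
Qed.

Lemma inX_closed r w : (forall e, 0 < e -> exists2 u, inX r u & normc (u - w) < e) -> inX r w.
Proof.
move=> h n; apply/ler_addgt0Pr => e e0; have [d d0 hd] := cont_at_iter a n w e0.
have [u hu /hd] := h d d0; have := hu n; have := normc_re (F n u - F n w).
by rewrite reD reN ler_norml; flra.
Qed.

Lemma fast_closed w : (forall e, 0 < e -> exists2 u, fast u & normc (u - w) < e) -> fast w.
Proof.
move=> h; have hw : inX R0 w.
  by apply: inX_closed => e e0; have [u hu hd] := h e e0; exists u => //; exact: fast_inR0.
have [k kw] := inR0_addr hw; exists k; split=> // n.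
have [d d0 hd] := cont_at_iter a n.+1 w (@ltr01 R).
have [u [k' [ku hk]] hd'] := h d d0; suff -> : k n.+1 = k' n.+1 by exact: hk.
apply: (strip_close (kw n.+1) (ku n.+1)).
have := hd u hd'; have := normc_im (F n.+1 u - F n.+1 w); rewrite imD imN distrC.
have := @pi_ge2 R; flra.
Qed.

(** The bound on the entries keeps every intermediate point far to the right, where the branches of
    the logarithm invert [f]. *)
Lemma addr_pullback k n u : addr (fun j => k (j + n)%N) u -> (forall j, (K0 <= `|k j.+1|)%N) ->
  exists2 w, F n w = u & addr k w.
Proof.
elim: n u => [|n IH] u ku hk.
  by exists u => // j; have := ku j; rewrite addn0.
have hu : inX (R0 + 100) u by apply: (addr_fast_inX ku) => j; exact: hk.
have h0 : 0 < re (u - a) by have := hu 0%N; have := re_a_le a; have := R0_gtA0; rewrite reD reN /=; flra.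
have [|//|w ew kw] := IH (Log (u - a) + ipi R (k n)).
  case=> [|j]; first exact: strip_branch.
  by have := ku j; rewrite iter_expmapS expmap_branch // addnS.
exists w => //; by rewrite [LHS]/= ew expmap_branch.
Qed.

Lemma iter_same_addr_inj k n u v : addr k u -> addr k v -> inX (A0 + 144) u -> inX (A0 + 144) v ->
  F n u = F n v -> u = v.
Proof.
move=> ku kv hu hv e; apply/eqP; rewrite -subr_eq0; apply/eqP/normc_eq0.
have := @iter_expand _ a n u v k (fun j _ => hu j) (fun j _ => hv j) (fun j _ => ku j) (fun j _ => kv j).
by rewrite e subrr normc0 pmulr_rle0 ?exprn_gt0.
Qed.

(* For points of [fast], being an initial point of a hair is decided at level 0:
   a longer hair of an iterate pulls back along the itinerary. *)
Lemma fast_tip w : fast w -> (forall z T, inX R0 z -> 0 <= T -> w = Phi z T -> T = 0) -> tip R0 w.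
Proof.
move=> /[dup] /fast_inR0 hw [k [kw hk]] h n z T hz T0 e.
have [kz hkz] := inR0_addr hz.
have ez : addr (fun j => k (j + n)%N) z.
  by rewrite (addr_uniq (addr_iter n kw) (k' := kz)) // e; exact: Phi_addr.
have [|z' ez' kz'] := addr_pullback ez; first by move=> j; have := hk j; lia.
have hz' : inX R0 z' by apply: fast_inR0; exists k.
have [S S0 eS] := tau_surj n (inR0_1 hz') T0.
have ew : w = Phi z' S.
  apply: (@iter_same_addr_inj k n) => //; [exact: Phi_addr|exact: inR0_144|exact: Phi_inX144|].
  by rewrite Phi_iter // ez' eS.
by rewrite -eS (h _ _ hz' S0 ew) tau0.
Qed.

(** At a high level [n] a tip from [guided_tip] is placed within 40 of [F n (Phi w S)], its
    itinerary is grafted onto the first [n] entries of that of [w], and pulling back shrinks the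
    distance. The grafted itinerary is again that of a [fast] point since [tau n w S] exceeds
    [n + K0], which leaves room to guide the tip with this offset. *)
Lemma fast_tips_dense w S e : fast w -> 0 < S -> 0 < e ->
  exists b : C, [/\ fast b, tip R0 b & normc (b - Phi w S) < e].
Proof.
move=> fw S0 e0; have hw := fast_inR0 fw; have i1 := inR0_1 hw; have [k [kw hk]] := fw.
have [N1 hN1] := tau_large (R0 + 600) i1 S0; have [N2 hN2] := pow16_gt 40 e0.
pose n := (maxn N1 N2).+1.
have hn : 40 < 16 ^+ n * e.
  apply: lt_le_trans hN2 _; by rewrite ler_pM2r // pow16_mono // leqW // leq_maxr.
have ht0 : R0 + 600 < tau n w S by apply: hN1; rewrite leqW // leq_maxl.
have R2 := R0_ge; have A1 := A0_ge0 a.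
have ht1 : (n + K0)%:R <= tau n w S.
  have hm : R0 + 600 < tau (maxn N1 N2) w S by apply: hN1; rewrite leq_maxl.
  have := fast_expR kw (hk (maxn N1 N2)); have := expR_ge1Dx (tau (maxn N1 N2) w S).
  rewrite [tau n w S]/=; set E := expR (re _); set E' := expR _ => h1; rewrite -/n.
  have E1 : A0 + 2 <= E.
    by have := expR_ge1Dx (re (F (maxn N1 N2) w)); have := hw (maxn N1 N2); rewrite -/E R0E; flra.
  move=> h2; have : E * 2 <= E * (E' - 1) by rewrite ler_pM2l; flra.
  flra.
have hre : re (F n w) + tau n w S - 10 <= re (F n (Phi w S)).
  by have := Phi_re n hw (ltW S0); rewrite ler_norml; flra.
have hwn := hw n; set x := re (F n (Phi w S)) in hre.
have [||b' [k' [kb' k0 hb' hj tb']]] := @guided_tip (k n) x (n + K0).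
- flra.
- have := @expR_lower x; flra.
pose kk j := if (j < n)%N then k j else k' (j - n)%N.
have kkn j : kk (j + n)%N = k' j by rewrite /kk ltnNge leq_addl /= addnK.
have kk_hk j : (j.+1 + K0 <= `|kk j.+1|)%N.
  rewrite /kk; case: ltnP => [_|]; first exact: hk.
  rewrite leq_eqVlt => /orP[/eqP en|hlt]; first by rewrite en subnn k0 -/n en; exact: hk.
  by have := hj (j - n)%N; rewrite -subSn // addnA subnK ?(ltnW hlt).
have [||b eb kb] := @addr_pullback kk n b'.
- by move=> j; rewrite kkn; exact: kb'.
- by move=> j; apply: leq_trans (kk_hk j); exact: leq_addl.
have fb : fast b by exists kk.
exists b; split=> //; first by apply: (@tip_of_iter R0 n) => //; rewrite eb.
rewrite -(@ltr_pM2l _ (16 ^+ n)) ?exprn_gt0 //; apply: le_lt_trans hn.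
have kP := Phi_addr hw (ltW S0) kw.
apply: le_trans (@iter_expand _ _ n _ _ k _ _ _ _) _.
- by move=> j _; exact: inR0_144 (fast_inR0 fb) j.
- by move=> j _; exact: Phi_inX144 hw (ltW S0) j.
- by move=> j jn; have := kb j; rewrite /kk jn.
- by move=> j _; exact: kP.
rewrite eb; apply: le_trans (normc_le_reim _) _; rewrite !reD !reN !imD !imN -/x.
have := strip_dist (kb' 0%N) (w := F n (Phi w S)); rewrite k0 => /(_ (kP n)) /=.
have := pi_lt4 R; flra.
Qed.

End Tips.

(** * Uniform escape along paths *)

Section UniformEscape.
Variable R : realType.
Local Notation C := R[i].
Variable a : C.
Implicit Types (z w u v : C) (x y t r S T e b c s p q : R) (k : nat -> int) (n m j M N : nat) (zeta gam : R -> C).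

Local Notation f := (expmap a).
Local Notation F n z := (iter n (expmap a) z).
Local Notation A0 := (normc a).
Local Notation R0 := (R0 a).
Local Notation inX := (inX a).
Local Notation Phi := (Phi a).
Local Notation tip := (tip a).
Local Notation fast := (fast a).
Local Notation K0 := (K0 a).

Definition unif gam b c := forall r, exists N, forall n, (N <= n)%N ->
  forall t, b <= t <= c -> r <= re (F n (gam t)).

Lemma unif_sub gam b c b' c' : b <= b' -> c' <= c -> unif gam b c -> unif gam b' c'.
Proof.
move=> bb cc h r; have [N hN] := h r; exists N => n Nn t tt; apply: hN => //; flra.
Qed.

Lemma unif_glue gam b c d : unif gam b c -> unif gam c d -> unif gam b d.
Proof.
move=> h h' r; have [N hN] := h r; have [N' hN'] := h' r; exists (maxn N N') => n.
rewrite geq_max => /andP[n1 n2] t tt; have [tc|/ltW tc] := leP t c.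
  by apply: hN => //; flra.
by apply: hN' => //; flra.
Qed.

Lemma unif_iter m gam b c : unif (fun t => F m (gam t)) b c <-> unif gam b c.
Proof.
split=> h r; have [N hN] := h r.
  exists (N + m)%N => n hn t tt; have h1 : (N <= n - m)%N by rewrite leq_subRL; lia.
  by have := hN _ h1 t tt; rewrite -iter_expmapD subnK //; lia.
exists N => n hn t tt; rewrite -iter_expmapD; apply: hN => //; lia.
Qed.

Lemma unif_inX r gam b c : unif gam b c -> exists M, forall t, b <= t <= c -> inX r (F M (gam t)).
Proof.
move=> h; have [N hN] := h r; exists N => t tt n; rewrite -iter_expmapD; apply: hN => //.
exact: leq_addl.
Qed.

Lemma unif_of_inX M gam b c : b <= c -> ccont gam b c ->
  (forall t, b <= t <= c -> inX R0 (F M (gam t))) ->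
  (forall t, b <= t <= c -> escaping f (gam t)) -> unif gam b c.
Proof. exact: path_escape. Qed.

Lemma ccont_rev gam b c : ccont gam b c -> ccont (fun t => gam (b + c - t)) b c.
Proof.
move=> h; apply: (ccont_reparam (x := fun t => b + c - t) h) => [|t]; last by flra.
by apply: (rcont_ext _ (@rcont_affine R (- 1) (b + c) b c)) => t _ /=; ring.
Qed.

Lemma K0_guided x : R0 + 300 <= x -> 64 * (K0%:R + 2) <= expR x.
Proof.
move=> hx; have A1 := A0_ge0 a; have R2 := R0_ge a.
have h0 : 0 <= expR (R0 + 100) + A0 + 10 by have := expR_gt0 (R0 + 100); flra.
have h1 : K0%:R <= expR (R0 + 100) + A0 + 11.
  by have := truncn_le (expR (R0 + 100) + A0 + 10); rewrite h0 /K0 -natr1; flra.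
have h2 : 200 * expR (R0 + 100) <= expR x.
  have -> : expR x = expR (x - (R0 + 100)) * expR (R0 + 100) by rewrite -expRD subrK.
  rewrite ler_pM2r ?expR_gt0 //; have := expR_ge1Dx (x - (R0 + 100)); flra.
have := expR_ge1Dx (R0 + 100); rewrite R0E in R2 *; flra.
Qed.

Lemma fast_guided (l : int) x : R0 + 300 <= x ->
  exists w, [/\ fast w, strip l w, `|re w - x| <= 30 & tip R0 w].
Proof.
move=> hx; have [||w [k [kw k0 hw hk tw]]] := @guided_tip _ a l x K0; first by flra.
  exact: K0_guided.
by exists w; split=> //; [exists k|rewrite -k0; exact: kw 0%N].
Qed.

Lemma fast_inX20 w : fast w -> inX (R0 + 20) w.
Proof. by move/fast_inX; apply: inX_le; flra. Qed.

(** On each [[t, q]] with [p < t] some iterate maps the path into [inX r], so [hair_stay_tip]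
    applies. The iterate depends on [t], whence the exclusion of [p]. *)
Lemma hair_stay_start r zeta w s T p q : ccont zeta p q ->
  (forall t, p < t <= q -> unif zeta t q) -> inX (R0 + 20) w -> R0 <= r -> tip r w ->
  p < s <= q -> 0 <= T -> zeta s = Phi w T ->
  forall t, p < t <= s -> exists2 S, 0 <= S & zeta t = Phi w S.
Proof.
move=> hz hu hw hr tw ss T0 e t tt.
have [|M hM] := @unif_inX r zeta t q; first by apply: hu; flra.
apply: (@hair_stay_tip _ a M r zeta w s T t s) => //; last by flra.
- by apply: ccont_sub hz; flra.
- by flra.
- by move=> t' tt'; apply: hM; flra.
Qed.

Lemma hair_above w x : inX R0 w -> exists2 B, 0 <= B & x <= re (Phi w B).
Proof.
move=> hw; have B0 : 0 <= Num.max 0 (x - re w + 10) by rewrite le_max lexx.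
exists (Num.max 0 (x - re w + 10)) => //; have := Phi_re 0 hw B0.
have : x - re w + 10 <= Num.max 0 (x - re w + 10) by rewrite le_max lexx orbT.
by rewrite /= ler_norml; flra.
Qed.

Lemma fast_hair_strip (l : int) w T : inX R0 w -> strip l w -> 0 <= T -> strip l (Phi w T).
Proof.
move=> hw sl T0; have [k kw] := inR0_addr hw.
by rewrite (strip_uniq sl (kw 0%N)); exact: (Phi_addr hw T0 kw 0%N).
Qed.

(** The hair of a tip is a wall: a path climbing through the strip to the right of [w] meets it by
    [crossing], and then lies on it at all earlier times after [p] by [hair_stay_start], although
    near [p] the path is below the strip. *)
Lemma barrier_up zeta (l : int) w t p q : p <= t <= q -> ccont zeta p q ->
  (forall s, p < s <= q -> unif zeta s q) -> fast w -> tip R0 w -> strip l w ->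
  (forall s, p <= s <= t -> re w <= re (zeta s)) ->
  im (zeta p) < twopi R * l%:~R - pi / 2 -> im (zeta t) <= twopi R * l%:~R + pi / 2.
Proof.
move=> tt hz hu fw tw sl hre hp; rewrite leNgt; apply/negP => ht.
have hw := fast_inR0 fw.
have hzt : ccont zeta p t by apply: ccont_sub hz; flra.
have [B B0 hB] := rcont_bounded (rcont_re hzt).
have [G G0 hG] := hair_above B hw.
have hs T : 0 <= T -> `|im (Phi w T) - twopi R * l%:~R| < pi / 2.
  by move=> T0; have := fast_hair_strip hw sl T0.
have [||||T|T|s|s|s [T [ss TT e]]] := @crossing R zeta (Phi w) p t 0 G.
- by flra.
- by [].
- exact: hzt.
- exact: Phi_ccont.
- by move=> /andP[/hs]; rewrite ltr_norml; flra.
- by move=> /andP[/hs]; rewrite ltr_norml; flra.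
- by move=> ss; rewrite Phi0 //; exact: hre.
- by move=> ss; apply: le_trans hG; exact: hB.
have T0 : 0 <= T by flra.
have ps : p < s.
  rewrite lt_neqAle; apply/andP; split; last by flra.
  by apply/eqP => ep; move: (hs T T0); rewrite -e -ep ltr_norml; flra.
have stay := hair_stay_start hz hu (fast_inX20 fw) (lexx R0) tw (_ : p < s <= q) T0 e.
have pp : p <= p <= q by flra.
have [|d d0 hd] := hz p pp (twopi R * l%:~R - pi / 2 - im (zeta p)); first by flra.
pose t' := Num.min s (p + d / 2).
have t's : t' <= s by rewrite ge_min lexx.
have t'd : t' <= p + d / 2 by rewrite ge_min lexx orbT.
have t'p : p < t' by rewrite lt_min ps /=; flra.
have [||S S0 eS] := stay _ t'; [flra|flra|].
have := hd t'; rewrite eS => /(_ ltac:(flra) ltac:(rewrite ltr_norml; flra)).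
have := normc_im (Phi w S - zeta p); rewrite imD imN; have := hs S S0.
rewrite ler_norml ltr_norml; flra.
Qed.

(** As for [barrier_up]; the path is run backwards so that [crossing] again sees it rise. *)
Lemma barrier_down zeta (l : int) w t p q : p <= t <= q -> ccont zeta p q ->
  (forall s, p < s <= q -> unif zeta s q) -> fast w -> tip R0 w -> strip l w ->
  (forall s, p <= s <= t -> re w <= re (zeta s)) ->
  twopi R * l%:~R + pi / 2 < im (zeta p) -> twopi R * l%:~R - pi / 2 <= im (zeta t).
Proof.
move=> tt hz hu fw tw sl hre hp; rewrite leNgt; apply/negP => ht.
have hw := fast_inR0 fw.
have hzt : ccont zeta p t by apply: ccont_sub hz; flra.
have [B B0 hB] := rcont_bounded (rcont_re hzt).
have [G G0 hG] := hair_above B hw.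
have hs T : 0 <= T -> `|im (Phi w T) - twopi R * l%:~R| < pi / 2.
  by move=> T0; have := fast_hair_strip hw sl T0.
have [||||T|T|s|s|s' [T [ss TT e']]] := @crossing R (fun s => zeta (p + t - s)) (Phi w) p t 0 G.
- by flra.
- by [].
- exact: ccont_rev.
- exact: Phi_ccont.
- by move=> /andP[/hs]; rewrite [p + t - p]addrAC subrr add0r ltr_norml; flra.
- by move=> /andP[/hs]; rewrite addrK ltr_norml; flra.
- by move=> ss; rewrite Phi0 //; apply: hre; flra.
- by move=> ss; apply: le_trans hG; apply: hB; flra.
set s := p + t - s' in e'.
have T0 : 0 <= T by flra.
have ps : p < s.
  rewrite lt_neqAle; apply/andP; split; last by rewrite /s; flra.
  by apply/eqP => ep; move: (hs T T0); rewrite -e' -ep ltr_norml; flra.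
have sq : p < s <= q by rewrite ps /s; flra.
have stay := hair_stay_start hz hu (fast_inX20 fw) (lexx R0) tw sq T0 e'.
have pp : p <= p <= q by flra.
have [|d d0 hd] := hz p pp (im (zeta p) - (twopi R * l%:~R + pi / 2)); first by flra.
pose t' := Num.min s (p + d / 2).
have t's : t' <= s by rewrite ge_min lexx.
have t'd : t' <= p + d / 2 by rewrite ge_min lexx orbT.
have t'p : p < t' by rewrite lt_min ps /=; flra.
have [|S S0 eS] := stay t'; first by flra.
have := hd t'; rewrite eS => /(_ ltac:(flra) ltac:(rewrite ltr_norml; flra)).
have := normc_im (Phi w S - zeta p); rewrite imD imN; have := hs S S0.
rewrite ler_norml ltr_norml; flra.
Qed.

End UniformEscape.

(** * Uniform escape at an end of a path: ends inside a hair, and tools for tips *)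

Section EndpointExtension.
Variable R : realType.
Local Notation C := R[i].
Variable a : C.
Implicit Types (z w u v : C) (x y t r S T e b c s p q : R) (k : nat -> int) (n m j M N : nat) (zeta gam : R -> C).

Local Notation f := (expmap a).
Local Notation F n z := (iter n (expmap a) z).
Local Notation A0 := (normc a).
Local Notation R0 := (R0 a).
Local Notation inX := (inX a).
Local Notation addr := (addr a).
Local Notation tau := (tau a).
Local Notation Phi := (Phi a).
Local Notation unif := (unif a).

Lemma nunif_iter m zeta p q : (forall t, p < t <= q -> unif zeta t q) ->
  forall t, p < t <= q -> unif (fun t => F m (zeta t)) t q.
Proof. by move=> h t tt; apply/unif_iter; exact: h. Qed.

(** The walls are hairs of tips in the two adjacent strips, beginning at real part about [x + 300];
    10 bounds [twopi R + pi / 2]. *)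
Lemma barrier_both zeta (l : int) x c p q : p <= c <= q -> ccont zeta p q ->
  (forall s, p < s <= q -> unif zeta s q) -> strip l (zeta p) -> R0 <= x ->
  (forall s, p <= s <= c -> x + 330 <= re (zeta s)) -> `|im (zeta c) - twopi R * l%:~R| <= 10.
Proof.
move=> cc hz hu sl hx hre; have p2 := @pi_ge2 R; have p4 := pi_lt4 R; have t8 := twopi_lt8 R.
have hx' : R0 + 300 <= x + 300 by flra.
move: sl; rewrite /strip ltr_norml => sl.
have tp : twopi R = 2 * pi by [].
have [w [fw sw xw tw]] := fast_guided (l + 1) hx'.
have [w' [fw' sw' xw' tw']] := fast_guided (l - 1) hx'.
rewrite !ler_norml in xw xw'.
have up := @barrier_up _ a zeta (l + 1) w c p q cc hz hu fw tw sw.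
have down := @barrier_down _ a zeta (l - 1) w' c p q cc hz hu fw' tw' sw'.
rewrite intrD mulrDr mulr1 in up; rewrite intrD mulrDr mulrN mulr1 in down.
have {}up : im (zeta c) <= twopi R * l%:~R + twopi R + pi / 2.
  apply: up; first by move=> s ss; have := hre s ss; clear -xw; flra.
  clear -sl tp p2; flra.
have {}down : twopi R * l%:~R - twopi R - pi / 2 <= im (zeta c).
  apply: down; first by move=> s ss; have := hre s ss; clear -xw'; flra.
  clear -sl tp p2; flra.
rewrite ler_norml; clear -up down t8 p4; flra.
Qed.

(* If the orbit dropped back to [2 * |F n z| + R0 + 400] it would do so at bounded height,
   because hairs of tips above and below act as barriers, and this is too small
   for its real part one step earlier. *)
Lemma nonend_core zeta p q z k : p < q -> ccont zeta p q ->
  (forall t, p < t <= q -> unif zeta t q) -> inX R0 z -> addr k z -> addr k (zeta p) ->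
  (forall n, 2 * normc (F n z) + R0 + 401 <= re (F n (zeta p))) ->
  exists2 e, 0 < e <= q - p & forall n t, p <= t <= p + e -> 2 * normc (F n z) + R0 + 400 < re (F n (zeta t)).
Proof.
move=> pq hz hu hzX kz kp hp.
have [|d d0 hd] := hz p _ 1 ltr01; first by flra.
exists (Num.min (d / 2) (q - p)); first by rewrite lt_min ge_min lexx orbT andbT; flra.
set e := Num.min _ _.
have ed : e <= d / 2 by rewrite ge_min lexx.
have eq_ : e <= q - p by rewrite ge_min lexx orbT.
have A1 := A0_ge0 a; have R2 := R0_ge a.
elim=> [|n IH] t tt.
  have := hd t; rewrite ltr_norml => /(_ ltac:(flra) ltac:(flra)).
  have := normc_re (zeta t - zeta p); have := hp 0%N; rewrite /= reD reN ler_norml; clear; flra.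
rewrite ltNge; apply/negP => hle.
have cz := ccont_iter a n.+1 hz.
have pt : p <= t by flra.
have czt : ccont (fun s => F n.+1 (zeta s)) p t by apply: ccont_sub cz; flra.
set th := 2 * normc (F n.+1 z) + R0 + 400 in hle.
(* [c] is the first time at which the real part has dropped to [th]; up to then the path is far
   enough to the right for the walls. *)
have [|||c cc [ec hc]] := @first_hit R (fun s => - re (F n.+1 (zeta s))) p t (- th) pt.
- apply: (@rcont_le _ _ (fun s => F n.+1 (zeta s))) => // s s'.
  rewrite -opprD normrN -reN -reD; exact: normc_re.
- by have := hp n.+1; rewrite /th; clear; flra.
- by clear -hle; flra.
have cpq : p <= c <= q by flra.
have hzn := hzX n.+1; have hzn' := hzX n.
have nz := le_trans (ler_norm _) (normc_re (F n.+1 z)).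
have hb : `|im (F n.+1 (zeta c)) - twopi R * (k n.+1)%:~R| <= 10.
  apply: (@barrier_both (fun s => F n.+1 (zeta s)) (k n.+1) (re (F n.+1 z)) c p q cpq cz
    (nunif_iter n.+1 hu) (kp n.+1) hzn).
  by move=> s ss; have := hc s ss; rewrite /th; cbv beta; clear -nz R2 hzn; flra.
have hs := kz n.+1; have iz := normc_im (F n.+1 z).
have E1 : 64 * R0 <= expR (re (F n z)).
  have := @expR_lower R (re (F n z)); clear -hzn' R2; flra.
have hE : normc (F n.+1 z) <= expR (re (F n z)) + A0.
  by rewrite expR_norm; have := @ler_normcD R (F n.+1 z - a) a; rewrite subrK.
have h1 : normc (F n.+1 (zeta c) - a) <= `|re (F n.+1 (zeta c))| + `|im (F n.+1 (zeta c))| + A0.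
  by have := ler_normcB (F n.+1 (zeta c)) a; have := normc_le_reim (F n.+1 (zeta c)); clear; flra.
have h2 : re (F n.+1 (zeta c)) = th by rewrite -[LHS]opprK ec opprK.
have h3 : `|im (F n.+1 (zeta c))| <= normc (F n.+1 z) + 12.
  have := pi_lt4 R; move: hb hs iz; rewrite /strip !ler_norml ltr_norml; clear; flra.
rewrite h2 (ger0_norm (_ : 0 <= th)) -?expR_norm in h1; last first.
  by have := normc_ge0 (F n.+1 z); rewrite /th; clear -R2; flra.
have pc : p <= c <= p + e by flra.
have hn := IH c pc; have nzn := le_trans (ler_norm _) (normc_re (F n z)).
(* By the induction hypothesis the lead at level [n] is at least 400. But [th] and the bounded
   height allow at most [3 * expR (re (F n z))] plus a remainder no larger than one further such
   exponential. *)
have h4 : 401 * expR (re (F n z)) <= expR (re (F n (zeta c))).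
  have -> : expR (re (F n (zeta c))) = expR (re (F n (zeta c)) - re (F n z)) * expR (re (F n z)).
    by rewrite -expRD subrK.
  rewrite ler_pM2r ?expR_gt0 //; have := expR_ge1Dx (re (F n (zeta c)) - re (F n z)).
  have := normc_ge0 (F n z); clear -hn nzn R2; flra.
have R3 := R0E a; rewrite /th in h1; clear -h1 h3 h4 hE E1 R3 A1 R2; flra.
Qed.

(** Since [T] is positive, [tau n z T] tends to infinity, so from step [N.+1] on the orbit of
    [zeta p] leads that of [z] by as much as [nonend_core] asks for. *)
Lemma nonend_unif zeta p q z T : p < q -> ccont zeta p q ->
  (forall t, p <= t <= q -> escaping f (zeta t)) ->
  (forall t, p < t <= q -> unif zeta t q) -> inX R0 z -> 0 < T -> zeta p = Phi z T -> unif zeta p q.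
Proof.
move=> pq hz hI hu hzX T0 ep; have i1 := inR0_1 hzX.
have A1 := A0_ge0 a; have R2 := R0_ge a.
have [N hN] := tau_large 100 i1 T0.
have [k kz] := inR0_addr hzX; have kp := Phi_addr hzX (ltW T0) kz; rewrite -ep in kp.
have hp n : 2 * normc (F n (F N.+1 z)) + R0 + 401 <= re (F n (F N.+1 (zeta p))).
  rewrite -!iter_expmapD addnS ep.
  have ht : 100 < tau (n + N) z T by apply: hN; exact: leq_addl.
  have := Phi_re (n + N).+1 hzX (ltW T0); have hr := hzX (n + N).+1; have hr' := hzX (n + N)%N.
  rewrite [tau _.+1 z T]/=; set E := expR (re _).
  have E1 : 64 * R0 <= E by have := @expR_lower R (re (F (n + N) z)); rewrite -/E; clear -hr' R2; flra.
  have hE : normc (F (n + N).+1 z) <= E + A0.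
    by rewrite /E expR_norm; have := @ler_normcD R (F (n + N).+1 z - a) a; rewrite subrK.
  have h2 : E * 100 <= E * (expR (tau (n + N) z T) - 1).
    rewrite ler_wpM2l ?expR_ge0 //; have := expR_ge1Dx (tau (n + N) z T); clear -ht; flra.
  rewrite ler_norml; have R3 := R0E a; clear -hr E1 hE h2 A1 R2 R3; flra.
have [e /andP[e0 eq_] he] := @nonend_core (fun t => F N.+1 (zeta t)) p q (F N.+1 z) _ pq (ccont_iter a N.+1 hz)
  (nunif_iter N.+1 hu) (inX_iter N.+1 hzX) (addr_iter N.+1 kz) (addr_iter N.+1 kp) hp.
have u1 : unif zeta p (p + e).
  apply: (@unif_of_inX _ a N.+1).
  - by clear -e0; flra.
  - by apply: ccont_sub hz => //; clear -eq_; flra.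
  - move=> t tt n; have := he n t tt; have := normc_ge0 (F n (F N.+1 z)); clear; flra.
  - by move=> t tt; apply: hI; flra.
by apply: (unif_glue u1); apply: hu; flra.
Qed.

Lemma chord_abs gam b c : b <= c -> ccont gam b c -> re (gam b) = re (gam c) ->
  (forall t, b <= t <= c -> re (gam t) <= re (gam c)) ->
  twopi R < `|im (gam c) - im (gam b)| ->
  exists s t, [/\ b <= s <= c, b <= t <= c & gam s = gam t + ipi R 1].
Proof.
move=> bc hg e hm; rewrite ltr_normr => /orP[h|h].
  by apply: chord_2pi => //; flra.
have [|||s [t [ss tt e']]] := @chord_2pi R (fun t => gam (b + c - t)) b c bc (ccont_rev hg).
- by rewrite [b + c - b]addrAC subrr add0r addrK.
- by move=> t tt; rewrite addrK e; apply: hm; flra.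
- by rewrite [b + c - b]addrAC subrr add0r addrK; flra.
by exists (b + c - s), (b + c - t); split => //; flra.
Qed.

Lemma ipi1_neq0 : ipi R 1 != 0.
Proof.
apply/eqP => /(congr1 (@complex.Im R)) /=; rewrite mulr1; have := twopi_ge4 R; flra.
Qed.

Lemma unif_ext gam gam' b c : (forall t, b <= t <= c -> gam t = gam' t) -> unif gam b c -> unif gam' b c.
Proof.
by move=> e h r; have [N hN] := h r; exists N => n Nn t tt; rewrite -e //; exact: hN.
Qed.

Lemma hair_first_hit w x : inX R0 w -> re w <= x ->
  exists2 c, 0 <= c & re (Phi w c) = x /\ forall t, 0 <= t <= c -> re (Phi w t) <= x.
Proof.
move=> hw hx; have [B B0 hB] := hair_above x hw.
have [|||c /andP[c0 _] [e h]] := @first_hit R (fun t => re (Phi w t)) 0 B x B0.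
- by apply: rcont_re; exact: Phi_ccont.
- by rewrite Phi0.
- by [].
by exists c.
Qed.

Lemma hair_imdist w S T : inX R0 w -> 0 <= S -> 0 <= T -> `|im (Phi w S) - im (Phi w T)| < pi.
Proof.
move=> hw S0 T0; have [k kw] := inR0_addr hw.
exact: (strip_dist (Phi_addr hw S0 kw 0%N) (Phi_addr hw T0 kw 0%N)).
Qed.

(* A long vertical displacement between an initial point and a point on the path
   makes the path, completed by the hair of the initial point, have a chord of
   length 2 pi i; the endpoints of the chord have the same image. *)
Lemma tip_level zeta p q : p < q -> ccont zeta p q ->
  (forall t, p < t <= q -> unif zeta t q) -> inX R0 (zeta p) ->
  (forall t, p <= t <= q -> re (zeta t) <= re (zeta q)) ->
  3 * pi < `|im (zeta q) - im (zeta p)| ->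
  exists2 t1, p < t1 <= q & exists2 T, 0 <= T & f (zeta t1) = Phi (f (zeta p)) T.
Proof.
move=> pq hz hu hY hm him.
have pp : p <= p <= q by flra.
have [c c0 [ec hc]] := hair_first_hit hY (hm p pp).
(* The path comes in along the hair of [zeta p], starting at the real part of [zeta q], and then
   follows [zeta]; so both its ends have the maximal real part, as [chord_2pi] requires. *)
pose eta t := if t <= p then Phi (zeta p) (p - t) else zeta t.
have ceta : ccont eta (p - c) q.
  apply: ccont_glue => //; last by rewrite subrr Phi0.
  apply: (ccont_reparam (a := 0) (b := c) (x := fun t => p - t)); first exact: Phi_ccont.
    by apply: (rcont_ext _ (@rcont_affine R (- 1) p _ _)) => t _ /=; ring.
  by move=> t tt; flra.
have etaL t : t <= p -> eta t = Phi (zeta p) (p - t) by rewrite /eta => ->.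
have etaR t : p < t -> eta t = zeta t by rewrite /eta ltNge => /negbTE ->.
have e1 : eta (p - c) = Phi (zeta p) c by rewrite etaL; [congr Phi; ring|flra].
have [|||||s [t [ss tt e]]] := @chord_abs eta (p - c) q.
- by clear -c0 pq; flra.
- exact: ceta.
- by rewrite e1 etaR.
- move=> t tt; rewrite (etaR q) //; have [tp|tp] := leP t p.
    by rewrite etaL //; apply: hc; flra.
  by rewrite etaR //; apply: hm; flra.
- rewrite e1 etaR //; have := hair_imdist hY c0 (lexx 0); rewrite Phi0 // /twopi.
  have := ler_normD (im (zeta q) - im (Phi (zeta p) c)) (im (Phi (zeta p) c) - im (zeta p)).
  rewrite addrA subrK; move: him; clear; flra.
have ef : f (eta s) = f (eta t) by rewrite e expmap_ipi.
have mixed t1 t2 : p < t1 -> t1 <= q -> t2 <= p -> f (eta t1) = f (eta t2) ->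
    exists2 t1, p < t1 <= q & exists2 T, 0 <= T & f (zeta t1) = Phi (f (zeta p)) T.
  move=> h1 h2 h3; rewrite etaR // etaL // => h; have T0 : 0 <= p - t2 by rewrite subr_ge0.
  exists t1; first by rewrite h1.
  exists (tau 1 (zeta p) (p - t2)); first exact: tau_ge0 (inR0_1 hY) T0.
  by rewrite h; exact: (Phi_iter 1 hY T0).
(* Both ends of the chord cannot lie on the hair, whose height varies by less than pi, nor both on
   [zeta], where iterates are injective away from [p]. The mixed cases give the claim. *)
have [sp|sp] := leP s p; have [tp|tp] := leP t p.
- move: e; rewrite !etaL // => /(congr1 (@complex.Im R)); rewrite imD [im (ipi _ _)]/= mulr1.
  have := @hair_imdist (zeta p) (p - s) (p - t) hY; rewrite !subr_ge0 => /(_ sp tp).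
  rewrite ltr_norml /twopi; clear; flra.
- by apply: (mixed t s) => //; flra.
- by apply: (mixed s t) => //; flra.
move: e ef; rewrite !etaR // => e ef; exfalso.
pose t0 := Num.min s t.
have t0s : t0 <= s by rewrite ge_min lexx.
have t0t : t0 <= t by rewrite ge_min lexx orbT.
have pt0 : p < t0 by rewrite lt_min sp.
have [|M hM] := @unif_inX _ a R0 (fun t => f (zeta t)) t0 q.
  by apply: (@nunif_iter 1 _ _ _ hu); flra.
have : zeta s = zeta t.
  apply: (@path_iter_inj R a M.+1 zeta t0 q).
  - by apply: ccont_sub hz; flra.
  - by move=> t' tt'; rewrite iter_expmapS; exact: hM.
  - by flra.
  - by flra.
  - by rewrite !iter_expmapS ef.
rewrite e => /eqP; rewrite -subr_eq0 addrAC subrr add0r; exact/negP/ipi1_neq0.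
Qed.

(* Adding multiples of 2 pi i of bounded size to an orbit gives a pseudo-orbit. *)
Lemma shift_addr (kx ky : nat -> int) w : inX (R0 + 20) w -> addr ky w ->
  (forall n, `|kx n - ky n|%R <= 2) ->
  exists w', addr kx w' /\ forall n, `|re (F n w') - re (F n w)| <= 2.
Proof.
move=> hw kw hk; have R2 := R0_ge a; have A1 := A0_ge0 a; have R3 := R0E a.
pose v n := F n w + ipi R (kx n - ky n).
have rv n : re (v n) = re (F n w) by rewrite /v reD /= addr0.
have nipi (l : int) : `|l|%R <= 2 -> normc (ipi R l) <= 16.
  move=> hl; rewrite /ipi normc_imag normrM (ger0_norm (_ : 0 <= twopi R)); last by have := twopi_ge4 R; flra.
  have : `|l%:~R| <= 2 :> R by rewrite -intr_norm -[2]/(2%:~R) ler_int.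
  have := twopi_lt8 R; have := twopi_ge4 R; have := normr_ge0 (l%:~R : R); clear; nra.
have [|n|n|w' hw'] := @shadowing _ a v kx 1; first by [].
- by rewrite rv; have := hw n; clear -R2 A1 R3; flra.
- have h0 : 0 < re (F n.+1 w - a).
    by have := hw n.+1; have := re_a_le a; rewrite [re (_ - _)]reD reN; clear -R2 A1 R3; flra.
  have e : F n w = Log (F n.+1 w - a) + ipi R (ky n) by apply: Log_branch.
  have eip : ipi R (ky n) + ipi R (kx n - ky n) = ipi R (kx n).
    by apply: complex_ext; rewrite ?reD ?imD /= ?addr0 // -mulrDr -intrD addrC subrK.
  have -> : v n - (Log (v n.+1 - a) + ipi R (kx n)) = Log (F n.+1 w - a) - Log (v n.+1 - a).
    by rewrite -eip /v {1}e; ring.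
  apply: le_trans (@branch_lip _ a (F n.+1 w) (v n.+1) _ _) _.
  + by have := hw n.+1; clear -R2 A1 R3; flra.
  + by rewrite rv; have := hw n.+1; clear -R2 A1 R3; flra.
  rewrite ler_pdivrMr // mul1r /v opprD addNKr normcN; exact: nipi.
exists w'; split=> n; first by have [] := hw' n.
have [h _] := hw' n; apply: le_trans (_ : normc (F n w' - v n) <= 2); last by clear -h; flra.
by apply: le_trans (normc_re _); rewrite reD reN rv.
Qed.

End EndpointExtension.

(** * Uniform escape at an end that is a tip, and at both ends *)

Section PathsEscapeUniformly.
Variable R : realType.
Local Notation C := R[i].
Variable a : C.
Implicit Types (z w v : C) (x y t r S T e b c s p q : R) (k : nat -> int) (n m j M N : nat) (zeta gam xi : R -> C).

Local Notation f := (expmap a).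
Local Notation F n z := (iter n (expmap a) z).
Local Notation A0 := (normc a).
Local Notation R0 := (R0 a).
Local Notation inX := (inX a).
Local Notation addr := (addr a).
Local Notation Phi := (Phi a).
Local Notation tip := (tip a).
Local Notation unif := (unif a).

Lemma hair_unif w b c : 0 <= b -> b <= c -> inX (R0 + 10) w -> escaping f w -> unif (Phi w) b c.
Proof.
move=> b0 bc hw ew; have hw0 : inX R0 w by apply: inX_R0_le hw.
apply: (@unif_of_inX _ a 0%N) => //; first exact: Phi_ccont.
  move=> t tt; have h10 : R0 <= R0 + 10 by flra.
  by apply: inX_le (Phi_inX h10 hw _); flra.
by move=> t tt; apply: escaping_Phi => //; flra.
Qed.

Lemma unif_point gam t : escaping f (gam t) -> unif gam t t.
Proof.
move=> /escapingP h r; have [N hN] := h r; exists N => n /hN hn t' tt'.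
by have -> : t' = t by flra.
Qed.

(** [tip_level] needs the maximal real part at the right end, so the path is prolonged along the
    hair of [zeta q] until it attains the bound [H]. This changes the height by less than pi, hence
    4 pi in place of 3 pi. Then [f (zeta t1)] is on the hair of the tip [f (zeta p)], and so is the
    image of the path before [t1]. *)
Lemma tip_levels zeta p q : p < q -> ccont zeta p q ->
  (forall t, p <= t <= q -> escaping f (zeta t)) ->
  (forall t, p < t <= q -> unif zeta t q) -> inX (R0 + 200) (zeta p) -> inX (R0 + 200) (zeta q) ->
  tip (R0 + 20) (zeta p) -> 4 * pi < `|im (zeta q) - im (zeta p)| -> unif zeta p q.
Proof.
move=> pq hz hI hu hY hX tY him; have R2 := R0_ge a.
have hY0 : inX R0 (zeta p) by apply: inX_le hY; flra.
have hX0 : inX R0 (zeta q) by apply: inX_le hX; flra.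
have [H H0 hH] := rcont_bounded (rcont_re hz).
have [c c0 [ec hc]] := hair_first_hit hX0 (hH q ltac:(flra)).
pose zt t := if t <= q then zeta t else Phi (zeta q) (t - q).
have cP : ccont (fun t => Phi (zeta q) (t - q)) q (q + c).
  apply: (ccont_reparam (a := 0) (b := c) (x := fun t => t - q)); first exact: Phi_ccont.
    by apply: (rcont_ext _ (@rcont_affine R 1 (- q) _ _)) => t _ /=; ring.
  by move=> t tt; flra.
have czt : ccont zt p (q + c) by apply: ccont_glue => //; rewrite subrr Phi0.
have zL t : t <= q -> zt t = zeta t by rewrite /zt => ->.
have zR t : q <= t -> zt t = Phi (zeta q) (t - q).
  by rewrite /zt le_eqVlt => /orP[/eqP <-|]; [rewrite lexx subrr Phi0|rewrite ltNge => /negbTE ->].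
have uR : unif zt q (q + c).
  move=> r; have hu0 : unif (Phi (zeta q)) 0 c.
    apply: hair_unif => //; [by apply: inX_le hX; flra|by apply: hI; flra].
  have [N hN] := hu0 r; exists N => n Nn t tt; rewrite zR; last by flra.
  by apply: hN => //; flra.
have uzt t : p < t <= q + c -> unif zt t (q + c).
  move=> tt; have [tq|tq] := leP t q; last by apply: unif_sub uR; flra.
  apply: unif_glue uR; apply: (unif_ext (gam := zeta)); first by move=> s ss; rewrite zL //; flra.
  by apply: hu; flra.
have zp : zt p = zeta p by rewrite zL //; flra.
have zq : zt (q + c) = Phi (zeta q) c by rewrite zR; [congr Phi; ring|flra].
have pqc : p < q + c by flra.
have h1 : forall t, p <= t <= q + c -> re (zt t) <= re (zt (q + c)).
  move=> t tt; rewrite zq ec; have [tq|/ltW tq] := leP t q.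
    by rewrite zL //; apply: hH; flra.
  by rewrite zR //; apply: hc; flra.
have h2 : 3 * pi < `|im (zt (q + c)) - im (zt p)|.
  rewrite zp zq; have := hair_imdist hX0 c0 (lexx 0); rewrite Phi0 // distrC => h0.
  have := ler_normD (im (zeta q) - im (Phi (zeta q) c)) (im (Phi (zeta q) c) - im (zeta p)).
  rewrite addrA subrK; move: him h0; clear; flra.
have [|t1 t1q [T T0 eT]] := tip_level pqc czt uzt _ h1 h2; first by rewrite zp.
rewrite zp in eT.
have hfY : inX (R0 + 200) (f (zeta p)) by exact: (inX_iter 1 hY).
have hfY0 : inX R0 (f (zeta p)) by apply: inX_le hfY; flra.
have ufz t : p < t <= q + c -> unif (fun t => f (zt t)) t (q + c).
  by move=> tt; apply/(unif_iter a 1); exact: uzt.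
have stay := hair_stay_start (ccont_iter a 1 czt) ufz (_ : inX (R0 + 20) _) (R0_le20 a) (tip_iter (m := 1) tY) t1q T0 eT.
pose t2 := Num.min t1 q.
have t2q : t2 <= q by rewrite ge_min lexx orbT.
have t21 : t2 <= t1 by rewrite ge_min lexx.
have pt2 : p < t2 by rewrite lt_min pq andbT; flra.
apply: (@unif_glue _ a zeta p t2 q); last by apply: hu; flra.
apply: (@unif_of_inX _ a 1); [by flra|by apply: ccont_sub hz; flra| |by move=> t tt; apply: hI; flra].
move=> t tt; have [<-|tp] := eqVneq p t; first exact: hfY0.
have [||S S0 eS] := stay _ t; first by apply: inX_le hfY; flra.
  by rewrite lt_neqAle tp /=; flra.
rewrite zL in eS; last by flra.
rewrite eS; have h10 : R0 <= R0 + 10 by flra.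
by apply: inX_le (Phi_inX h10 _ S0); [flra|apply: inX_le hfY; flra].
Qed.

(** If the ends are far apart in height at some level, [tip_levels] applies there. Otherwise their
    itineraries differ by at most 2 in each entry, and the orbit of [zeta p] is shifted to a point
    [w'] with the itinerary of [zeta q]. Shifting back shows that [w'] is a tip too, so [zeta q]
    lies on its hair and the path runs along that hair. *)
Lemma tip_unif zeta p q : p < q -> ccont zeta p q ->
  (forall t, p <= t <= q -> escaping f (zeta t)) ->
  (forall t, p < t <= q -> unif zeta t q) -> inX (R0 + 200) (zeta p) -> inX (R0 + 200) (zeta q) ->
  tip (R0 + 20) (zeta p) -> unif zeta p q.
Proof.
move=> pq hz hI hu hY hX tY.
have [[m hm]|hno] := pselect (exists m, 4 * pi < `|im (F m (zeta q)) - im (F m (zeta p))|).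
  apply/(unif_iter a m); apply: tip_levels => //.
  - exact: ccont_iter.
  - by move=> t tt; apply/escaping_iter; exact: hI.
  - exact: nunif_iter.
  - exact: inX_iter.
  - exact: inX_iter.
  - exact: tip_iter.
have hY0 : inX R0 (zeta p) by apply: inX_le hY; flra.
have hX0 : inX R0 (zeta q) by apply: inX_le hX; flra.
have [ky kY] := inR0_addr hY0; have [kx kX] := inR0_addr hX0.
have hd n : `|kx n - ky n|%R <= 2.
  have h1 : `|im (F n (zeta q)) - im (F n (zeta p))| <= 4 * pi.
    by rewrite leNgt; apply/negP => h; apply: hno; exists n.
  have h2 := kX n; have h3 := kY n.
  have h4 : `|twopi R * (kx n)%:~R - twopi R * (ky n)%:~R| < 3 * twopi R.
    move: h1 h2 h3; rewrite /strip !ltr_norml ler_norml /twopi; have := @pi_ge2 R; clear; flra.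
  rewrite -mulrBr -intrB normrM (ger0_norm (_ : 0 <= twopi R)) in h4; last by have := twopi_ge4 R; flra.
  rewrite mulrC ltr_pM2r in h4; last by have := twopi_ge4 R; flra.
  rewrite -intr_norm -[3]/(3%:~R) ltr_int in h4; move: h4; clear; lia.
have hY20 : inX (R0 + 20) (zeta p) by apply: inX_le hY; flra.
have [w' [kw' hw']] := shift_addr hY20 kY hd.
have hW : inX (R0 + 190) w'.
  by move=> n; have := hw' n; have := hY n; rewrite ler_norml; clear; flra.
have hW0 : inX R0 w' by apply: inX_le hW; flra.
have tw : tip (R0 + 50) w'.
  move=> n z T hzX T0 e; apply/eqP; rewrite eq_le T0 andbT leNgt; apply/negP => Tp.
  have hz0 : inX R0 z by apply: inX_le hzX; flra.
  have kz : addr (fun i => kx (i + n)%N) z.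
    have [kk hk] := inR0_addr hz0; have := Phi_addr hz0 T0 hk; rewrite -e => hk2.
    by rewrite (addr_uniq (addr_iter n kw') hk2).
  have hd' i : `|ky (i + n)%N - kx (i + n)%N|%R <= 2 by rewrite distrC.
  have hz20 : inX (R0 + 20) z by apply: inX_le hzX; flra.
  have [z' [kz' hz']] := shift_addr hz20 kz hd'.
  have hZ : inX (R0 + 20) z'.
    by move=> i; have := hz' i; have := hzX i; rewrite ler_norml; clear; flra.
  have hZ0 : inX R0 z' by apply: inX_le hZ; flra.
  have [N hN] := Phi_large 200 hz0 Tp.
  have gap i : (N <= i)%N -> re (F i z') + 100 < re (F i (F n (zeta p))).
    move=> /hN; rewrite -e; have := hz' i; have := hw' (i + n)%N; rewrite !iter_expmapD !ler_norml.
    clear; flra.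
  have [N'|S S0 eS] := hair_of_ge hZ0 (inR0_144 (inX_iter n hY0)) kz' (addr_iter n kY).
    exists (maxn N N'); first exact: leq_maxr.
    by have := gap (maxn N N') (leq_maxl _ _); clear; flra.
  have S_0 := tY n z' S hZ S0 eS; have := gap N (leqnn N); rewrite eS S_0 Phi0 //; clear; flra.
have [T T0 eT] : exists2 T, 0 <= T & zeta q = Phi w' T.
  have [//|[T T0 eT]] := hair_cmp hW0 hX0 kw' kX.
  have hX50 : inX (R0 + 50) (zeta q) by apply: inX_le hX; flra.
  have := tw 0%N _ _ hX50 T0 eT => T_0; exists 0 => //.
  by rewrite eT T_0 !Phi0 //.
have r50 : R0 <= R0 + 50 by flra.
have hW20 : inX (R0 + 20) w' by apply: inX_le hW; flra.
have stay := hair_stay_start hz hu hW20 r50 tw (_ : p < q <= q) T0 eT.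
apply: (@unif_of_inX _ a 0%N) => //; first exact: ltW.
move=> t tt; have [<-|tp] := eqVneq p t; first exact: hY0.
have [||S S0 ->] := stay _ t; [by rewrite pq lexx|by rewrite lt_neqAle tp|].
have h10 : R0 <= R0 + 10 by flra.
by apply: inX_le (Phi_inX h10 _ S0); [flra|apply: inX_le hW; flra].
Qed.

Lemma unif_left zeta p q : p < q -> ccont zeta p q ->
  (forall t, p <= t <= q -> escaping f (zeta t)) ->
  (forall t, p < t <= q -> unif zeta t q) -> unif zeta p q.
Proof.
move=> pq hz hI hu.
have [[j [z [T [hzX T0 e]]]]|hno] := pselect (exists j z T, [/\ inX (R0 + 20) z, 0 < T & F j (zeta p) = Phi z T]).
  apply/(unif_iter a j); apply: (nonend_unif pq _ _ _ (_ : inX R0 z) T0 e).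
  - exact: ccont_iter.
  - by move=> t tt; apply/escaping_iter; exact: hI.
  - exact: nunif_iter.
  - by apply: inX_le hzX; flra.
have tp : tip (R0 + 20) (zeta p).
  move=> j z T hzX T0 e; apply/eqP; rewrite eq_le T0 andbT leNgt; apply/negP => Tp.
  by apply: hno; exists j, z, T.
have [m hm] := escaping_inX (R0 + 200) (hI p ltac:(flra)).
have [m' hm'] := escaping_inX (R0 + 200) (hI q ltac:(flra)).
apply/(unif_iter a (m' + m)); apply: tip_unif => //.
- exact: ccont_iter.
- by move=> t tt; apply/escaping_iter; exact: hI.
- exact: nunif_iter.
- by rewrite iter_expmapD; exact: inX_iter.
- by rewrite addnC iter_expmapD; exact: inX_iter.
- exact: tip_iter.
Qed.

Lemma unif_rev zeta p q b c : b <= c -> unif (fun t => zeta (p + q - t)) b c ->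
  unif zeta (p + q - c) (p + q - b).
Proof.
move=> bc h r; have [N hN] := h r; exists N => n Nn t tt.
by have := hN n Nn (p + q - t); rewrite subKr; apply; flra.
Qed.

Lemma unif_both zeta p q : p < q -> ccont zeta p q ->
  (forall t, p <= t <= q -> escaping f (zeta t)) ->
  (forall s t, p < s -> s <= t -> t < q -> unif zeta s t) -> unif zeta p q.
Proof.
move=> pq hz hI hu; pose m := (p + q) / 2.
apply: (@unif_glue _ a zeta p m q).
  apply: unif_left; first by rewrite /m; flra.
  - by apply: ccont_sub hz; rewrite /m; flra.
  - by move=> t tt; apply: hI; move: tt; rewrite /m; flra.
  - by move=> t tt; apply: hu; move: tt; rewrite /m; flra.
have := @unif_rev zeta p q p m; rewrite (_ : p + q - m = m); last by rewrite /m; field.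
rewrite [p + q - p]addrAC subrr add0r; apply; first by rewrite /m; flra.
have cr := ccont_rev hz.
apply: unif_left; first by rewrite /m; flra.
- by apply: ccont_sub cr; rewrite /m; flra.
- by move=> t tt; apply: hI; move: tt; rewrite /m; flra.
- move=> t tt r; have [|||N hN] := hu (p + q - m) (p + q - t) _ _ _ r; try by (move: tt; rewrite /m; flra).
  by exists N => n Nn s ss; apply: hN => //; flra.
Qed.

(** The path retraces a lifted hair. Cutting it off below at the parameter [g t2] gives a path
    through [zeta t2] and [zeta t3] whose image stays on the hair of [F M (zeta t2)];
    [hair_stay_base] brings this down to level 0. *)
Lemma ends_comparable M zeta p q : p <= q -> ccont zeta p q ->
  (forall t, p <= t <= q -> inX (R0 + 20) (F M (zeta t))) -> inX R0 (zeta p) -> inX R0 (zeta q) ->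
  (exists2 T, 0 <= T & zeta q = Phi (zeta p) T) \/ (exists2 T, 0 <= T & zeta p = Phi (zeta q) T).
Proof.
move=> pq hz hX hp hq.
have hX0 t (tt : p <= t <= q) : inX R0 (F M (zeta t)) by apply: inX_R0_le (hX t tt).
have [s [t1 [g [l [[ss tt1] [gs rg hG] cl el hl]]]]] := hair_lift pq hz hX0.
have pp : p <= p <= q by flra. have qq : p <= q <= q by flra.
have main t2 t3 : p <= t2 <= q -> p <= t3 <= q -> inX R0 (zeta t2) -> g t2 <= g t3 ->
    exists2 T, 0 <= T & zeta t3 = Phi (zeta t2) T.
  move=> tt2 tt3 h2 hg.
  pose zt t := l (Num.max (g t) (g t2)).
  have mG t : p <= t <= q -> 0 <= Num.max (g t) (g t2) <= g t1.
    move=> tt; have /andP[g1 g2] := hG t tt; have /andP[_ g4] := hG t2 tt2.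
    by rewrite le_max ge_max g1 g2.
  have rm : rcont (fun t => Num.max (g t) (g t2)) p q.
    move=> t tt e e00; have [d d0 hd] := rg t tt e e00; exists d => // t' tt' /(hd _ tt').
    rewrite !ltr_norml !maxEle; case: ifP => /negP h4; case: ifP => /negP h5; move: h4 h5; rewrite ?negbK; clear -e00; flra.
  have -> : zeta t3 = zt t3 by rewrite /zt (max_idPl hg) -hl.
  apply: (@hair_stay_base _ a M zt (zeta t2) t2 0 p q) => //.
  - exact: (ccont_reparam cl rm mG).
  - by rewrite /zt maxxx -hl // Phi0.
  - move=> t tt; rewrite /zt el ?mG // (hl t2) // el ?hG //.
    have /andP[g2 _] := hG t2 tt2.
    have m1 : g t2 <= Num.max (g t) (g t2) by rewrite le_max lexx orbT.
    by have [S S0 ->] := Phi_shift (hX s ss) g2 m1; exists S.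
have [h|/ltW h] := leP (g p) (g q); first by left; exact: main.
by right; exact: main.
Qed.

End PathsEscapeUniformly.

(** * Baire category: from the ends of paths to all escaping paths *)

Section LocalUniformity.
Variable R : realType.
Local Notation C := R[i].
Variable a : C.
Implicit Types (z w : C) (x y t r S T e b c s p q u v : R) (k : nat -> int) (n m j M N : nat) (zeta gam xi : R -> C).

Local Notation f := (expmap a).
Local Notation F n z := (iter n (expmap a) z).
Local Notation R0 := (R0 a).
Local Notation inX := (inX a).
Local Notation addr := (addr a).
Local Notation Phi := (Phi a).
Local Notation tip := (tip a).
Local Notation unif := (unif a).

Definition lu b c gam t := exists2 d, 0 < d & forall u v, b <= u -> u <= v -> v <= c ->
  t - d < u -> v < t + d -> unif gam u v.
Definition bad b c gam t := b <= t <= c /\ ~ lu b c gam t.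

Lemma unif_of_lu b c gam : b <= c -> (forall t, b <= t <= c -> lu b c gam t) -> unif gam b c.
Proof.
move=> bc h; apply: (cousin bc) => [u v w _ _ _ _|t tt]; first exact: unif_glue.
have [d d0 hd] := h t tt; exists d => // u v bu uv vc; exact: hd.
Qed.

Lemma lu_sub b c b' c' gam t : b <= b' -> c' <= c -> lu b c gam t -> lu b' c' gam t.
Proof.
move=> bb cc [d d0 h]; exists d => // u v bu uv vc tu vt; apply: h => //; flra.
Qed.

Lemma lu_open b c gam t : lu b c gam t -> exists2 d, 0 < d & forall t', `|t' - t| < d -> lu b c gam t'.
Proof.
move=> [d d0 h]; exists (d / 2); first by flra.
move=> t'; rewrite ltr_norml => ht; exists (d / 2); first by flra.
by move=> u v bu uv vc tu vt; apply: h => //; flra.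
Qed.

Lemma lu_iter j b c gam t : lu b c (fun t => F j (gam t)) t <-> lu b c gam t.
Proof.
by split=> -[d d0 h]; exists d => // u v bu uv vc tu vt; apply/(unif_iter a j); exact: h.
Qed.

(** Compact parts of a gap of the bad set are covered by local uniformity; [unif_both] adds the two
    ends, even if these are bad. *)
Lemma unif_gap b c gam p q : ccont gam b c -> (forall t, b <= t <= c -> escaping f (gam t)) ->
  b <= p -> p < q -> q <= c -> (forall t, p < t < q -> ~ bad b c gam t) -> unif gam p q.
Proof.
move=> hg hI bp pq qc h; apply: (unif_both pq).
- exact: ccont_sub hg.
- by move=> t tt; apply: hI; flra.
move=> s t ps st tq; apply: unif_of_lu => // x xx; apply: (lu_sub (b := b) (c := c)); [flra|flra|].
apply: contrapT => hx; apply: (h x); first by flra.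
by split => //; flra.
Qed.

Lemma last_point (P : R -> Prop) (s v : R) : s <= v -> P s ->
  (forall t, s <= t <= v -> ~ P t -> exists2 d : R, 0 < d & forall t', `|t' - t| < d -> ~ P t') ->
  exists p, [/\ s <= p <= v, P p & forall t, p < t <= v -> ~ P t].
Proof.
move=> sv Ps cl; pose S := [set t | s <= t <= v /\ P t].
have Ss : S s by split; [rewrite lexx|].
have hS : has_sup S by split; [exists s|exists v => t [/andP[]]].
set p := sup S.
have sp : s <= p by apply: ub_le_sup; [exact: hS.2|].
have pv : p <= v by apply: ge_sup; [exists s|move=> t [/andP[]]].
exists p; split; first by rewrite sp.
  apply: contrapT => nP; have [|d d0 hd] := cl p _ nP; first by rewrite sp.
  have [t [/andP[st tv] Pt] pt] := sup_adherent d0 hS.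
  have tp : t <= p by apply: ub_le_sup; [exact: hS.2|split; [apply/andP|]].
  by apply: (hd t) => //; rewrite ltr_norml; move: pt; rewrite -/p; clear -tp d0; flra.
move=> t /andP[pt tv] Pt; have : t <= p.
  by apply: ub_le_sup; [exact: hS.2|split => //; apply/andP; split=> //; flra].
by flra.
Qed.

Lemma first_point (P : R -> Prop) (u s : R) : u <= s -> P s ->
  (forall t, u <= t <= s -> ~ P t -> exists2 d : R, 0 < d & forall t', `|t' - t| < d -> ~ P t') ->
  exists p, [/\ u <= p <= s, P p & forall t, u <= t < p -> ~ P t].
Proof.
move=> us Ps cl; have [|||p [pp Pp hp]] := @last_point (fun t => P (- t)) (- s) (- u).
- by flra.
- by rewrite opprK.
- move=> t tt nP; have [|d d0 hd] := cl (- t) _ nP; first by flra.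
  exists d => // t' ht; apply: hd; rewrite -opprD normrN; exact: ht.
exists (- p); split => //; first by flra.
move=> t tt; have := hp (- t); rewrite opprK; apply; flra.
Qed.

Section OnInterval.
Variables (b c : R) (xi : R -> C).
Hypothesis hxi : ccont xi b c.
Hypothesis hI : forall t, b <= t <= c -> escaping f (xi t).

Lemma bad_closed t : b <= t <= c -> ~ bad b c xi t ->
  exists2 d, 0 < d & forall t', `|t' - t| < d -> ~ bad b c xi t'.
Proof.
move=> tt nb; have /lu_open[d d0 hd] : lu b c xi t by apply: contrapT => h; apply: nb.
by exists d => // t' /hd h [_].
Qed.

Lemma nearest_bad s t : bad b c xi s -> b <= t <= c -> exists p,
  [/\ bad b c xi p, Num.min s t <= p <= Num.max s t & unif xi (Num.min p t) (Num.max p t)].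
Proof.
move=> bs tt; have sbc := bs.1; have [st|ts] := leP s t.
  have [|p [pp bp hp]] := last_point st bs.
    by move=> t' tt'; apply: bad_closed; flra.
  have /andP[sp pt] := pp.
  exists p; split => //; rewrite (min_idPl pt) (max_idPr pt).
  move: pt; rewrite le_eqVlt => /orP[/eqP ->|pt]; first by apply: unif_point; exact: hI.
  by apply: (unif_gap hxi hI) => //; [flra|flra|move=> t' tt'; apply: hp; flra].
have [|p [pp bp hp]] := first_point (ltW ts) bs.
  by move=> t' tt'; apply: bad_closed; flra.
have /andP[tp ps] := pp.
exists p; split => //; rewrite (min_idPr tp) (max_idPl tp).
move: tp; rewrite le_eqVlt => /orP[/eqP <-|tp]; first by apply: unif_point; exact: hI.
by apply: (unif_gap hxi hI) => //; [flra|flra|move=> t' tt'; apply: hp; flra].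
Qed.

Lemma gap_addr p q k : b <= p -> p <= q -> q <= c -> inX R0 (xi p) -> inX R0 (xi q) ->
  (forall t, p < t < q -> ~ bad b c xi t) -> addr k (xi p) -> addr k (xi q).
Proof.
move=> bp pq qc hp hq h; move: pq; rewrite le_eqVlt => /orP[/eqP <- //|pq] kp.
have [M hM] := unif_inX (R0 + 20) (unif_gap hxi hI bp pq qc h).
have cx : ccont xi p q by apply: ccont_sub hxi.
have [[T T0 ->]|[T T0 e]] := ends_comparable (ltW pq) cx hM hp hq; first exact: Phi_addr.
have [k' hk'] := inR0_addr hq; have := Phi_addr hq T0 hk'; rewrite -e => hk2.
by rewrite (addr_uniq kp hk2).
Qed.

Variables u v : R.
Hypothesis bu : b <= u.
Hypothesis vc : v <= c.
Hypothesis hbad : forall t, u <= t <= v -> bad b c xi t -> inX (R0 + 100) (xi t).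

Lemma bad_inR0 t : u <= t <= v -> bad b c xi t -> inX R0 (xi t).
Proof. by move=> tt /(hbad tt); apply: inX_le; flra. Qed.

(** Between bad parameters the path may leave the strips, so connectedness of the path is of no
    direct use. Across a gap of the bad set [gap_addr] transfers the itinerary, near a bad parameter
    continuity does, and [cousin] combines the two. *)
Lemma bad_strip n s t (l : int) : u <= s <= v -> u <= t <= v -> bad b c xi s -> bad b c xi t ->
  strip l (F n (xi s)) -> strip l (F n (xi t)).
Proof.
move=> ss tt bs bt; have uv : u <= v by flra.
have bu' := bu; have vc' := vc.
suff H : forall s t, u <= s <= v -> u <= t <= v -> bad b c xi s -> bad b c xi t ->
    forall l, strip l (F n (xi s)) -> strip l (F n (xi t)) by exact: H.
move=> {s t ss tt bs bt l}.
apply: (@cousin R (fun u' v' : R => forall s t, u' <= s <= v' -> u' <= t <= v' -> bad b c xi s ->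
  bad b c xi t -> forall l, strip l (F n (xi s)) -> strip l (F n (xi t))) u v uv).
  move=> u1 m v1 uu1 u1m mv1 v1v I1 I2.
  have cross s t : u1 <= s <= m -> m <= t <= v1 -> bad b c xi s -> bad b c xi t ->
      forall l, strip l (F n (xi s)) <-> strip l (F n (xi t)).
    move=> ss tt bs bt l.
    have sm : s <= m by flra. have mt : m <= t by flra.
    have [|p [pp bp hp]] := last_point sm bs.
      by move=> t' tt'; apply: bad_closed; flra.
    have [|q [qq bq hq]] := first_point mt bt.
      by move=> t' tt'; apply: bad_closed; flra.
    have ip : inX R0 (xi p) by apply: bad_inR0 => //; flra.
    have iq : inX R0 (xi q) by apply: bad_inR0 => //; flra.
    have [k kp] := inR0_addr ip.
    have kq : addr k (xi q).
      apply: (gap_addr _ _ _ ip iq _ kp); [flra|flra|flra|].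
      move=> x xx; have [xm|xm] := leP x m; first by apply: hp; flra.
      by apply: hq; flra.
    have sp l' : strip l' (F n (xi s)) <-> strip l' (F n (xi p)).
      by split; apply: I1 => //; flra.
    have qt l' : strip l' (F n (xi q)) <-> strip l' (F n (xi t)).
      by split; apply: I2 => //; flra.
    rewrite sp -qt; split=> h.
      by rewrite (strip_uniq h (kp n)); exact: kq.
    by rewrite (strip_uniq h (kq n)); exact: kp.
  move=> s t ss tt bs bt l h; have [sm|sm] := leP s m; have [tm|tm] := leP t m.
  - by apply: (I1 s t) => //; flra.
  - by rewrite -(cross s t) //; flra.
  - by rewrite (cross t s) //; flra.
  - by apply: (I2 s t) => //; flra.
move=> t tt; have [bt|nb] := pselect (bad b c xi t); last first.
  have [|d d0 hd] := bad_closed _ nb; first by flra.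
  exists d => // u1 v1 _ _ _ tu vt s t' ss _ bs; exfalso; apply: (hd s) => //.
  by rewrite ltr_norml; flra.
have [d d0 hd] := ccont_iter a n hxi (bt.1) ltr01.
exists d => // u1 v1 uu1 u1v1 v1v tu vt.
have [k kt] := inR0_addr (bad_inR0 tt bt).
have key s : u1 <= s <= v1 -> bad b c xi s -> forall l, strip l (F n (xi s)) -> l = k n.
  move=> ss bs l h; apply: (strip_close h (kt n)).
  have sd : `|s - t| < d by rewrite ltr_norml; flra.
  have := hd s bs.1 sd; have := normc_im (F n (xi s) - F n (xi t)); have := @pi_ge2 R.
  by rewrite imD imN; flra.
move=> s t' ss tt' bs bt' l h; rewrite (key s ss bs l h).
have ut' : u <= t' <= v by flra.
have [k' kt'] := inR0_addr (bad_inR0 ut' bt').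
by rewrite -(key t' tt' bt' _ (kt' n)).
Qed.

Lemma bad_addr s t k : u <= s <= v -> u <= t <= v -> bad b c xi s -> bad b c xi t ->
  addr k (xi s) -> addr k (xi t).
Proof. by move=> ss tt bs bt h n; apply: (bad_strip ss tt bs bt); exact: h. Qed.

(** All bad points on [[u, v]] share one itinerary, and each other point is joined to a bad one by a
    uniformly escaping piece of path. If [xi s] is a tip, bad points lie on its hair and such a
    piece cannot leave it. Otherwise some iterate of [xi s] lies at a positive parameter on the hair
    of some [z]; near [s] the path avoids [z], and [hair_stay_avoid] applies. *)
Lemma near_bad s : u <= s <= v -> bad b c xi s ->
  exists j, exists2 d, 0 < d & forall t, u <= t <= v -> `|t - s| < d -> inX R0 (F j (xi t)).
Proof.
have bu' := bu; have vc' := vc.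
move=> ss bs; have ys := hbad ss bs; have ys0 := bad_inR0 ss bs.
have [k ks] := inR0_addr ys0.
have locate t : u <= t <= v -> exists p, [/\ bad b c xi p, u <= p <= v,
    forall t', Num.min p t <= t' <= Num.max p t -> `|t' - s| <= `|t - s| &
    unif xi (Num.min p t) (Num.max p t)].
  move=> tt; have tbc : b <= t <= c by flra.
  have [p [bp pp hu]] := nearest_bad bs tbc; exists p; split => //.
    by move: pp; rewrite ge_min le_max => /andP[/orP[] h1 /orP[] h2]; flra.
  move=> t'; move: pp; have [st|/ltW ts] := leP s t.
    move=> /andP[sp pt]; rewrite (min_idPl pt) (max_idPr pt) => tt'.
    by rewrite !ger0_norm; flra.
  move=> /andP[tp ps]; rewrite (min_idPr tp) (max_idPl tp) => tt'.
  by rewrite !ler0_norm; flra.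
have pmm x y : Num.min x y <= x <= Num.max x y by rewrite ge_min le_max lexx.
have pmm' x y : Num.min x y <= y <= Num.max x y by rewrite ge_min le_max lexx !orbT.
have mmb p t : u <= p <= v -> u <= t <= v -> b <= Num.min p t /\ Num.max p t <= c.
  by move=> h1 h2; rewrite le_min ge_max; split; apply/andP; split; flra.
have r20 := R0_le20 a.
have [[j [z [T [hz T0 e]]]]|hno] := pselect (exists j z T, [/\ inX (R0 + 20) z, 0 < T & F j (xi s) = Phi z T]); last first.
  have tY : tip (R0 + 20) (xi s).
    move=> j z T hz T0 e; apply/eqP; rewrite eq_le T0 andbT leNgt; apply/negP => Tp.
    by apply: hno; exists j, z, T.
  exists 0%N; exists 1 => // t tt _; have [p [bp pp _ hu]] := locate t tt.
  have [M hM] := unif_inX (R0 + 20) hu.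
  have yp := hbad pp bp; have yp0 := bad_inR0 pp bp.
  have [S S0 eS] : exists2 S, 0 <= S & xi p = Phi (xi s) S.
    have [//|[S S0 eS]] := hair_cmp ys0 yp0 ks (bad_addr ss pp bs bp ks).
    have hp20 : inX (R0 + 20) (xi p) by apply: inX_le yp; flra.
    have S_0 := tY 0%N _ _ hp20 S0 eS; exists 0 => //.
    by rewrite eS S_0 !Phi0.
  have hs20 : inX (R0 + 20) (xi s) by apply: inX_le ys; flra.
  have [m1 m2] := mmb p t pp tt.
  have [S' S'0 eS'] := hair_stay_tip hs20 r20 tY (ccont_sub m1 m2 hxi) (pmm p t) S0 eS hM (pmm' p t).
  have h100 : R0 <= R0 + 100 by flra.
  by rewrite /= eS'; apply: inX_le (Phi_inX h100 ys S'0); flra.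
have hz0 : inX R0 z by apply: inX_le hz; flra.
have cj := ccont_iter a j hxi.
have [N hN] := Phi_large 100 hz0 T0; have {}hN := hN N (leqnn N); rewrite -e in hN.
have sbc : b <= s <= c by flra.
have [d1 d10 hd1] := ccont_iter a N cj sbc ltr01.
have nz : 0 < normc (z - F j (xi s)).
  apply: normc_gt0; rewrite subr_eq0; apply/eqP => ez.
  have : 0 = T by apply: (Phi_inj hz0) => //; [exact: ltW|rewrite Phi0 // {1}ez].
  by move=> T_0; rewrite -T_0 ltxx in T0.
have [d2 d20 hd2] := cj s sbc _ nz.
exists j, (Num.min d1 d2); first by rewrite lt_min d10.
move=> t tt; rewrite lt_min => /andP[t1 t2]; have [p [bp pp hp hu]] := locate t tt.
have [M hM] := unif_inX (R0 + 20) ((unif_iter a j xi _ _).2 hu).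
have yp := inX_iter j (bad_inR0 pp bp).
have kp := addr_iter j (bad_addr ss pp bs bp ks).
have [kz hkz] := inR0_addr hz0.
have kj : addr kz (F j (xi s)) by rewrite e; apply: Phi_addr => //; exact: ltW.
rewrite -(addr_uniq kj (addr_iter j ks)) in kp.
have ps := le_lt_trans (hp p (pmm p t)) t1.
have pbc : b <= p <= c by flra.
have [S S0 eS] : exists2 S, 0 <= S & F j (xi p) = Phi z S.
  have [//|hS] := hair_cmp hz0 yp hkz kp; exfalso.
  have := le_trivial yp hS N; have := hd1 p pbc ps.
  have := normc_re (F N (F j (xi p)) - F N (F j (xi s))); rewrite reD reN ler_norml.
  move: hN; flra.
have [m1 m2] := mmb p t pp tt.
have hne t' : Num.min p t <= t' <= Num.max p t -> F j (xi t') != z.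
  move=> tt'; have := hd2 t' ltac:(flra) (le_lt_trans (hp t' tt') t2).
  by apply: contraTneq => ->; rewrite ltxx.
have [S' S'0 eS'] := hair_stay_avoid hz (ccont_sub m1 m2 cj) (pmm p t) S0 eS hM hne (pmm' p t).
by rewrite eS'; apply: inX_le (Phi_inX r20 hz S'0); flra.
Qed.

End OnInterval.

(** If no iterate worked, each interval around a bad parameter would contain a smaller one, again
    around a bad parameter, on which some iterate of index at least [N] has real part below [r]. The
    point common to the nested intervals would not escape. *)
Lemma bad_baire r b c gam t0 : ccont gam b c -> (forall t, b <= t <= c -> escaping f (gam t)) ->
  bad b c gam t0 -> exists N s e, [/\ 0 < e, bad b c gam s &
    forall t, b <= t <= c -> `|t - s| < e -> bad b c gam t -> inX r (F N (gam t))].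
Proof.
move=> hg hI bt0; apply: contrapT => hno.
have step N (x : R * R) : exists x' : R * R, bad b c gam x.1 -> 0 < x.2 ->
    [/\ bad b c gam x'.1, 0 < x'.2, `|x'.1 - x.1| + x'.2 <= x.2, x'.2 <= x.2 / 2 &
     forall t, b <= t <= c -> `|t - x'.1| <= x'.2 -> exists2 m, (N <= m)%N & re (F m (gam t)) < r].
  case: x => s e /=; have [[bs e0]|h] := pselect (bad b c gam s /\ 0 < e); last first.
    by exists (s, e) => bs e0; case: h.
  have [t [tt ts bt ht]] : exists t, [/\ b <= t <= c, `|t - s| < e, bad b c gam t & ~ inX r (F N (gam t))].
    apply: contrapT => h; apply: hno; exists N, s, e; split => // t tt ts bt.
    by apply: contrapT => hi; apply: h; exists t.
  have [m hm] : exists m, re (F (m + N) (gam t)) < r.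
    apply: contrapT => h; apply: ht => m; rewrite -iter_expmapD leNgt; apply/negP => hm.
    by apply: h; exists m.
  have g0 : 0 < r - re (F (m + N) (gam t)) by flra.
  have [d d0 hd] := ccont_iter a (m + N) hg tt g0.
  pose e' := Num.min (d / 2) (Num.min (e / 2) (e - `|t - s|)).
  have e'd : e' <= d / 2 by rewrite ge_min lexx.
  have e'e : e' <= e / 2 by rewrite /e' !ge_min lexx orbT.
  have e's : e' <= e - `|t - s| by rewrite /e' !ge_min lexx !orbT.
  have e'0 : 0 < e' by rewrite !lt_min; apply/and3P; split; flra.
  exists (t, e') => _ _ /=; split => //; first by flra.
  move=> t' tt' ht'; exists (m + N)%N; first exact: leq_addl.
  have td : `|t' - t| < d by flra.
  have := hd t' tt' td; have := normc_re (F (m + N) (gam t') - F (m + N) (gam t)).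
  by rewrite reD reN ler_norml; clear; flra.
have /choice[g hg'] (Nx : nat * (R * R)) := step Nx.1 Nx.2.
pose X := fix X N := if N is M.+1 then g (M, X M) else (t0, 1).
have hX N : bad b c gam (X N).1 /\ 0 < (X N).2.
  elim: N => [|N [h1 h2]]; first by split.
  by have [] := hg' (N, X N) h1 h2.
have nest N : [/\ `|(X N.+1).1 - (X N).1| + (X N.+1).2 <= (X N).2, (X N.+1).2 <= (X N).2 / 2 &
     forall t, b <= t <= c -> `|t - (X N.+1).1| <= (X N.+1).2 -> exists2 m, (N <= m)%N & re (F m (gam t)) < r].
  by have [h1 h2] := hX N; have [] := hg' (N, X N) h1 h2.
have small N : (X N).2 <= 1 / 2 ^+ N.
  elim: N => [|N IH]; first by rewrite expr0 divr1.
  have [_ h _] := nest N.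
  have -> : 1 / 2 ^+ N.+1 = 1 / 2 ^+ N / 2 :> R by rewrite exprS; field; rewrite expf_neq0.
  flra.
have [|l hl] := @geometric_cvg R (fun N => (X N).1) 1.
  move=> N; apply: le_trans (small N); have [h _ _] := nest N; have [_] := hX N.+1; flra.
have near N m : (N <= m)%N -> `|(X m).1 - (X N).1| + (X m).2 <= (X N).2.
  elim: m => [|m IH]; first by rewrite leqn0 => /eqP ->; rewrite subrr normr0 add0r.
  rewrite leq_eqVlt => /orP[/eqP ->|]; first by rewrite subrr normr0 add0r.
  rewrite ltnS => /IH h; have [h' _ _] := nest m.
  have := ler_normD ((X m.+1).1 - (X m).1) ((X m).1 - (X N).1); rewrite addrA subrK; flra.
have tiny e : 0 < e -> exists m0, forall m, (m0 <= m)%N -> 2 * 1 / 2 ^+ m <= e :> R.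
  move=> e0; have [m0 hm0] := @pow2_gt R 2 e e0; exists m0 => m hm.
  rewrite mulr1 ler_pdivrMr ?exprn_gt0 // mulrC; apply: le_trans (ltW hm0) _.
  by rewrite ler_pM2r // pow2_le.
have lX N : `|l - (X N).1| <= (X N).2.
  apply/ler_addgt0Pr => e e0; have [m0 hm0] := tiny e e0.
  have h1 := near N (maxn N m0) (leq_maxl _ _); have h2 := hm0 (maxn N m0) (leq_maxr _ _).
  have h3 := hl (maxn N m0); have [_ h4] := hX (maxn N m0).
  have := ler_normD (l - (X (maxn N m0)).1) ((X (maxn N m0)).1 - (X N).1).
  rewrite addrA subrK (distrC l (X (maxn N m0)).1); flra.
have lbc : b <= l <= c.
  apply/andP; split; apply/ler_addgt0Pr => e e0; have [m0 hm0] := tiny e e0;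
    have := hl m0; have := hm0 m0 (leqnn _); have [[h _] _] := hX m0; rewrite ler_norml; flra.
have /escapingP/(_ r)[N hN] := hI l lbc.
have [_ _ h] := nest N; have [m Nm hm] := h l lbc (lX N.+1).
by have := hN m Nm; flra.
Qed.

(* A path in the escaping set escapes uniformly: the closed set of parameters near
   which it does not would, by Baire, contain a relatively open piece mapped into
   [inX] by one iterate, and there all points lie on one hair. *)
Lemma path_unif b c gam : b <= c -> ccont gam b c ->
  (forall t, b <= t <= c -> escaping f (gam t)) -> unif gam b c.
Proof.
move=> bc hg hI.
have [h|hno] := pselect (forall t, b <= t <= c -> lu b c gam t); first exact: unif_of_lu.
exfalso; have [t0 bt0] : exists t, bad b c gam t.
  apply: contrapT => h; apply: hno => t tt; apply: contrapT => hl; apply: h.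
  by exists t.
have [N [s [e [e0 bs hs]]]] := bad_baire (R0 + 100) hg hI bt0.
pose xi t := F N (gam t).
have cxi : ccont xi b c by exact: ccont_iter.
have hIx t : b <= t <= c -> escaping f (xi t) by move=> tt; apply/escaping_iter; exact: hI.
have badE t : bad b c xi t <-> bad b c gam t.
  by split=> -[h1 h2]; split => // h; apply: h2; apply/(lu_iter N).
pose u := Num.max b (s - e / 2); pose v := Num.min c (s + e / 2).
have bu : b <= u by rewrite le_max lexx.
have us : s - e / 2 <= u by rewrite le_max lexx orbT.
have vc : v <= c by rewrite ge_min lexx.
have vs : v <= s + e / 2 by rewrite ge_min lexx orbT.
have sbc := bs.1.
have su : u <= s by rewrite ge_max; apply/andP; split; flra.
have sv : s <= v by rewrite le_min; apply/andP; split; flra.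
have hbad t : u <= t <= v -> bad b c xi t -> inX (R0 + 100) (xi t).
  move=> tt /badE bt; apply: hs => //; first by flra.
  by rewrite ltr_norml; flra.
have suv : u <= s <= v by rewrite su.
have bs' : bad b c xi s by apply/badE.
have [j [d d0 hd]] := near_bad cxi hIx bu vc hbad suv bs'.
apply: bs'.2; exists (Num.min d (e / 2)); first by rewrite lt_min d0; flra.
move=> u' v' bu' uv' vc' hu' hv'.
have md : Num.min d (e / 2) <= d by rewrite ge_min lexx.
have me : Num.min d (e / 2) <= e / 2 by rewrite ge_min lexx orbT.
apply: (@unif_of_inX _ a j) => //.
- exact: ccont_sub cxi.
- move=> t tt; apply: hd; last by rewrite ltr_norml; flra.
  by rewrite /u /v ge_max le_min; apply/andP; split; apply/andP; split; flra.
- by move=> t tt; apply: hIx; flra.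
Qed.

End LocalUniformity.

(** * Separating tips *)

Section Connect.
Variable R : realType.
Local Notation C := R[i].
Variable a : C.
Implicit Types (z w : C) (x y t r S T e b c s p q u v : R) (k : nat -> int) (n m j N : nat) (zeta gam xi l : R -> C).

Local Notation f := (expmap a).
Local Notation F n z := (iter n (expmap a) z).
Local Notation R0 := (R0 a).
Local Notation inX := (inX a).
Local Notation addr := (addr a).
Local Notation Phi := (Phi a).
Local Notation tau := (tau a).
Local Notation tip := (tip a).
Local Notation fast := (fast a).

Lemma cluster3 (x y t : nat -> R) B : (forall n, `|x n| <= B) -> (forall n, `|y n| <= B) ->
  (forall n, `|t n| <= B) -> exists x0 y0 t0, forall e, 0 < e -> forall N, exists n,
  [/\ (N <= n)%N, `|x n - x0| < e, `|y n - y0| < e & `|t n - t0| < e].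
Proof.
move=> hx hy ht.
have hx' n : - B <= x n <= B by rewrite -ler_norml.
have [x0 [phi [_ hphi cx]]] := bolzano hx'.
have hy' n : - B <= y (phi n) <= B by rewrite -ler_norml.
have [y0 [psi [_ hpsi cy]]] := bolzano hy'.
have ht' n : - B <= t (phi (psi n)) <= B by rewrite -ler_norml.
have [t0 _ ct] := cluster_seq ht'.
exists x0, y0, t0 => e e0 N; have [K1 h1] := cx e e0; have [K2 h2] := cy e e0.
have [n hn h3] := ct e e0 (maxn N (maxn K1 K2)); move: hn; rewrite !geq_max => /and3P[n1 n2 n3].
exists (phi (psi n)); split => //.
- exact: leq_trans n1 (leq_trans (hpsi n) (hphi _)).
- by apply: h1; exact: leq_trans n2 (hpsi n).
- exact: h2.
Qed.

Lemma invS_lt (e : R) : 0 < e -> exists N, forall n, (N <= n)%N -> n.+1%:R^-1 < e.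
Proof.
move=> e0; exists (Num.truncn e^-1) => n hn; rewrite invf_plt ?posrE //.
by apply: lt_le_trans (truncnS_gt _) _; rewrite ler_nat.
Qed.

(** Compactness: hairs run to the right at nearly constant height, so for hairs through points
    tending to [Y0] the initial points and parameters stay bounded. By joint continuity of [Phi] a
    cluster point gives a hair through [Y0] that begins too far away. *)
Lemma near_tip_open (Y0 : C) (d : R) : 0 < d ->
  (forall w T, inX R0 w -> 0 <= T -> Y0 = Phi w T -> normc (Y0 - w) < d) ->
  exists2 r, 0 < r & forall Y w T, normc (Y - Y0) < r -> inX R0 w -> 0 <= T -> Y = Phi w T ->
    normc (Y - w) < 2 * d.
Proof.
move=> d0 h; apply: contrapT => hno.
have /choice[W hW] n : exists W : C * R, [/\ inX R0 W.1, 0 <= W.2,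
    normc (Phi W.1 W.2 - Y0) < n.+1%:R^-1 & 2 * d <= normc (Phi W.1 W.2 - W.1)].
  apply: contrapT => hn; apply: hno; exists n.+1%:R^-1; first by rewrite invr_gt0.
  move=> Y w T hY hw T0 e; rewrite ltNge; apply/negP => hd; apply: hn.
  by exists (w, T); rewrite /= -e.
pose B := normc Y0 + 100.
have n1 n : n.+1%:R^-1 <= 1 :> R by rewrite invf_le1 ?ltr0n // ler1n.
have R2 := R0_ge a.
have bd n : [/\ `|re (W n).1| <= B, `|im (W n).1| <= B & `|(W n).2| <= B].
  have [hw T0 h0 _] := hW n; have h1 := lt_le_trans h0 (n1 n).
  have := Phi_re 0 hw T0; have := hw 0%N.
  have := hair_imdist hw T0 (lexx 0); rewrite Phi0 //=.
  have := normc_re (Phi (W n).1 (W n).2 - Y0); have := normc_im (Phi (W n).1 (W n).2 - Y0).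
  have := normc_re Y0; have := normc_im Y0; rewrite reD imD reN imN; have := pi_lt4 R.
  rewrite /B !ler_norml !ltr_norml; move: h1 T0 R2; clear => *; split; flra.
have [n|n|n|x0 [y0 [t0 hc]]] := @cluster3 (fun n => re (W n).1) (fun n => im (W n).1) (fun n => (W n).2) B.
- by have [] := bd n.
- by have [] := bd n.
- by have [] := bd n.
pose w0 : C := x0 +i* y0.
have near e N : 0 < e -> exists n, [/\ (N <= n)%N, normc ((W n).1 - w0) < e & `|(W n).2 - t0| < e].
  move=> e0; have [|n [Nn h1 h2 h3]] := hc (e / 2) _ N; first by flra.
  exists n; split => //; last by flra.
  by apply: le_lt_trans (normc_le_reim _) _; rewrite reD imD reN imN /=; flra.
have hw0 : inX R0 w0.
  apply: inX_closed => e e0; have [n [_ hn _]] := near e 0%N e0.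
  by exists (W n).1 => //; have [] := hW n.
have t00 : 0 <= t0.
  apply/ler_addgt0Pr => e e0; have [n [_ _ hn]] := near e 0%N e0.
  by have [_ T0 _ _] := hW n; move: hn; rewrite ltr_norml; flra.
have lim e : 0 < e -> exists n, [/\ normc ((W n).1 - w0) < e,
    normc (Phi (W n).1 (W n).2 - Phi w0 t0) < e & normc (Phi (W n).1 (W n).2 - Y0) < e].
  move=> e0; have [d1 d10 hd1] := Phi_jcont hw0 t00 e0; have [N hN] := invS_lt e0.
  have [|n [Nn h1 h2]] := near (Num.min d1 e) N; first by rewrite lt_min d10.
  move: h1 h2; rewrite !lt_min => /andP[h1 h1'] /andP[h2 h2'].
  have [hw T0 h3 _] := hW n; exists n; split => //; first exact: hd1.
  exact: lt_trans h3 (hN n Nn).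
have eY : Y0 = Phi w0 t0.
  apply: eq_small => e e0; have [|n [_ h1 h2]] := lim (e / 2); first by flra.
  have := ler_normc_tri (Phi (W n).1 (W n).2) Y0 (Phi w0 t0); rewrite (normcB Y0 (Phi (W n).1 _)); flra.
have := h w0 t0 hw0 t00 eY; have [|n [h1 _ h2]] := lim (d / 4); first by flra.
have [_ _ _ h3] := hW n.
have := ler_normc_tri Y0 (Phi (W n).1 (W n).2) (W n).1; have := ler_normc_tri w0 Y0 (W n).1.
rewrite (normcB w0 (W n).1); flra.
Qed.

(** * Nested discs and stages; no hair leads from U to V *)

Section Stages.
Variables (M : nat) (U V : C -> Prop).
Hypothesis hU : forall w, U w -> exists2 r : R, 0 < r & forall z, normc (z - w) < r -> U z.
Hypothesis hV : forall w, V w -> exists2 r : R, 0 < r & forall z, normc (z - w) < r -> V z.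
Hypothesis hUV : forall w, fast (F M w) -> tip R0 (F M w) -> (U w \/ V w) /\ ~ (U w /\ V w).

Definition goodpt w := [/\ U w, fast (F M w) & tip R0 (F M w)].
(** The closure is needed because limits of good points need not be tips; they are still [fast]
    under [F M] and outside [V]. *)
Definition goodcl w := forall e, 0 < e -> exists2 z, goodpt z & normc (z - w) < e.
(* A piece of hair, lifted by [F M], from a good point to a point away from good points. *)
Definition stage l S := [/\ 0 <= S, ccont l 0 S, goodpt (l 0),
  forall u, 0 <= u <= S -> F M (l u) = Phi (F M (l 0)) u & ~ goodcl (l S)].

Lemma goodpt_cl w : goodpt w -> goodcl w.
Proof. by move=> h e e0; exists w => //; rewrite subrr normc0. Qed.

Lemma goodcl_closed w : ~ goodcl w -> exists2 r, 0 < r & forall z, normc (z - w) < r -> ~ goodcl z.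
Proof.
move=> h; have [e [e0 he]] : exists e, 0 < e /\ forall z, goodpt z -> e <= normc (z - w).
  apply: contrapT => hno; apply: h => e e0; apply: contrapT => hn; apply: hno.
  exists e; split => // z gz; rewrite leNgt; apply/negP => hz; apply: hn; by exists z.
exists (e / 2); first by flra.
move=> z hz hcl; have [|z' gz' hz'] := hcl (e / 2); first by flra.
have := he z' gz'; have := ler_normc_tri z z' w; flra.
Qed.

Lemma goodcl_fast w : goodcl w -> fast (F M w).
Proof.
move=> h; apply: fast_closed => e e0; have [d d0 hd] := cont_at_iter a M w e0.
by have [z [_ fz _] hz] := h d d0; exists (F M z) => //; exact: hd.
Qed.

Lemma goodcl_notV w : goodcl w -> ~ V w.
Proof.
move=> h /hV[r r0 hr]; have [z [Uz fz tz] hz] := h r r0.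
by have [_ []] := hUV fz tz; split => //; exact: hr.
Qed.

(** [s] is the last parameter at which [l] is a limit of good points, so an arbitrarily short piece
    beyond [l s] already ends outside [goodcl]. A good point close to [l s] begins a hair that
    follows this piece, and its lift is the new, smaller stage. *)
Lemma stage_step l S : stage l S -> exists2 s, 0 <= s <= S & goodcl (l s) /\
  forall r, 0 < r -> exists l' S', stage l' S' /\ forall u, 0 <= u <= S' -> normc (l' u - l s) < r.
Proof.
move=> [S0 cl gl el nl]; have [Ul fl tl] := gl.
have P0 : (0 <= (0 : R) <= S) /\ goodcl (l 0) by split; [rewrite lexx|exact: goodpt_cl].
have [|s [/andP[s0 sS] [_ gs] hs]] := @last_point R (fun u => (0 <= u <= S) /\ goodcl (l u)) 0 S S0 P0.
  move=> t tt nP; have [|r r0 hr] := @goodcl_closed (l t); first by move=> g; apply: nP.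
  have [d d0 hd] := cl t tt r r0; exists d => // t' ht [tt' g].
  by apply: (hr (l t')) => //; exact: hd.
have ss : 0 <= s <= S by rewrite s0.
exists s => //; split=> // r r0.
set X0 := F M (l 0) in el fl tl; set Y := F M (l s).
have eY : Y = Phi X0 s by exact: el.
have hX0 := fast_inR0 fl; have fY : fast Y by rewrite eY; exact: fast_Phi.
have hY := fast_inR0 fY.
have sltS : s < S.
  by rewrite lt_neqAle sS andbT; apply/eqP => e; apply: nl; rewrite -e.
have hX20 : inX (R0 + 20) X0 by apply: inX_le (fast_inX fl); flra.
have /choice[kap hk] T : exists u, 0 <= T -> s <= u /\ Phi Y T = Phi X0 u.
  have [T0|T0] := pselect (0 <= T); last by exists 0.
  by rewrite eY; have [u su e] := Phi_Phi hX20 s0 T0; exists u.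
have rk B : rcont kap 0 B.
  apply: (hair_coord hX0 (Phi_ccont (b := 0) (c := B) hY (lexx 0))) => t tt.
  by have [|h1 h2] := hk t; [flra|split=> //; flra].
have k0 : kap 0 = s.
  have [|h1 h2] := hk 0; first by [].
  by apply: (Phi_inj hX0) => //; [flra|rewrite -h2 Phi0].
have [d d0 hd] := cl s ss (r / 2) ltac:(flra).
have t01 : 0 <= (0 : R) <= 1 by rewrite lexx ler01.
have dS0 : 0 < Num.min d (S - s) by rewrite lt_min d0; flra.
have [d' d'0 hd'] := rk 1 0 t01 _ dS0.
pose T1 := Num.min 1 (d' / 2).
have T11 : T1 <= 1 by rewrite ge_min lexx.
have T1d : T1 <= d' / 2 by rewrite ge_min lexx orbT.
have T10 : 0 < T1 by rewrite lt_min ltr01; flra.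
have kr T : 0 <= T <= T1 -> [/\ s <= kap T, kap T <= S & `|kap T - s| < d].
  move=> TT; have := hd' T; rewrite k0 subr0 => h; have {h} : `|kap T - s| < Num.min d (S - s).
    by apply: h; [flra|rewrite ger0_norm; flra].
  rewrite lt_min => /andP[h1 h2]; have [|h3 _] := hk T; first by flra.
  by split => //; move: h2; rewrite ltr_norml; flra.
have kT1 : s < kap T1.
  have [|h1 _ _] := kr T1; first by flra.
  rewrite lt_neqAle h1 andbT; apply/eqP => e; have [|_ h2] := hk T1; first by flra.
  have : T1 = 0 by apply: (Phi_inj hY) => //; [flra|rewrite h2 -e -eY Phi0].
  flra.
pose mu T := l (kap T).
have cmu : ccont mu 0 T1.
  apply: (ccont_reparam cl (rcont_sub (lexx 0) T11 (rk 1))) => t tt.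
  by have [h1 h2 _] := kr t tt; flra.
have eMmu T : 0 <= T <= T1 -> F M (mu T) = Phi Y T.
  move=> TT; have [h1 h2 _] := kr T TT; rewrite /mu el; last by flra.
  by have [|_ ->] := hk T; first by flra.
have nmu : ~ goodcl (mu T1).
  move=> g; have [|h1 h2 _] := kr T1; first by flra.
  by apply: (hs (kap T1)); [rewrite kT1|split => //; flra].
have [e1 e10 he1] := goodcl_closed nmu.
have [r1 r10 hr1] := iter_locally_inj a M (l s).
pose e := Num.min (r / 2) (Num.min e1 (r1 / 2)).
have er : e <= r / 2 by rewrite ge_min lexx.
have ee1 : e <= e1 by rewrite /e !ge_min lexx orbT.
have er1 : e <= r1 / 2 by rewrite /e !ge_min lexx !orbT.
have e0 : 0 < e by rewrite !lt_min e10; apply/and3P; split => //; flra.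
have [d2 d20 hd2] := iter_path_perturb a M cmu e0.
have d220 : 0 < d2 / 2 by flra.
have [d3 d30 hd3] := Phi_ucont T1 hY d220.
have [d4 d40 hd4] := cont_at_iter a M (l s) d30.
have d5 : 0 < Num.min d4 (r1 / 2) by rewrite lt_min d40; flra.
have [x2 gx2 hx2] := gs _ d5; have [Ux2 fx2 tx2] := gx2.
move: hx2; rewrite lt_min => /andP[x2a x2b].
have hFx := fast_inR0 fx2.
have [||l' [cl' el' hl']] := hd2 (Phi (F M x2)).
- exact: Phi_ccont.
- move=> T TT; rewrite eMmu //; apply: le_lt_trans (_ : d2 / 2 < d2); last by flra.
  by apply: hd3 => //; exact: hd4.
have T10' : 0 <= T1 by flra.
have i0 : 0 <= (0 : R) <= T1 by rewrite lexx T10'.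
have mu0 : mu 0 = l s by rewrite /mu k0.
have l'0 : l' 0 = x2.
  apply: hr1.
  - by have := hl' 0 i0; rewrite mu0; flra.
  - by flra.
  - by rewrite el' // Phi0.
exists l', T1; split.
  split => //; first by rewrite l'0.
    by move=> u uu; rewrite l'0; exact: el'.
  by apply: he1; have := hl' T1; rewrite T10' lexx => /(_ isT); flra.
move=> u uu; have := hl' u uu; have [h1 h2 h3] := kr u uu.
have := hd (kap u) ltac:(flra) h3.
have := ler_normc_tri (mu u) (l' u) (l s); rewrite -/(mu u); flra.
Qed.

(** The oscillation bound [e] for [F M] limits how far back a hair through a point of the image of
    the stage can begin. *)
Definition disc w r e l S := [/\ stage l S, 0 < r,
  forall u, 0 <= u <= S -> normc (l u - w) < r,
  forall z z', normc (z - w) <= r -> normc (z' - w) <= r -> normc (F M z - F M z') < e & goodcl w].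

(** As [F M (l 0)] is a tip, a hair through [F M (l s)] begins on the piece between the two, whose
    image under [F M] oscillates by less than [e]. [near_tip_open] extends this to all points of a
    small disc about [l s], at the price of a factor 2. *)
Lemma disc_step w r e l S : 0 < e -> disc w r e l S -> exists w' r' l' S',
  [/\ disc w' r' (e / 2) l' S', r' <= r / 2, normc (w' - w) + r' <= r &
   forall z (v : C) T, normc (z - w') <= r' -> inX R0 v -> 0 <= T -> F M z = Phi v T -> normc (F M z - v) < 2 * e].
Proof.
move=> e0 [st r0 hr hd gw]; have [s ss [gs step]] := stage_step st.
have [S0 cl gl el nl] := st; have [Ul fl tl] := gl.
have hX0 := fast_inR0 fl.
have hX20 : inX (R0 + 20) (F M (l 0)) by apply: inX_le (fast_inX fl); flra.
have s0 : 0 <= s by flra.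
have hYt (v : C) T : inX R0 v -> 0 <= T -> F M (l s) = Phi v T -> normc (F M (l s) - v) < e.
  move=> hv T0 e'; have eY := el s ss.
  have [k kv] := inR0_addr hv; have kY := Phi_addr hv T0 kv; rewrite -e' in kY.
  have [k' kX] := inR0_addr hX0; have kY' := Phi_addr hX0 s0 kX; rewrite -eY in kY'.
  rewrite (addr_uniq kY kY') in kv.
  have [u u0 eu] : exists2 u, 0 <= u & v = Phi (F M (l 0)) u.
    have [//|[T' T'0 eT]] := hair_cmp hX0 hv kX kv.
    have T'_0 := tl 0%N _ _ hv T'0 eT; exists 0 => //.
    by rewrite Phi0 // eT T'_0 Phi0.
  have us : u <= s.
    apply: (hair_param_le hX0 u0 s0) => N; exists N => //.
    rewrite -eu -eY e'; have := Phi_re N hv T0; have := tau_ge0 N (inR0_1 hv) T0.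
    by rewrite ler_norml; flra.
  have uu : 0 <= u <= S by flra.
  by rewrite eu -el //; apply: hd; apply: ltW; apply: hr.
have [rho rho0 hrho] := near_tip_open e0 hYt.
have hm : 0 < Num.min rho (e / 4) by rewrite lt_min rho0; flra.
have [d d0 hdd] := cont_at_iter a M (l s) hm.
pose r' := Num.min (d / 2) (Num.min (r / 2) (r - normc (l s - w))).
have r'd : r' <= d / 2 by rewrite ge_min lexx.
have r'r : r' <= r / 2 by rewrite /r' !ge_min lexx orbT.
have r'w : r' <= r - normc (l s - w) by rewrite /r' !ge_min lexx !orbT.
have r'0 : 0 < r' by have hrs := hr s ss; rewrite !lt_min; apply/and3P; split; flra.
have near z : normc (z - l s) <= r' -> normc (F M z - F M (l s)) < rho /\ normc (F M z - F M (l s)) < e / 4.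
  move=> hz; have : normc (F M z - F M (l s)) < Num.min rho (e / 4) by apply: hdd; flra.
  by rewrite lt_min => /andP[].
have [l' [S' [st' hl']]] := step r' r'0.
exists (l s), r', l', S'; split => //; last 1 first.
- by move=> z v T hz hv T0 ez; apply: hrho ez => //; have [] := near z hz.
- split => // z z' /near[_ h1] /near[_ h2].
  have := ler_normc_tri (F M (l s)) (F M z) (F M z').
  rewrite (normcB (F M (l s)) (F M z')); flra.
- flra.
Qed.

Lemma disc0 l S : stage l S -> exists w r l' S', disc w r 1 l' S'.
Proof.
move=> st; have [s ss [gs step]] := stage_step st.
have e3 : 0 < 3^-1 :> R by flra.
have [d d0 hd] := cont_at_iter a M (l s) e3.
have d20 : 0 < d / 2 by flra.
have [l' [S' [st' hl']]] := step (d / 2) d20.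
exists (l s), (d / 2), l', S'; split => //.
move=> z z' hz hz'; have h1 := hd z ltac:(flra); have h2 := hd z' ltac:(flra).
have := ler_normc_tri (F M (l s)) (F M z) (F M z').
rewrite (normcB (F M (l s)) (F M z')); flra.
Qed.

(* Discs of the nested sequence shrink to a point that is again an initial point,
   hence lies in U, together with whole stages; the far ends of those stages are
   limits of good points by density, which stages forbid. *)
Lemma no_stage l S : ~ stage l S.
Proof.
move=> /disc0[w0 [r0 [l0 [S0 D0]]]].
pose st := (C * R * (R -> C) * R)%type.
pose ok n (x : st) := disc x.1.1.1 x.1.1.2 (2 ^- n) x.1.2 x.2.
have p2 n : 0 < 2 ^- n :> R by rewrite invr_gt0 exprn_gt0.
have stepx n (x : st) : exists x' : st, ok n x -> [/\ ok n.+1 x', x'.1.1.2 <= x.1.1.2 / 2,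
    normc (x'.1.1.1 - x.1.1.1) + x'.1.1.2 <= x.1.1.2 &
    forall z (v : C) T, normc (z - x'.1.1.1) <= x'.1.1.2 -> inX R0 v -> 0 <= T -> F M z = Phi v T ->
      normc (F M z - v) < 2 * 2 ^- n].
  have [ox|nx] := pselect (ok n x); last by exists x.
  have [w' [r' [l' [S' [h1 h2 h3 h4]]]]] := disc_step (p2 n) ox.
  exists (w', r', l', S') => _; split => //; rewrite /ok /=.
  by rewrite (_ : 2 ^- n.+1 = 2 ^- n / 2) // exprS invfM mulrC.
have /choice[g hg] (nx : nat * st) := stepx nx.1 nx.2.
pose X := fix X n := if n is m.+1 then g (m, X m) else (w0, r0, l0, S0).
have oX n : ok n (X n).
  elim: n => [|n IH]; first by rewrite /ok /= expr0 invr1.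
  by have [] := hg (n, X n) IH.
have hX n := hg (n, X n) (oX n).
pose ww n := (X n).1.1.1; pose rr n := (X n).1.1.2.
have rr0 n : 0 < rr n by have [] := oX n.
have rrS n : rr n.+1 <= rr n / 2 by have [] := hX n.
have nest n : normc (ww n.+1 - ww n) + rr n.+1 <= rr n by have [] := hX n.
have small n : rr n <= r0 / 2 ^+ n.
  elim: n => [|n IH]; first by rewrite expr0 divr1.
  have -> : r0 / 2 ^+ n.+1 = r0 / 2 ^+ n / 2 by rewrite exprS; field; rewrite expf_neq0.
  have := rrS n; flra.
have [n|z hz] := @geometric_cvgC R ww r0.
  by have := nest n; have := small n; have := rr0 n.+1; flra.
have near n m : (n <= m)%N -> normc (ww m - ww n) + rr m <= rr n.
  elim: m => [|m IH]; first by rewrite leqn0 => /eqP ->; rewrite subrr normc0 add0r.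
  rewrite leq_eqVlt => /orP[/eqP ->|]; first by rewrite subrr normc0 add0r.
  rewrite ltnS => /IH h; have h' := nest m.
  have := ler_normc_tri (ww m) (ww m.+1) (ww n); flra.
have r00 : 0 < r0 by exact: (rr0 0%N).
have tiny e : 0 < e -> exists m0, forall m, (m0 <= m)%N -> 4 * r0 / 2 ^+ m <= e.
  move=> e0; have [m0 hm0] := @pow2_gt R (4 * r0) e e0; exists m0 => m hm.
  rewrite ler_pdivrMr ?exprn_gt0 // (mulrC e); apply: le_trans (ltW hm0) _.
  by rewrite ler_pM2r // pow2_le.
have zX n : normc (z - ww n) <= rr n.
  apply/ler_addgt0Pr => e e0; have [m0 hm0] := tiny e e0.
  have h1 := near n (maxn n m0) (leq_maxl _ _); have h2 := hm0 (maxn n m0) (leq_maxr _ _).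
  have h3 := hz (maxn n m0); have h4 := rr0 (maxn n m0).
  have := ler_normc_tri (ww (maxn n m0)) z (ww n).
  rewrite (normcB z (ww (maxn n m0))); flra.
have rsmall e : 0 < e -> exists n, 4 * rr n <= e.
  move=> e0; have [m0 hm0] := tiny e e0; exists m0; have := hm0 m0 (leqnn _); have := small m0; flra.
have gz : goodcl z.
  move=> e e0; have [n hn] := rsmall e e0.
  have [_ _ _ _ gw] := oX n; have [y gy hy] := gw _ (rr0 n); exists y => //.
  have := ler_normc_tri (ww n) y z; rewrite (normcB (ww n) z); have := zX n; have := rr0 n.
  rewrite -/(ww n) in hy *; flra.
have fz := goodcl_fast gz; have hz0 := fast_inR0 fz.
(* [z] lies in every disc, so a hair through [F M z] begins within [2 * 2 ^- n] of it for all [n],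
   that is, at [F M z] itself. *)
have tz : tip R0 (F M z).
  apply: fast_tip => // v T hv T0 e.
  have ev : F M z = v.
    apply: eq_small => d d0; have [n hn] := @pow2_gt R 2 d d0.
    have [_ _ _ h] := hX n; have := h z v T (zX n.+1) hv T0 e.
    have p := p2 n; have : 2 * 2 ^- n <= d.
      by rewrite ler_pdivrMr ?exprn_gt0 // mulrC ltW.
    flra.
  apply/esym/(Phi_inj hv (lexx 0) T0); rewrite Phi0 //; rewrite -e; exact: esym.
have [Uz|Vz] := (hUV fz tz).1; last exact: (goodcl_notV gz Vz).
have [rU rU0 hrU] := hU Uz; have [n hn] := rsmall rU rU0.
have [[S1 cl gl el nl] _ hr _ _] := oX n; set l1 := (X n).1.2 in cl gl el nl hr; set S2 := (X n).2 in S1 cl el nl hr.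
have [Ul fl tl] := gl.
(* A stage of length zero would end at its own good initial point; [fast_tips_dense] needs a
   positive parameter. *)
have S2p : 0 < S2.
  by rewrite lt_neqAle S1 andbT; apply/eqP => e; apply: nl; rewrite -e; exact: goodpt_cl.
have SS : 0 <= S2 <= S2 by rewrite S1 lexx.
have Unear (y : C) : normc (y - ww n) < 2 * rr n -> U y.
  move=> hy; apply: hrU; have := ler_normc_tri (ww n) y z; have := zX n; have := rr0 n.
  rewrite (normcB (ww n) z); flra.
apply: nl => e e0.
have e'0 : 0 < Num.min e (rr n) by rewrite lt_min e0 rr0.
have [d d0 hd] := iter_open a M (l1 S2) e'0.
have [b [fb tb hb]] := fast_tips_dense fl S2p d0.
rewrite -el // in hb.
have [y hy ey] := hd b hb; move: hy; rewrite lt_min => /andP[hy1 hy2].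
exists y => //; split; rewrite ?ey //; apply: Unear.
have := hr S2 SS; have := ler_normc_tri (l1 S2) y (ww n); rewrite -/(ww n) -/(rr n); flra.
Qed.

Lemma no_fast_hair l S w : 0 <= S -> ccont l 0 S -> fast w -> tip R0 w ->
  (forall u, 0 <= u <= S -> F M (l u) = Phi w u) -> U (l 0) -> ~ V (l S).
Proof.
move=> S0 cl fw tw el Ul Vl.
have e0 : F M (l 0) = w by rewrite el ?lexx // Phi0 //; exact: fast_inR0.
apply: (@no_stage l S); split => //.
- by split; rewrite ?e0.
- by rewrite e0.
- by move/goodcl_notV.
Qed.

End Stages.

Lemma tau_inverse n w S : inX 1 w -> 0 <= S -> exists sg : R -> R, [/\ rcont sg 0 (tau n w S),
  sg 0 = 0, sg (tau n w S) = S & forall T, 0 <= T <= tau n w S -> 0 <= sg T <= S /\ tau n w (sg T) = T].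
Proof.
move=> hw S0.
have /choice[sg hs] T : exists u, 0 <= T -> 0 <= u /\ tau n w u = T.
  have [T0|T0] := pselect (0 <= T); last by exists 0.
  by have [u u0 eu] := tau_surj n hw T0; exists u.
have p1 : 1 <= 2 ^+ n :> R by rewrite exprn_ege1 //; flra.
have ex u u' : 0 <= u -> u <= u' -> u' - u <= tau n w u' - tau n w u.
  by move=> u0 uu; have [h _] := tau_expand n hw u0 uu; nra.
have inj u u' : 0 <= u -> 0 <= u' -> tau n w u = tau n w u' -> u = u'.
  move=> u0 u'0 e; have [h|/ltW h] := leP u u'.
    by have := ex _ _ u0 h; flra.
  by have := ex _ _ u'0 h; flra.
have tS := tau_ge0 n hw S0.
exists sg; split.
- apply: (@rcont_lip _ _ _ _ 1) => // t t' tt tt'; rewrite mul1r.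
  have [|u0 eu] := hs t; first by flra. have [|u'0 eu'] := hs t'; first by flra.
  have [h|/ltW h] := leP (sg t) (sg t').
    have := ex _ _ u0 h; rewrite eu eu' => h2; rewrite ler0_norm ?ler0_norm; flra.
  have := ex _ _ u'0 h; rewrite eu eu' => h2; rewrite ger0_norm ?ger0_norm; flra.
- by have [|u0 eu] := hs 0; [|apply: inj => //; rewrite eu tau0].
- by have [|u0 eu] := hs (tau n w S); [|apply: inj].
move=> T /andP[T0 TS]; have [//|u0 eu] := hs T; split=> //; rewrite u0 /= leNgt; apply/negP => h.
by have := ex _ _ S0 (ltW h); rewrite eu; flra.
Qed.

(** Pulled-back points stay within 40 of the orbit of [u], so a margin of 200 keeps them beyond the
    threshold 144 for contraction. *)
Lemma pullback_near n (u v : C) k : inX (normc a + 200) u -> addr k u -> normc (v - F n u) <= 40 ->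
  exists w, [/\ F n w = v, forall j, (j <= n)%N -> normc (F j w - F j u) <= 40 &
    16 ^+ n * normc (w - u) <= 40].
Proof.
elim: n u k => [|n IH] u k hu ku hv.
  exists v; split => //; last by rewrite expr0 mul1r.
  by move=> j; rewrite leqn0 => /eqP ->.
have hfu : inX (normc a + 200) (f u) by exact: (inX_iter 1 hu).
have kfu : addr (fun j => k (j + 1)%N) (f u) by exact: (addr_iter 1 ku).
have hv' : normc (v - F n (f u)) <= 40 by rewrite -iter_expmapS.
have [w1 [ew1 hw1 h16]] := IH (f u) _ hfu kfu hv'.
have c1 := hw1 0%N (leq0n _); rewrite /= in c1.
have r1 : normc a + 144 <= re w1.
  by have := hfu 0%N; have := normc_re (w1 - f u); rewrite reD reN ler_norml /=; flra.
have r2 : normc a + 144 <= re (f u) by have := hfu 0%N; rewrite /=; flra.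
have hra := re_a_le a.
have eu : u = Log (f u - a) + ipi R (k 0%N).
  by apply: Log_branch; [exact: ku 0%N|rewrite [re _]reD reN; flra].
have fw : f (Log (w1 - a) + ipi R (k 0%N)) = w1 by apply: expmap_branch; rewrite reD reN; flra.
have hd : normc (Log (w1 - a) + ipi R (k 0%N) - u) <= normc (w1 - f u) / 16.
  have -> : Log (w1 - a) + ipi R (k 0%N) - u = Log (w1 - a) - Log (f u - a) by rewrite {1}eu; ring.
  exact: branch_lip.
exists (Log (w1 - a) + ipi R (k 0%N)); split.
- by rewrite iter_expmapS fw.
- case=> [_|j]; first by rewrite /=; flra.
  by rewrite ltnS !iter_expmapS fw; exact: hw1.
rewrite exprS; set q := 16 ^+ n in h16 *.
have q0 : 0 <= q by rewrite exprn_ge0.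
have := ler_wpM2l q0 hd; flra.
Qed.

(** The hair of an arbitrary [w] is replaced by that of a fast tip: at a high level [n] such a tip
    [b] near [F n w] is pulled back to [e1] near [w]. The hair of [e1] follows that of [w] on
    [[0, S]] and lifts to a path near [l], with ends still in [U] and [V]. At level [n + N] this
    path is the hair of [b], up to the reparametrisation by the inverse of [tau]. *)
Lemma no_hair (U V : C -> Prop) N l S w :
  (forall w, U w -> exists2 r : R, 0 < r & forall z, normc (z - w) < r -> U z) ->
  (forall w, V w -> exists2 r : R, 0 < r & forall z, normc (z - w) < r -> V z) ->
  (forall M w, fast (F M w) -> tip R0 (F M w) -> (U w \/ V w) /\ ~ (U w /\ V w)) ->
  0 <= S -> ccont l 0 S -> inX (R0 + 100) w -> escaping f w ->
  (forall u, 0 <= u <= S -> F N (l u) = Phi w u) -> U (l 0) -> ~ V (l S).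
Proof.
move=> hU hV hUV S0 cl hw ew el Ul Vl.
have [rU rU0 hrU] := hU _ Ul; have [rV rV0 hrV] := hV _ Vl.
have hw0 : inX R0 w by apply: inX_le hw; flra.
have [k kw] := inR0_addr hw0.
pose e := Num.min rU rV; have e0 : 0 < e by rewrite lt_min rU0.
have eU : e <= rU by rewrite ge_min lexx.
have eV : e <= rV by rewrite ge_min lexx orbT.
have [d d0 hd] := iter_path_perturb a N cl e0.
have d20 : 0 < d / 2 by flra.
have [d1 d10 hd1] := Phi_ucont S hw0 d20.
have [n1 hn1] := pow16_gt 40 d10.
have /escapingP/(_ (R0 + 300))[n2 hn2] := ew.
pose n := maxn n1 n2.
have [b [fb sb xb tb]] := fast_guided (k n) (hn2 n (leq_maxr _ _)).
have hb : normc (b - F n w) <= 40.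
  apply: le_trans (normc_le_reim _) _; rewrite reD reN imD imN.
  have := strip_dist sb (kw n); have := pi_lt4 R; flra.
have R2 := R0_ge a; have R3 := R0E a; have A1 := A0_ge0 a.
have [|e1 [ee1 he1 h16]] := pullback_near _ kw hb; first by apply: inX_le hw; flra.
have he1X : inX R0 e1.
  move=> j; have [jn|nj] := leqP j n.
    by have := he1 j jn; have := hw j; have := normc_re (F j e1 - F j w); rewrite reD reN ler_norml; flra.
  by have := fast_inR0 fb (j - n)%N; rewrite -ee1 -iter_expmapD subnK // ltnW.
have he1w : normc (e1 - w) < d1.
  rewrite -(@ltr_pM2l _ (16 ^+ n)) ?exprn_gt0 //; apply: le_lt_trans h16 (lt_le_trans hn1 _).
  by rewrite ler_pM2r // pow16_mono // leq_maxl.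
have hclose T : 0 <= T <= S -> normc (Phi e1 T - F N (l T)) < d.
  move=> TS; rewrite el //; apply: le_lt_trans (_ : d / 2 < d); last by flra.
  exact: hd1.
have [l' [cl' el' hl']] := hd _ (Phi_ccont he1X (lexx 0)) hclose.
have [sg [rs s0 sS hs]] := tau_inverse n (inR0_1 he1X) S0.
have tS := tau_ge0 n (inR0_1 he1X) S0.
have c'' : ccont (fun T => l' (sg T)) 0 (tau n e1 S).
  by apply: (ccont_reparam cl' rs) => t /hs[].
have i0 : 0 <= (0 : R) <= S by rewrite lexx.
have iS : 0 <= S <= S by rewrite lexx S0.
apply: (@no_fast_hair (n + N) U V hU hV (hUV (n + N)%N) (fun T => l' (sg T)) (tau n e1 S) b tS c'' fb tb).
- move=> T TT; have [h1 h2] := hs T TT; rewrite iter_expmapD el' // Phi_iter //; last by flra.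
  by rewrite ee1 h2.
- by rewrite s0; apply: hrU; have := hl' 0 i0; flra.
- by rewrite sS; apply: hrV; have := hl' S iS; flra.
Qed.

End Connect.

(** * Endpoints and the Julia set *)

Section Bridge.
Variable R : realType.
Local Notation C := R[i].
Implicit Types (z w : C) (x y t r e b c : R).

Lemma pos_complex (e : C) : 0 < e -> 0 < re e /\ e = (re e)%:C.
Proof. by case: e => x y; rewrite ltcE /= => /andP[/eqP -> h]. Qed.

Lemma normr_normc z : `|z| = (normc z)%:C. Proof. by []. Qed.

Lemma ball_normc w z e : ball w e%:C z <-> normc (z - w) < e.
Proof. by rewrite -ball_normE /= normr_normc ltcR normcB. Qed.

Lemma nbhs_normc w (P : set C) :
  nbhs w P <-> exists2 r : R, 0 < r & forall z, normc (z - w) < r -> P z.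
Proof.
split.
  move=> /nbhs_ballP[e /= e0 h]; have [r0 er] := pos_complex e0.
  by exists (re e) => // z hz; apply: h; rewrite er; exact/ball_normc.
move=> [r r0 h]; apply/nbhs_ballP; exists (r%:C) => /=; first by rewrite ltcR.
by move=> z /ball_normc; exact: h.
Qed.

Lemma open_normc (U : set C) : open U ->
  forall w, U w -> exists2 r : R, 0 < r & forall z, normc (z - w) < r -> U z.
Proof. by move=> oU w Uw; apply/nbhs_normc; exact: open_nbhs_nbhs. Qed.

Lemma within_ccont (gam : R -> C) b c : {within `[b, c], continuous gam} <-> ccont gam b c.
Proof.
split.
  move=> /subspace_continuousP h t tt e e0.
  have ht : [set` `[b, c]] t by rewrite /= in_itv.
  have hP : nbhs (gam t) [set z | normc (z - gam t) < e] by apply/nbhs_normc; exists e.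
  have /nbhs_ballP[d /= d0 hd] : nbhs t [set x | [set` `[b, c]] x -> normc (gam x - gam t) < e].
    exact: h t ht _ hP.
  exists d => // t' tt' td; apply: hd; last by rewrite /= in_itv.
  by rewrite -ball_normE /= distrC.
move=> h; apply/subspace_continuousP => t; rewrite /= in_itv /= => tt P /nbhs_normc[r r0 hr].
have [d d0 hd] := h t tt r r0.
suff : nbhs t [set x | [set` `[b, c]] x -> P (gam x)] by [].
apply/nbhs_ballP; exists d => //= t'.
rewrite -ball_normE /= => td; rewrite in_itv /= => tt'; apply: hr; apply: hd => //.
by rewrite distrC.
Qed.

(** The quotient [q] lies between 0 and 1, where it is the sine of its own arcsine, and the sine is
    1-Lipschitz. *)
Lemma chord_le_spherical_dist z w :
  2 * (normc (z - w) / (Num.sqrt (1 + normc z ^+ 2) * Num.sqrt (1 + normc w ^+ 2))) <= spherical_dist z w.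
Proof.
rewrite /spherical_dist; set q := normc _ / _; rewrite ler_pM2l //.
have s0 v : 0 < Num.sqrt (1 + normc v ^+ 2) by rewrite sqrtr_gt0; have := sqr_ge0 (normc v); flra.
have s2 v : Num.sqrt (1 + normc v ^+ 2) ^+ 2 = 1 + normc v ^+ 2.
  by rewrite sqr_sqrtr //; have := sqr_ge0 (normc v); flra.
have q0 : 0 <= q by rewrite divr_ge0 ?normc_ge0 // mulr_ge0 // ltW ?s0.
have q1 : q <= 1.
  rewrite /q ler_pdivrMr ?mulr_gt0 ?s0 // mul1r.
  rewrite -(@ler_pXn2r _ 2) ?nnegrE ?normc_ge0 ?mulr_ge0 ?sqrtr_ge0 // exprMn !s2.
  have := ler_normcB z w; have := normc_ge0 (z - w); set d := normc (z - w).
  have := normc_ge0 z; have := normc_ge0 w; set x := normc z; set y := normc w.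
  move=> y0 x0 d0 h; apply: le_trans (_ : (x + y) ^+ 2 <= _).
    by rewrite ler_pXn2r ?nnegrE //; flra.
  have := sqr_ge0 (1 - x * y); flra.
have h : sin (asin q) = q by rewrite asinK // in_itv /= q1; flra.
rewrite -{1}h; apply: le_trans (ler_norm _) _.
have := sin_lip (asin q) 0; rewrite sin0 !subr0 => /le_trans -> //.
rewrite ger0_norm // leNgt; apply/negP => a0.
have : sin (asin q) < sin 0.
  rewrite ltr_sin ?in_itv //=; have := @pi_gt0 R; have := asin_geNpi2 (x := q); flra.
by rewrite h sin0; flra.
Qed.

End Bridge.

(** * Tips are escaping endpoints, and escaping points lie in the Julia set *)

Section Endpoints.
Variable R : realType.
Local Notation C := R[i].
Variable a : C.
Implicit Types (z w : C) (x y t r S T e b c s p q u v : R) (k : nat -> int) (n m j N M : nat) (zeta gam l : R -> C).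

Local Notation f := (expmap a).
Local Notation F n z := (iter n (expmap a) z).
Local Notation R0 := (R0 a).
Local Notation inX := (inX a).
Local Notation Phi := (Phi a).
Local Notation tip := (tip a).
Local Notation fast := (fast a).

(** Only a short initial piece is claimed to lift: an intermediate lift may run into [a], which [f]
    omits. *)
Lemma small_lift M (p : R -> C) w : ccont p 0 1 -> p 0 = F M w ->
  exists2 e, 0 < e <= 1 & exists l, [/\ ccont l 0 e, l 0 = w &
    forall T, 0 <= T <= e -> F M (l T) = p T].
Proof.
move=> cp; elim: M w => [|M IH] w ep.
  by exists 1; [rewrite ltr01 lexx|exists p].
have [|e /andP[e0 e1] [l [cl l0 el]]] := IH (f w); first by rewrite -iter_expmapS.
have i0 : 0 <= (0 : R) <= e by rewrite lexx ltW.
have n0 : 0 < normc (l 0 - a) by apply: normc_gt0; rewrite l0 expmapBa cexp_neq0.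
have [d d0 hd] := cl 0 i0 _ n0.
pose e' := Num.min e (d / 2).
have e'0 : 0 < e' by rewrite lt_min e0; flra.
have e'e : e' <= e by rewrite ge_min lexx.
have e'd : e' <= d / 2 by rewrite ge_min lexx orbT.
have cla : ccont (fun t => l t - a) 0 e'.
  by apply: ccontB; [apply: ccont_sub cl|exact: ccont_cst].
have na t : 0 <= t <= e' -> l t - a != 0.
  move=> tt; apply/eqP => h; have := hd t ltac:(flra).
  rewrite subr0 ger0_norm; last by flra.
  have -> : l t - l 0 = - (l 0 - a) by rewrite -[l t](subrK a) h; ring.
  by rewrite normcN ltxx => /(_ ltac:(flra)).
have [|l' [cl' l'0 el']] := exp_lift (ltW e'0) cla na (w0 := w).
  by rewrite l0 expmapBa.
exists e'; first by rewrite e'0 (le_trans e'e).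
exists l'; split => // T TT; rewrite iter_expmapS /expmap el' // subrK; apply: el; flra.
Qed.

(** By uniform escape an iterate maps an arc through [w] into a hair. The parameter [g] on that hair
    is injective along the arc, and it vanishes at time 0 because [w] comes from a tip; but then
    both halves of the arc take the same small positive values of [g]. *)
Lemma tip_not_on_hair M w : inX (R0 + 20) (F M w) -> tip R0 (F M w) -> ~ on_hair f w.
Proof.
move=> hX tw [gam [[/within_ccont cg inj] hI g0]].
have m1 : (- 1 : R) <= 1 by flra.
have [M' hM'] := unif_inX R0 (path_unif m1 cg hI).
have hM t : - 1 <= t <= 1 -> inX R0 (F (M + M') (gam t)).
  by move=> tt; rewrite iter_expmapD; exact: inX_iter (hM' t tt).
have [s [t1 [g [l [[ss tt1] [gs rg hG] cl el hl]]]]] := hair_lift m1 cg hM.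
have i0 : - 1 <= (0 : R) <= 1 by flra.
have g00 : g 0 = 0.
  have e : F (M + M') (gam 0) = Phi (F (M + M') (gam s)) (g 0) by rewrite hl // el // hG.
  have hg : 0 <= g 0 by have := hG 0 i0; flra.
  by apply: (tw M' _ _ (hM s ss) hg); rewrite -e g0 addnC iter_expmapD.
have injg x y : - 1 <= x <= 1 -> - 1 <= y <= 1 -> g x = g y -> x = y.
  by move=> xx yy h; apply: inj; rewrite ?inE /= ?in_itv // hl // h -hl.
have gpos x : - 1 <= x <= 1 -> x != 0 -> 0 < g x.
  move=> xx x0; rewrite lt_neqAle eq_sym; have /andP[-> _] := hG x xx; rewrite andbT.
  by apply: contra x0 => /eqP h; apply/eqP; apply: injg => //; rewrite g00.
have im1 : - 1 <= (- 1 : R) <= 1 by flra. have i1 : - 1 <= (1 : R) <= 1 by flra.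
pose m := Num.min (g (- 1)) (g 1).
have mp : 0 < m by rewrite lt_min !gpos //; apply/eqP; flra.
have ml : m <= g (- 1) by rewrite ge_min lexx. have mr : m <= g 1 by rewrite ge_min lexx orbT.
have [|x /andP[_ xx] ex] := @rIVT R g (- 1) 1 0 (- 1) m rg i0 im1; first by rewrite g00 ml ltW.
have [|y /andP[_ yy] ey] := @rIVT R g (- 1) 1 0 1 m rg i0 i1; first by rewrite g00 mr ltW.
have h01 : (- 1 : R) <= 0 by flra. have h10 : (0 : R) <= 1 by flra.
rewrite (min_idPr h01) (max_idPl h01) in xx; rewrite (min_idPl h10) (max_idPr h10) in yy.
have xy : x = y by apply: injg; [flra|flra|rewrite ex ey].
have x0 : x = 0 by flra.
by rewrite x0 g00 in ex; rewrite -ex ltxx in mp.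
Qed.

Lemma tip_endpoint M w : fast (F M w) -> tip R0 (F M w) -> escaping_endpoints f w.
Proof.
move=> fw tw; have hX := fast_inX20 fw; have hX0 := fast_inR0 fw.
have ew := fast_escaping fw; split; last by apply/(escaping_iter a M).
split; first exact: tip_not_on_hair hX tw.
have [|e /andP[e0 e1] [l [cl l0 el]]] := small_lift (Phi_ccont (c := 1) hX0 (lexx 0)) (w := w) (M := M).
  by rewrite Phi0.
have et t : 0 <= t <= 1 -> 0 <= e * t <= e.
  by move=> /andP[t0 t1]; rewrite mulr_ge0 ?(ltW e0) // ler_piMr // ltW.
exists (fun t => l (e * t)); split; last 1 first.
- move=> t /andP[t0 t1]; apply/(escaping_iter a M); rewrite el; last by apply: et; rewrite ltW.
  by apply: escaping_Phi => //; rewrite mulr_ge0 ?ltW.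
- split.
    apply/within_ccont; apply: (ccont_reparam (x := fun t => e * t) cl _ et).
    by apply: (rcont_ext _ (@rcont_affine R e 0 _ _)) => t _ /=; ring.
  move=> x y; rewrite !inE /= !in_itv /= => xx yy h.
  have hx := et x xx; have hy := et y yy.
  have : e * x = e * y.
    apply: (Phi_inj hX0); [flra|flra|by rewrite -!el // h].
  by apply: mulfI; rewrite gt_eqF.
- by rewrite mulr0.
Qed.

(** Arbitrarily close to [z] there are points whose orbit, at some late time, has the same real part
    as that of [z] but height pi modulo 2 pi. The next image is far to the left and the one after it
    within 1 of [a], while the orbit of [z] has modulus at least [R0]. The distance [e] fits a point
    of modulus at most [1 + normc a] and one of modulus at least [R0]. *)
Lemma escaping_julia z : escaping f z -> julia f z.
Proof.
move=> ez heq.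
have A1 := A0_ge0 a; have R2 := R0_ge a; have R3 := R0E a; have hra := re_a_le a.
pose e := (2 + normc a)^-1; have e0 : 0 < e by rewrite invr_gt0; flra.
have /nbhs_normc[r r0 hr] := heq e e0.
have [N hN] := escaping_inX R0 ez; set y := F N z in hN.
have [d d0 hd] := iter_open a N z r0.
have [n hn] := pow16_gt 40 d0.
have [k ky] := inR0_addr hN.
have [l hl] := near_2pin (im (F n y) - pi); set un := F n y in hl.
pose v : C := re un +i* (pi + twopi R * l%:~R).
have hv : normc (v - un) <= 40.
  apply: le_trans (normc_le_reim _) _; rewrite reD imD reN imN /= subrr normr0 add0r.
  move: hl; rewrite !ler_norml; have := pi_lt4 R; flra.
have [|w' [ew' _ h16]] := pullback_near _ ky hv; first by apply: inX_le hN; flra.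
have hw' : normc (w' - y) < d.
  by rewrite -(@ltr_pM2l _ (16 ^+ n)) ?exprn_gt0 //; exact: le_lt_trans h16 hn.
have [w hw ew] := hd w' hw'.
have {hr} := hr w hw (n.+2 + N)%N.
have -> : F (n.+2 + N) w = f (f v) by rewrite iter_expmapD ew [F n.+2 w']/= ew'.
have -> : F (n.+2 + N) z = F n.+2 y by rewrite iter_expmapD.
have hfv : re (f v) <= 0.
  have -> : re (f v) = re a - expR (re un).
    rewrite /expmap reD [re (cexp _)]/= cos_2pin cospi; ring.
  by have := hN n; rewrite -/un; have := expR_ge1Dx (re un); flra.
have hff : normc (f (f v)) <= 1 + normc a.
  have := @ler_normcD R (f (f v) - a) a; rewrite subrK normc_expmapBa.
  have : expR (re (f v)) <= expR 0 by rewrite ler_expR.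
  by rewrite expR0; flra.
set p := f (f v) in hff *; set q := F n.+2 y.
have hq : R0 <= normc q by apply: le_trans (hN n.+2) (le_trans (ler_norm _) (normc_re _)).
have sqle (u : C) : Num.sqrt (1 + normc u ^+ 2) <= 1 + normc u.
  rewrite -(@ler_pXn2r _ 2) ?nnegrE ?sqrtr_ge0 ?addr_ge0 ?normc_ge0 //.
  rewrite sqr_sqrtr; last by have := sqr_ge0 (normc u); flra.
  have := normc_ge0 u; flra.
have s0 (u : C) : 0 < Num.sqrt (1 + normc u ^+ 2).
  by rewrite sqrtr_gt0; have := sqr_ge0 (normc u); flra.
have := chord_le_spherical_dist p q; move=> h1 h2.
have {h1 h2} : 2 * (normc (p - q) / (Num.sqrt (1 + normc p ^+ 2) * Num.sqrt (1 + normc q ^+ 2))) < e.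
  exact: le_lt_trans h1 h2.
rewrite mulrA ltr_pdivrMr ?mulr_gt0 ?s0 // /e -ltr_pdivrMl ?invr_gt0; last by flra.
rewrite invrK => h.
have h3 : Num.sqrt (1 + normc p ^+ 2) * Num.sqrt (1 + normc q ^+ 2) <= (2 + normc a) * (1 + normc q).
  by apply: ler_pM; rewrite ?sqrtr_ge0 //; have := sqle p; flra.
have h4 : normc q - normc p <= normc (p - q).
  by have := ler_normc_dist q p; rewrite (normcB q p) ler_norml; flra.
have : (2 + normc a) * (2 * normc (p - q)) < (2 + normc a) * (1 + normc q) by flra.
rewrite ltr_pM2l; flra.
Qed.

(** The hair is given the new initial point [Phi w b]; [kap] translates its parameters, and
    [hair_param_le] confines them to [[b, c]]. *)
Lemma no_hair_between (U V : C -> Prop) N l G w b c :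
  (forall w, U w -> exists2 r : R, 0 < r & forall z, normc (z - w) < r -> U z) ->
  (forall w, V w -> exists2 r : R, 0 < r & forall z, normc (z - w) < r -> V z) ->
  (forall M w, fast (F M w) -> tip R0 (F M w) -> (U w \/ V w) /\ ~ (U w /\ V w)) ->
  0 <= b -> b <= c -> c <= G -> ccont l 0 G -> inX (R0 + 120) w -> escaping f w ->
  (forall u, 0 <= u <= G -> F N (l u) = Phi w u) -> U (l b) -> ~ V (l c).
Proof.
move=> hU hV hUV b0 bc cG cl hw ew el Ub Vc.
have hw0 : inX R0 w by apply: inX_le hw; flra.
have hw20 : inX (R0 + 20) w by apply: inX_le hw; flra.
have r120 : R0 <= R0 + 120 by flra.
have hw' : inX (R0 + 110) (Phi w b) by apply: inX_le (Phi_inX r120 hw b0); flra.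
have hw'0 : inX R0 (Phi w b) by apply: inX_le hw'; flra.
have [T1 T10 eT1] := Phi_shift hw20 b0 bc.
have /choice[kap hk] T : exists u, 0 <= T -> b <= u /\ Phi (Phi w b) T = Phi w u.
  have [T0|T0] := pselect (0 <= T); last by exists 0.
  by have [u su e] := Phi_Phi hw20 b0 T0; exists u.
have rk : rcont kap 0 T1.
  apply: (hair_coord hw0 (Phi_ccont (b := 0) (c := T1) hw'0 (lexx 0))) => t tt.
  by have [|h1 h2] := hk t; [flra|split=> //; flra].
have k0 : kap 0 = b.
  have [|h1 h2] := hk 0; first by [].
  by apply: (Phi_inj hw0) => //; [flra|rewrite -h2 Phi0].
have k1 : kap T1 = c.
  have [//|h1 h2] := hk T1.
  by apply: (Phi_inj hw0); [flra|flra|rewrite -h2 -eT1].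
have kr T : 0 <= T <= T1 -> b <= kap T <= c.
  move=> /andP[T0 TT]; have [//|h1 h2] := hk T; rewrite h1 /=.
  have c0 : 0 <= c by flra. have k00 : 0 <= kap T by flra.
  apply: (hair_param_le hw0 k00 c0) => n; exists n => //.
  rewrite -h2 eT1; have := Phi_re n hw'0 T0; have := Phi_re n hw'0 T10.
  have := tau_le n (inR0_1 hw'0) T0 TT; rewrite !ler_norml; flra.
have hw'100 : inX (R0 + 100) (Phi w b) by apply: inX_le hw'; flra.
apply: (@no_hair R a U V N (fun T => l (kap T)) T1 (Phi w b) hU hV hUV T10 _ hw'100 (escaping_Phi hw0 ew b0)).
- by apply: (ccont_reparam cl rk) => t /kr; flra.
- move=> u uu; rewrite el; first by have [|_ ->] := hk u; [flra|].
  by have := kr u uu; flra.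
- by rewrite k0.
- by rewrite k1.
Qed.

End Endpoints.

(** * From a path component meeting both open sets to a contradiction *)

Section Final.
Variable R : realType.
Local Notation C := R[i].
Variable a : C.

Local Notation f := (expmap a).
Local Notation F n z := (iter n (expmap a) z).
Local Notation fast := (fast a).
Local Notation tip := (tip a).

Lemma path_component_avoids (U V : C -> Prop) (z0 y1 y2 : C) :
  (forall w, U w -> exists2 r : R, 0 < r & forall z, normc (z - w) < r -> U z) ->
  (forall w, V w -> exists2 r : R, 0 < r & forall z, normc (z - w) < r -> V z) ->
  (forall w, escaping_endpoints f w -> (U w \/ V w) /\ ~ (U w /\ V w)) ->
  path_component R (escaping f) z0 y1 -> path_component R (escaping f) z0 y2 -> U y1 -> ~ V y2.
Proof.
move=> hU hV hUV [g1 [/within_ccont c1 g10 g11 I1]] [g2 [/within_ccont c2 g20 g21 I2]] Uy Vy.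
have hUV' M w : fast (F M w) -> tip (R0 a) (F M w) -> (U w \/ V w) /\ ~ (U w /\ V w).
  by move=> fw tw; apply: hUV; exact: tip_endpoint fw tw.
have hVU' M w : fast (F M w) -> tip (R0 a) (F M w) -> (V w \/ U w) /\ ~ (V w /\ U w).
  by move=> fw tw; have [h1 h2] := hUV' M w fw tw; split; [case: h1; [right|left]|case=> h3 h4; apply: h2].
pose gam t := if t <= 1 then g1 (1 - t) else g2 (t - 1).
have cg : ccont gam 0 2.
  apply: ccont_glue.
  - apply: (ccont_reparam (x := fun t => 1 - t) c1); last by move=> t; flra.
    by apply: (rcont_ext _ (@rcont_affine R (- 1) 1 _ _)) => t _ /=; ring.
  - apply: (ccont_reparam (x := fun t => t - 1) c2); last by move=> t; flra.
    by apply: (rcont_ext _ (@rcont_affine R 1 (- 1) _ _)) => t _ /=; ring.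
  - by rewrite subrr g10 g20.
have gI t : 0 <= t <= 2 -> escaping f (gam t).
  by move=> tt; rewrite /gam; case: (leP t 1) => h; [apply: I1|apply: I2]; flra.
have e0 : gam 0 = y1 by rewrite /gam ler01 subr0.
have e2 : gam 2 = y2 by rewrite /gam leNgt ltr1n /= -g21; congr g2; ring.
have l02 : (0 : R) <= 2 by flra.
have [M hM] := unif_inX (R0 a + 120) (path_unif l02 cg gI).
have hM0 t : 0 <= t <= 2 -> inX a (R0 a) (F M (gam t)).
  by move=> tt; apply: inX_le (hM t tt); flra.
have [s [t1 [g [l [[ss tt1] [gs rg hG] cl el hl]]]]] := hair_lift l02 cg hM0.
have ew : escaping f (F M (gam s)) by apply/(escaping_iter a M); exact: gI.
have i0 : 0 <= (0 : R) <= 2 by flra. have i2 : 0 <= (2 : R) <= 2 by flra.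
have /andP[a0 b0] := hG 0 i0; have /andP[a2 b2] := hG 2 i2.
have Ul : U (l (g 0)) by rewrite -hl // e0.
have Vl : V (l (g 2)) by rewrite -hl // e2.
(* Either of the two points may come first along the hair; [no_hair_between] is applied to [U] and
   [V] in the corresponding order. *)
have [h|/ltW h] := leP (g 0) (g 2).
  exact: (no_hair_between hU hV hUV' a0 h b2 cl (hM s ss) ew el Ul Vl).
exact: (no_hair_between hV hU hVU' a2 h b0 cl (hM s ss) ew el Vl Ul).
Qed.

End Final.

Theorem theorem1p5 (R : realType) (a : R[i])
  (hdense : exists2 z0 : R[i], escaping (expmap a) z0 &
    julia (expmap a) `<=`
      closure (path_component R (escaping (expmap a)) z0)) :
  connected (escaping_endpoints (expmap a)).
Proof.
have [z0 _ hd] := hdense.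
(* Connectedness speaks of a nonempty relatively clopen [B]: the open set [C1] and the complement of
   the closed set [C2] are the two separating sets. *)
move=> B [x1 Bx1] [C1 oC1 e1] [C2 cC2 e2].
apply/seteqP; split => [x|x2 Ex2]; first by rewrite e1 => -[].
apply: contrapT => nB.
have oV : open (~` C2) by exact: closed_openC.
have Ex1 : escaping_endpoints (expmap a) x1 by move: Bx1; rewrite e1 => -[].
have hUV w : escaping_endpoints (expmap a) w -> (C1 w \/ (~` C2) w) /\ ~ (C1 w /\ (~` C2) w).
  move=> Ew; split.
    have [C2w|] := pselect (C2 w); last by right.
    by left; have : B w by [rewrite e2]; rewrite e1 => -[].
  by move=> [C1w]; apply; have : B w by [rewrite e1]; rewrite e2 => -[].
have meet (W : set R[i]) x : open W -> W x -> escaping_endpoints (expmap a) x ->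
    exists2 y, path_component R (escaping (expmap a)) z0 y & W y.
  move=> oW Wx [_ ex]; have := hd x (escaping_julia ex) W.
  by case=> [|y [h1 h2]]; [exact: open_nbhs_nbhs|exists y].
have U1 : C1 x1 by move: Bx1; rewrite e1 => -[].
have V2 : (~` C2) x2 by move=> C2x2; apply: nB; rewrite e2.
have [y1 p1 Uy1] := meet _ _ oC1 U1 Ex1; have [y2 p2 Vy2] := meet _ _ oV V2 Ex2.
exact: (path_component_avoids (open_normc oC1) (open_normc oV) hUV p1 p2 Uy1 Vy2).
Qed.
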